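(* Let $d\ge1$ and let $\mathcal{X}_n=\{X_1,\dots,X_n\}$ be i.i.d. samples in $\mathbb{R}^d$ from the density $f_{\mathrm e}(x)=c_{\mathrm e}e^{-\|x\|}$. Let $\{R_n\}$ be a sequence of positive numbers, and let $\beta_{k,n}=\beta_k\big(\check{C}(\mathcal{X}_n\cap (B_{R_n}(0))^c,1)\big)$. If $\lim_{n\to\infty}ne^{-R_n}=0$, then $$\lim_{n\to\infty}\big(nR_n^{d-1}e^{-R_n}\big)^{-1}\mathbb{E}\{\beta_{0,n}\}=\mu_{\mathrm e,0},$$ $$\lim_{n\to\infty}\big(n^{k+2}R_n^{d-1}e^{-(k+2)R_n}\big)^{-1}\mathbb{E}\{\beta_{k,n}\}=\mu_{\mathrm e,k},\qquad k\ge1,$$ where $\mu_{\mathrm e,0}=s_{d-1}c_{\mathrm e}$ and, for $k\ge 1$, $$\mu_{\mathrm e,k}=\frac{s_{d-1}c_{\mathrm e}^{k+2}}{(k+2)!}\int_0^\infty\int_{(\mathbb{R}^d)^{k+1}}T_k(0,\mathbf{y})\,e^{-\left((k+2)\rho+\sum_{i=1}^{k+1}y_i^1\right)}\prod_{i=1}^{k+1}\mathbf{1}\{y_i^1>-\rho\}\,d\mathbf{y}\,d\rho,$$ with $y_i^1$ the first coordinate of $y_i\in\mathbb{R}^d$.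
   Context: $\|\cdot\|$ is the Euclidean norm; $B_r(x)$ is the closed Euclidean ball of radius $r$ about $x$; $c_{\mathrm e}>0$ is the normalization constant making $f_{\mathrm e}$ a probability density; $s_{d-1}$ is the surface area of the $(d-1)$-dimensional unit sphere in $\mathbb{R}^d$. For a finite set $\mathcal{Y}\subset\mathbb{R}^d$ and $\varepsilon>0$, the Čech complex $\check{C}(\mathcal{Y},\varepsilon)$ is the abstract simplicial complex with vertex set $\mathcal{Y}$ in which $[x_{i_0},\dots,x_{i_m}]$ is a simplex iff $\bigcap_{j=0}^m B_\varepsilon(x_{i_j})\neq\emptyset$. $\beta_k$ denotes the $k$-th Betti number (rank of the $k$-th homology group). For $k\ge1$ and finite $\mathcal{Y}\subset\mathbb{R}^d$, $T_k(\mathcal{Y})=1$ if $|\mathcal{Y}|=k+2$ and $\beta_k(\check{C}(\mathcal{Y},1))=1$, and $T_k(\mathcal{Y})=0$ otherwise; for $\mathbf{y}=(y_1,\dots,y_{k+1})\in(\mathbb{R}^d)^{k+1}$, $T_k(0,\mathbf{y})=T_k(\{0,y_1,\dots,y_{k+1}\})$. *)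

(* Defs.v *)
From HB Require Import structures.
From mathcomp Require Import all_boot all_order all_algebra all_fingroup finmap.
From mathcomp Require Import all_classical all_reals all_analysis.
Import Order.TTheory GRing.Theory Num.Theory.
Import numFieldNormedType.Exports.

Set Implicit Arguments.
Unset Strict Implicit.
Unset Printing Implicit Defensive.

Local Open Scope classical_set_scope.
Local Open Scope ring_scope.

Section sigma_finite_structure.
Context d (T : measurableType d) (R : realType).
Context (nu : {measure set T -> \bar R}).
Context (nu_sf : sigma_finite setT nu).

Let nu' : set T -> \bar R := nu.
HB.instance Definition _ := Measure.on nu'.
HB.instance Definition _ := Measure_isSigmaFinite.Build _ _ _ nu' nu_sf.

Lemma sigma_finite_structure :
  {mu : {sigma_finite_measure set T -> \bar R} | nu = mu :> (_ -> _)}.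
Proof. by exists nu'. Qed.

End sigma_finite_structure.

(* The n-fold product of a sigma-finite measure m, as a measure on n.-tuple T;
   see tuple_measure_box. *)

Section tuple_measure.
Context {d} {T : measurableType d} {R : realType}.

Let tcons n (p : T * n.-tuple T) := [the n.+1.-tuple T of p.1 :: p.2].

Fixpoint tuple_measure (m : set T -> \bar R) (n : nat) {struct n} :
    set (n.-tuple T) -> \bar R :=
  match n with
  | 0 => \d_([tuple] : 0.-tuple T)
  | n'.+1 => pushforward (m \x @tuple_measure m n')%E (@tcons n')
  end.

Arguments tuple_measure m n A : clear implicits.

Context (m : {sigma_finite_measure set T -> \bar R}).

Let mtcons n : measurable_fun setT (@tcons n).
Proof. exact: measurable_cons. Qed.

Let tuncons n (t : n.+1.-tuple T) : T * n.-tuple T :=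
  (thead t, [tuple of behead t]).

Let mtuncons n : measurable_fun setT (@tuncons n).
Proof.
apply/measurable_fun_pair; last exact: measurable_behead.
exact: measurable_tnth.
Qed.

Let tconsK n : cancel (@tcons n) (@tuncons n).
Proof. by case=> x t; congr pair => //; apply/val_inj. Qed.

Let pushforward_tcons_sigma_finite n
    (mu : {sigma_finite_measure set (n.-tuple T) -> \bar R}) :
  sigma_finite setT (pushforward (m \x mu)%E (@tcons n)).
Proof.
have /sigma_finiteP[F [FT ndF mF]] := sigma_finiteT m.
have /sigma_finiteP[G [GT ndG mG]] := sigma_finiteT mu.
exists (fun k => @tuncons n @^-1` (F k `*` G k)).
  rewrite -preimage_bigcup (_ : \bigcup_k _ = setT) ?preimage_setT//.
  rewrite -subTset -setXTT FT GT => -[x y] [/= [i _ Fix] [j _ Gjy]].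
  exists (maxn i j) => //; split.
    by move: x Fix; exact/subsetPset/ndF/leq_maxl.
  by move: y Gjy; exact/subsetPset/ndG/leq_maxr.
move=> k; have [mFk Fkoo] := mF k; have [mGk Gkoo] := mG k; split.
  by rewrite -[_ @^-1` _]setTI; apply: mtuncons => //; exact: measurableX.
rewrite /pushforward (_ : _ @^-1` _ = F k `*` G k).
  by rewrite product_measure1E// lte_mul_pinfty// ge0_fin_numE.
rewrite -comp_preimage (_ : _ \o _ = id)//.
by apply/funext => p; exact: tconsK.
Qed.

Let tuple_measure_structure n :
  {mu : {sigma_finite_measure set (n.-tuple T) -> \bar R} |
     tuple_measure m n = mu :> (_ -> _)}.
Proof.
elim: n => [|n [mu IH]]; first by exists \d_([tuple] : 0.-tuple T).
pose nu := measure_function_pushforward__canonical__measure_function_Measure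
  (m \x mu)%E (@mtcons n).
have [mu' nuE] := sigma_finite_structure (nu := nu) (@pushforward_tcons_sigma_finite n mu).
by exists mu'; rewrite -nuE /= IH.
Qed.

Context (n : nat).

Let tuple_measure0 : tuple_measure m n set0 = 0%E.
Proof. by have [mu ->] := tuple_measure_structure n; exact: measure0. Qed.

Let tuple_measure_ge0 A : (0 <= tuple_measure m n A)%E.
Proof. by have [mu ->] := tuple_measure_structure n; exact: measure_ge0. Qed.

Let tuple_measure_sigma_additive : semi_sigma_additive (tuple_measure m n).
Proof.
have [mu ->] := tuple_measure_structure n.
exact: measure_semi_sigma_additive.
Qed.

HB.instance Definition _ := isMeasure.Build _ _ _ (tuple_measure m n)
  tuple_measure0 tuple_measure_ge0 tuple_measure_sigma_additive.

Let tuple_measure_sigma_finite : sigma_finite setT (tuple_measure m n).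
Proof. by have [mu ->] := tuple_measure_structure n; exact: sigma_finiteT. Qed.

HB.instance Definition _ := Measure_isSigmaFinite.Build _ _ _
  (tuple_measure m n) tuple_measure_sigma_finite.

End tuple_measure.
Arguments tuple_measure {d T R} m n A : simpl never.

Lemma tuple_measure_box d (T : measurableType d) (R : realType)
    (m : {sigma_finite_measure set T -> \bar R}) n (A : 'I_n -> set T) :
  (forall i, measurable (A i)) ->
  tuple_measure m n [set t | forall i, A i (tnth t i)] =
  (\prod_(i < n) m (A i))%E.
Proof.
elim: n A => [|n IH] A mA.
  rewrite big_ord0 /tuple_measure /dirac indicE mem_set//.
  by move=> [].
rewrite big_ord_recl -IH// -product_measure1E//; last first.
  rewrite (_ : mkset _ = \bigcap_(i in [set: 'I_n]) ((@tnth n T)^~ i @^-1` A (lift ord0 i))).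
    apply: fin_bigcap_measurable => [|i _]; first exact: finite_finset.
    by rewrite -[_ @^-1` _]setTI; exact: measurable_tnth.
  by apply/seteqP; split => t tA i; [move=> _|]; exact: (tA i).
rewrite /tuple_measure -/(tuple_measure m n) /pushforward.
congr (_ _); apply/seteqP; split => -[x t] /= xtA.
  split; first exact: (xtA ord0).
  by move=> i; have := xtA (lift ord0 i); rewrite tnthS.
move=> i; case: (unliftP ord0 i) => [j ->|->]; last exact: xtA.1.
by rewrite tnthS; exact: xtA.2.
Qed.

(* Points of R^d are d-tuples: the tuple type carries the product (Borel)
   sigma-algebra, and its geometry below is the Euclidean one. *)

(* lebesgue_measure lives on measurableTypeR R, i.e., R with a display other than
   the canonical one but the same sigma-algebra; the alias lebesgueR is the same
   measure on R with its canonical display. *)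
Section lebesgueR.
Context {R : realType}.

Definition lebesgueR : set R -> \bar R := lebesgue_measure.

Let lebesgueR0 : lebesgueR set0 = 0%E.
Proof. exact: (measure0 (@lebesgue_measure R)). Qed.

Let lebesgueR_ge0 A : (0 <= lebesgueR A)%E.
Proof. exact: (measure_ge0 (@lebesgue_measure R)). Qed.

Let lebesgueR_sigma_additive : semi_sigma_additive lebesgueR.
Proof. exact: (@measure_semi_sigma_additive _ _ _ (@lebesgue_measure R)). Qed.

HB.instance Definition _ := isMeasure.Build _ _ _ lebesgueR
  lebesgueR0 lebesgueR_ge0 lebesgueR_sigma_additive.

Let lebesgueR_sigma_finite : sigma_finite setT lebesgueR.
Proof. exact: (sigma_finiteT (@lebesgue_measure R)). Qed.

HB.instance Definition _ := Measure_isSigmaFinite.Build _ _ _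
  lebesgueR lebesgueR_sigma_finite.

End lebesgueR.

(* Lebesgue measure on R^d. *)
Definition lebesgue_tuple {R : realType} (d : nat) :
    set (d.-tuple R) -> \bar R :=
  tuple_measure lebesgueR d.
Arguments lebesgue_tuple {R} d A.

HB.instance Definition _ (R : realType) (d : nat) :=
  SigmaFiniteMeasure.on (@lebesgue_tuple R d).

Lemma lebesgue_tuple_box (R : realType) (d : nat) (A : 'I_d -> set R) :
  (forall i, measurable (A i)) ->
  lebesgue_tuple d [set x | forall i, A i (tnth x i)] =
  (\prod_(i < d) lebesgue_measure (A i))%E.
Proof. exact: tuple_measure_box. Qed.

Section euclidean.
Context {R : realType} {d : nat}.
Implicit Types x y : d.-tuple R.

Definition origin : d.-tuple R := [tuple 0 | i < d].

Definition enorm x : R := Num.sqrt (\sum_(i < d) tnth x i ^+ 2).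

Definition edist x y : R := enorm [tuple tnth x i - tnth y i | i < d].

Definition eball (r : R) x : set (d.-tuple R) := [set y | edist x y <= r].

End euclidean.

(* Surface area of the unit sphere of R^d, as a Minkowski content: the volume
   of the closed e-neighbourhood of the sphere, divided by 2e, as e -> 0+. *)
Definition sphere_area (R : realType) (d : nat) : R :=
  let sphere := [set u : d.-tuple R | enorm u = 1] in
  let tube (e : R) := \bigcup_(u in sphere) eball e u in
  lim ((fine (lebesgue_tuple d (tube e)) / (2 * e)) @[e --> 0^'+]).

(* Simplicial homology with integer coefficients of an abstract simplicial
   complex K (a family of nonempty subsets of V, closed under nonempty subsets).
   A k-chain is an alternating function c on ordered (k+1)-tuples of vertices,
   c (v_0, ..., v_k) being the coefficient of the oriented simplex
   [v_0, ..., v_k]. As [t] occurs with sign +1 in the boundary of [v, t], the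
   coefficient of [t] in the boundary of c is the sum of c (v, t) over v. *)
Section homology.
Context (V : finType) (K : {set {set V}}).
Implicit Types k : nat.

Definition is_chain k (c : {ffun k.+1.-tuple V -> int}) : Prop :=
  (forall t, c t != 0 -> uniq t && ([set v in t]%SET \in K)) /\
  (forall (s : 'S_k.+1) (t : k.+1.-tuple V),
     c [tuple tnth t (s i) | i < k.+1] = (-1) ^+ s * c t).

Definition boundary k (c : {ffun k.+2.-tuple V -> int}) :
    {ffun k.+1.-tuple V -> int} :=
  [ffun t : k.+1.-tuple V => \sum_(v : V) c [tuple of v :: t]].

Definition is_cycle k : {ffun k.+1.-tuple V -> int} -> Prop :=
  match k with
  | 0 => @is_chain 0
  | k'.+1 => fun c => @is_chain k'.+1 c /\ boundary c = 0
  end.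

Definition is_boundary k (c : {ffun k.+1.-tuple V -> int}) : Prop :=
  exists2 b : {ffun k.+2.-tuple V -> int}, is_chain b & c = boundary b.

(* The classes of the cycles z_i are Z-linearly independent in the quotient of
   the group of k-cycles by the group of k-boundaries. *)
Definition homology_independent k m (z : 'I_m -> {ffun k.+1.-tuple V -> int}) :
    Prop :=
  (forall i, is_cycle (z i)) /\
  (forall a : 'I_m -> int,
     is_boundary (\sum_(i < m) z i *~ a i) -> forall i, a i = 0).

(* The rank of the k-th homology group; it is at most the number of
   k-simplices, so the bound m <= #|K| is harmless. *)
Definition betti k : nat :=
  \max_(m < #|K|.+1 |
        `[< exists z : 'I_m -> {ffun k.+1.-tuple V -> int},
              homology_independent z >]) m.

End homology.

Section cech.
Context {R : realType} {d : nat}.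

Definition cech (Y : {fset d.-tuple R}) (eps : R) : {set {set Y}} :=
  [set s : {set Y} | (s != finset.set0) &&
     `[< \bigcap_(x in [set` s]) eball eps (val x) !=set0 >]]%SET.

Definition T_set (k : nat) (Y : {fset d.-tuple R}) : bool :=
  (#|` Y | == k.+2) && (betti (cech Y 1) k == 1%N).

Definition T_zero (k : nat) (y : k.+1.-tuple (d.-tuple R)) : bool :=
  T_set k (origin |` [fset x in tval y])%fset.

End cech.

Definition f_e {R : realType} {d : nat} (c_e : R) (x : d.-tuple R) : R :=
  c_e * expR (- enorm x).

Section model.
Context {R : realType} {d : nat}.
Context {dO : measure_display} {Omega : measurableType dO}.
Context {P : probability Omega R}.

Definition has_density (X : {RV P >-> d.-tuple R}) (f : d.-tuple R -> R) :
    Prop :=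
  forall A, measurable A ->
    distribution P X A = (\int[lebesgue_tuple d]_(x in A) (f x)%:E)%E.

Definition mutually_independent (X : nat -> {RV P >-> d.-tuple R}) : Prop :=
  forall (J : {fset nat}) (A : nat -> set (d.-tuple R)),
    (forall i, measurable (A i)) ->
    P (\bigcap_(i in [set` J]) X i @^-1` A i) =
    (\prod_(i <- J) P (X i @^-1` A i))%E.

Definition sample (X : nat -> {RV P >-> d.-tuple R}) (n : nat) (w : Omega) :
    {fset d.-tuple R} :=
  [fset X (val i) w | i in 'I_n]%fset.

Definition betti_outside (X : nat -> {RV P >-> d.-tuple R}) (r : R^nat)
    (k n : nat) (w : Omega) : nat :=
  betti (cech [fset x in sample X n w | x \in ~` eball (r n) origin]%fset 1) k.

End model.

Definition mu_e0 {R : realType} (d : nat) (c_e : R) : R :=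
  sphere_area R d * c_e.

(* The first coordinate of y_i is entry 0 of the tuple tnth y i. *)
Definition mu_e {R : realType} (d : nat) (c_e : R) (k : nat) : \bar R :=
  ((sphere_area R d * c_e ^+ k.+2 / (k.+2)`!%:R)%:E *
   \int[lebesgue_measure]_(rho in `[0%R, +oo[)
     \int[tuple_measure (lebesgue_tuple d) k.+1]_y
       ((T_zero y)%:R *
        expR (- (k.+2%:R * rho + \sum_(i < k.+1) (tnth y i)`_0)) *
        \prod_(i < k.+1) (- rho < (tnth y i)`_0)%R%:R)%:E)%E.

(* Main.v *)
Require Import Defs.
From HB Require Import structures.
From mathcomp Require Import all_boot all_order all_algebra all_fingroup finmap.
From mathcomp Require Import all_classical all_reals all_analysis.
From mathcomp Require Import measurable_realfun ring lra zify.
Import Order.TTheory GRing.Theory Num.Theory.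
Import numFieldNormedType.Exports.

Set Implicit Arguments.
Unset Strict Implicit.
Unset Printing Implicit Defensive.

Local Open Scope classical_set_scope.
Local Open Scope ring_scope.

(** Far from the origin the sample is so sparse that the Betti number counts the
    smallest configurations which carry homology, and the expectation of a count is
    an integral.

    Let O be the set of sample points outside of the ball of radius R_n. Call a set
    of k+2 points hollow when its unit balls have no common point although those of
    every proper subset do; by betti_hollow this is the condition T_k = 1. A connected
    component of the Cech complex with exactly k+2 points contributes 1 to beta_k if
    it is hollow and 0 otherwise, and smaller components contribute nothing. In larger
    components, everything of relevance lies in sets of k+3 points with diameter at
    most 6, called clusters. This yields a comparison that holds for every
    configuration (betti_cech_le, betti_cech_ge):
    beta_k and the number of hollow sets differ by at most 2 ^ (k+3) times the number
    of clusters. For k = 0, the hollow sets are replaced by the points and the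
    clusters by the pairs of points at distance at most 6 (betti0_cech_le,
    betti0_cech_ge).

    It remains to estimate the expected number of sets of m+1 sample points in O
    which form a configuration in a given set A, invariant under isometries and
    bounded. By independence it is the binomial coefficient (n choose m+1) times the
    mass that the product density gives to A outside of the ball
    (expectation_cluster_count). To evaluate this mass for a radius rho, one uses the
    positions y of the other points relative to the first point x. As Lebesgue measure
    and A are invariant under reflections, the integral over y depends only on the
    norm of x (outer_mass_axis), so that polar coordinates reduce the problem to
    x = (rho + t) e_1. Each point contributes e^{-rho} and the Jacobian contributes
    s_{d-1} (rho + t)^{d-1}; after division by rho^{d-1} e^{-(m+1) rho} there is a
    limit by dominated convergence, because |(rho + t) e_1 + y| - rho tends to
    t + y^1 (axis_excess_cvg, cluster_mass_cvg_pinfty). For the hollow configurations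
    this limit is the integral in mu_{e,k}.

    Since the count of m+1 points has order n^{m+1} R_n^{d-1} e^{-(m+1) R_n}, the
    clusters, which have one more point than the hollow sets, contribute less by a
    factor n e^{-R_n}, which tends to 0. The expectation of beta_k is thus squeezed
    between two quantities with the same limit (expectation_squeeze). *)

(** * Bounds on the Betti numbers of a simplicial complex *)

(** A nonzero rational kernel vector exists by counting dimensions; clearing its
    denominators makes it integral. *)
Lemma int_dependence m N (A : 'I_m -> 'I_N -> int) : (N < m)%N ->
  exists2 a : 'I_m -> int, (exists i, a i != 0) &
    forall j, \sum_(i < m) A i j * a i = 0.
Proof.
move=> Nm; pose M : 'M[rat]_(m, N) := \matrix_(i, j) (A i j)%:~R.
have /rowV0Pn[v /sub_kermxP vM v0] : kermx M != 0.
  rewrite kermx_eq0; apply/negP => /eqP rM.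
  by have := rank_leq_col M; rewrite rM leqNgt Nm.
pose D : int := \prod_j denq (v ord0 j).
have D0 : D != 0 by apply/prodf_neq0 => j _; exact: denq_neq0.
pose a i := numq (v ord0 i) * \prod_(j | j != i) denq (v ord0 j).
have aE i : (a i)%:~R = v ord0 i * D%:~R :> rat.
  by rewrite /D (bigD1 i)//= !intrM mulrA -numqE.
exists a.
  have /existsP[i vi] : [exists i, v ord0 i != 0].
    apply: contraNT v0; rewrite negb_exists => /forallP v0.
    by apply/eqP/rowP => i; rewrite mxE; apply/eqP; move: (v0 i); rewrite negbK.
  by exists i; rewrite -(intr_eq0 rat) aE mulf_neq0// intr_eq0.
move=> j; apply/eqP; rewrite -(intr_eq0 rat) rmorph_sum/=.
under eq_bigr do rewrite rmorphM /= aE mulrA mulrC.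
rewrite -big_distrr /=; have /matrixP/(_ ord0 j) := vM.
rewrite !mxE => vM0; rewrite (eq_bigr (fun i => v ord0 i * M i j)) ?vM0 ?mulr0//.
by move=> i _; rewrite mxE mulrC.
Qed.

Section chains.
Import boot.fintype boot.finset.
Local Open Scope set_scope.
Variable V : finType.
Implicit Types (K : {set {set V}}) (Z : {set V}).

Lemma ffunMzE (aT : finType) (f : {ffun aT -> int}) (a : int) t :
  (f *~ a) t = f t * a.
Proof.
by case: a => n; rewrite ?NegzE ?mulrNz -?pmulrn ?ffunE ?ffunMnE ?mulrN -mulrzz -?pmulrn.
Qed.

Definition alternating n (c : {ffun n.-tuple V -> int}) :=
  forall (s : 'S_n) (t : n.-tuple V),
    c [tuple tnth t (s i) | i < n] = (-1) ^+ s * c t.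

(** The value of an alternating chain on a simplex is determined up to sign by the
    vertex set, so its vanishing can be tested on any ordering. *)
Lemma alternating_perm n (c : {ffun n.-tuple V -> int}) (t t' : n.-tuple V) :
  alternating c -> perm_eq t t' -> c t = 0 -> c t' = 0.
Proof.
by move=> altc; rewrite perm_sym => /tuple_permP[s /val_inj ->] ct; rewrite altc ct mulr0.
Qed.

Lemma perm_tuple_set n (t t' : n.-tuple V) :
  uniq t -> uniq t' -> [set v in t] = [set v in t'] -> perm_eq t t'.
Proof.
move=> ut ut' tt'; apply: uniq_perm => // v.
by have /setP/(_ v) := tt'; rewrite !inE.
Qed.

Lemma set_tuple n Z : #|Z| = n -> exists t : n.-tuple V, uniq t /\ [set v in t] = Z.
Proof.
move=> Zn; have sz : size (enum Z) == n by rewrite -cardE Zn.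
exists (Tuple sz); split; first exact: enum_uniq.
by apply/setP => v; rewrite !inE mem_enum.
Qed.

Lemma card_set_tuple n (t : n.-tuple V) : uniq t -> #|[set v in t]| = n.
Proof. by move=> ut; rewrite cardsE (card_uniqP ut) size_tuple. Qed.

Lemma set_cons n v (t : n.-tuple V) :
  [set u in [tuple of v :: t]] = v |: [set u in t].
Proof. by apply/setP => u; rewrite !inE. Qed.

Lemma boundary_neq0 k (c : {ffun k.+2.-tuple V -> int}) t :
  boundary c t != 0 -> exists v, c [tuple of v :: t] != 0.
Proof.
rewrite ffunE => cn0; apply/existsP; apply: contraNT cn0.
by rewrite negb_exists => /forallP c0; rewrite big1// => v _; apply/eqP; rewrite -[_ == _]negbK.
Qed.

Lemma boundary_alternating k (c : {ffun k.+2.-tuple V -> int}) :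
  alternating c -> alternating (boundary c).
Proof.
move=> altc s t; rewrite !ffunE mulr_sumr; apply: eq_bigr => v _.
rewrite (_ : [tuple of v :: _] =
    [tuple tnth [tuple of v :: t] (lift_perm ord0 ord0 s i) | i < _]).
  by rewrite altc odd_lift_perm.
apply: eq_from_tnth => i; rewrite tnth_mktuple.
case: (unliftP ord0 i) => [j ->|->]; last by rewrite lift_perm_id.
by rewrite lift_perm_lift !tnthS tnth_mktuple.
Qed.

Lemma alternating_swap k (c : {ffun k.+2.-tuple V -> int}) v w (t : k.-tuple V) :
  alternating c -> c [tuple of [:: v, w & t]] = - c [tuple of [:: w, v & t]].
Proof.
move=> altc.
have := altc (tperm ord0 (lift ord0 ord0)) [tuple of [:: w, v & t]].
rewrite odd_tperm /= expr1 mulN1r => <-; congr (c _).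
apply: eq_from_tnth => i; rewrite tnth_mktuple.
case: tpermP => [->|->|] //.
case: (unliftP ord0 i) => [j ->|->//].
case: (unliftP ord0 j) => [l ->|->//] _ _.
by rewrite !tnthS.
Qed.

(** The double sum over the two added vertices changes sign when they are
    exchanged. *)
Lemma boundaryK k (c : {ffun k.+3.-tuple V -> int}) :
  alternating c -> boundary (boundary c) = 0.
Proof.
move=> altc; apply/ffunP => t; rewrite !ffunE.
under eq_bigr do rewrite ffunE.
set S := (X in X = _); suff : S = - S by lia.
rewrite {2}/S exchange_big -sumrN; apply: eq_bigr => v _.
by rewrite -sumrN; apply: eq_bigr => w _; exact: alternating_swap.
Qed.

Lemma boundaryB k (c c' : {ffun k.+2.-tuple V -> int}) :
  boundary (c - c') = boundary c - boundary c'.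
Proof.
by apply/ffunP => t; rewrite !ffunE -sumrB; apply: eq_bigr => v _; rewrite !ffunE.
Qed.

Lemma boundary_sum k m (z : 'I_m -> {ffun k.+2.-tuple V -> int}) (a : 'I_m -> int) :
  boundary (\sum_i z i *~ a i) = \sum_i boundary (z i) *~ a i.
Proof.
apply/ffunP => t; rewrite !ffunE sum_ffunE.
under eq_bigr do rewrite sum_ffunE.
rewrite exchange_big; apply: eq_bigr => i _.
by rewrite ffunMzE ffunE mulr_suml; apply: eq_bigr => v _; rewrite ffunMzE.
Qed.

Lemma alternating_sum n m (z : 'I_m -> {ffun n.-tuple V -> int}) (a : 'I_m -> int) :
  (forall i, alternating (z i)) -> alternating (\sum_i z i *~ a i).
Proof.
move=> altz s t; rewrite !sum_ffunE mulr_sumr; apply: eq_bigr => i _.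
by rewrite !ffunMzE altz mulrA.
Qed.

Lemma sum_neq0 n m (z : 'I_m -> {ffun n.-tuple V -> int}) (a : 'I_m -> int) t :
  (\sum_i z i *~ a i) t != 0 -> exists2 i, z i t != 0 & a i != 0.
Proof.
rewrite sum_ffunE => z0.
have /existsP[i] : [exists i, z i t * a i != 0].
  apply: contraNT z0; rewrite negb_exists => /forallP z0.
  by rewrite big1// => i _; rewrite ffunMzE; apply/eqP; rewrite -[_ == _]negbK.
by rewrite mulf_eq0 negb_or => /andP[]; exists i.
Qed.

Lemma is_cycle_sum K k m (z : 'I_m -> {ffun k.+1.-tuple V -> int}) (a : 'I_m -> int) :
  (forall i, is_cycle K (z i)) -> is_cycle K (\sum_i z i *~ a i).
Proof.
have chain_sum n (c : 'I_m -> {ffun n.+1.-tuple V -> int}) :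
    (forall i, is_chain K (c i)) -> is_chain K (\sum_i c i *~ a i).
  move=> cc; split; last by apply: alternating_sum => i; exact: (cc i).2.
  by move=> t /sum_neq0[i ci _]; exact: (cc i).1.
case: k z => [|k] z cz; first exact: chain_sum.
split; first by apply: chain_sum => i; exact: (cz i).1.
rewrite boundary_sum big1// => i _; rewrite (cz i).2.
by apply/ffunP => t; rewrite ffunMzE !ffunE mul0r.
Qed.

(** More cycles than test simplices have a nontrivial integral combination that
    vanishes on all the test simplices; being a boundary, it contradicts the
    independence of their classes. *)
Lemma betti_le K k (L : seq (k.+1.-tuple V)) :
  (forall z, is_cycle K z -> {in L, forall t, z t = 0} -> is_boundary K z) ->
  (betti K k <= size L)%N.
Proof.
move=> LK; apply/bigmax_leqP => m /asboolP[z [cz iz]].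
rewrite leqNgt; apply/negP => Lm.
have [a [i ai0] aL] := int_dependence (fun i j => z i (tnth (in_tuple L) j)) Lm.
have : is_boundary K (\sum_i z i *~ a i).
  apply: LK; first exact: is_cycle_sum.
  move=> t tL; have /tnthP[j ->] : t \in in_tuple L by [].
  by rewrite sum_ffunE -[RHS](aL j); apply: eq_bigr => l _; rewrite ffunMzE.
by move=> /iz/(_ i) /eqP; rewrite (negbTE ai0).
Qed.

Lemma betti_ge K k m (z : 'I_m -> {ffun k.+1.-tuple V -> int}) :
  (m <= #|K|)%N -> homology_independent K z -> (m <= betti K k)%N.
Proof.
rewrite -ltnS => mK zi.
apply: (@leq_bigmax_cond _ _ (fun i : 'I_#|K|.+1 => i : nat) (Ordinal mK)).
by apply/asboolP; exists z.
Qed.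

(** The oriented simplex with ordered vertices t0, as an alternating function. *)
Definition simplex_chain n (t0 : n.-tuple V) : {ffun n.-tuple V -> int} :=
  [ffun t => \sum_(s : 'S_n | [tuple tnth t0 (s i) | i < n] == t) (-1) ^+ s].

Lemma simplex_chain_alternating n (t0 : n.-tuple V) :
  alternating (simplex_chain t0).
Proof.
move=> s t; rewrite !ffunE (reindex_inj (mulgI s))/= mulr_sumr.
apply: eq_big => [u|u _]; last by rewrite odd_permM signr_addb.
apply/eqP/eqP => tE; last first.
  by rewrite -tE; apply: eq_from_tnth => i; rewrite !tnth_mktuple permM.
apply: eq_from_tnth => i.
have /(congr1 (fun x => tnth x (s^-1 i)%g)) := tE.
by rewrite !tnth_mktuple permM permKV.
Qed.

Lemma simplex_chain_neq0 n (t0 t : n.-tuple V) :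
  simplex_chain t0 t != 0 -> perm_eq t t0.
Proof.
rewrite ffunE => e0; apply/tuple_permP.
have /existsP[s /eqP st] :
    [exists s : 'S_n, [tuple tnth t0 (s i) | i < n] == t].
  apply: contraNT e0; rewrite negb_exists => /forallP e0.
  by rewrite big_pred0// => s; apply/negbTE.
by exists s; rewrite st.
Qed.

Lemma simplex_chain1 n (t0 : n.-tuple V) : uniq t0 -> simplex_chain t0 t0 = 1.
Proof.
move=> ut; rewrite ffunE (big_pred1 1%g) ?odd_perm1// => s /=.
apply/eqP/eqP => [ts|->]; last first.
  by apply: eq_from_tnth => i; rewrite tnth_mktuple perm1.
apply/permP => i; rewrite perm1.
have /(congr1 (fun x => tnth x i)) := ts; rewrite tnth_mktuple.
by move/tuple_uniqP : ut => /[apply].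
Qed.

Lemma facetP n (t : n.-tuple V) Z :
  uniq t -> #|Z| = n.+1 -> [set u in t] \subset Z ->
  exists2 v, v \in Z & [set u in t] = Z :\ v.
Proof.
move=> ut Zn tZ; have /cards1P[v vE] : #|Z :\: [set u in t]| == 1%N.
  by rewrite cardsD (setIidPr tZ) Zn card_set_tuple// subSnn.
have : v \in Z :\: [set u in t] by rewrite vE set11.
rewrite inE => /andP[vt vZ]; exists v => //.
by rewrite -vE setDDr setDv set0U (setIidPr tZ).
Qed.

(** Two facets of Z share a face s with one vertex less, and the only simplices on
    which z may be nonzero and which contain s are these two facets: the equation
    boundary z = 0 at s makes the two coefficients agree up to sign. *)
Lemma cycle_spread k (z : {ffun k.+2.-tuple V -> int}) Z :
  alternating z -> (forall t, z t != 0 -> uniq t) -> boundary z = 0 ->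
  #|Z| = k.+3 ->
  (forall v (t : k.+1.-tuple V), v \notin Z -> [set u in t] \subset Z ->
     z [tuple of v :: t] = 0) ->
  forall t0 t : k.+2.-tuple V, uniq t0 -> [set u in t0] \subset Z ->
    [set u in t] \subset Z -> z t0 = 0 -> z t = 0.
Proof.
move=> altz uz bz Zk zout t0 t ut0 t0Z tZ zt0.
apply/eqP/negPn/negP => zt; have ut := uz _ zt; move/eqP: zt; apply.
have [v0 v0Z t0E] := facetP ut0 Zk t0Z.
have [v vZ tE] := facetP ut Zk tZ.
have [vv0|vv0] := eqVneq v v0.
  by apply: alternating_perm zt0 => //; apply: perm_tuple_set; rewrite // t0E tE vv0.
have [|s [us sE]] := @set_tuple k.+1 (Z :\ v0 :\ v).
  by move: Zk; rewrite (cardsD1 v0) v0Z (cardsD1 v) !inE vv0 vZ => -[].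
have v0s : v0 \notin [set u in s] by rewrite sE !inE eqxx /= andbF.
have vs : v \notin [set u in s] by rewrite sE !inE eqxx.
have zvs : z [tuple of v :: s] = 0.
  apply: alternating_perm zt0 => //; apply: perm_tuple_set => //.
    by rewrite /= us andbT; rewrite inE in vs.
  by rewrite set_cons sE setD1K ?t0E// !inE vv0.
suff : z [tuple of v0 :: s] = 0.
  apply: alternating_perm => //; apply: perm_tuple_set => //.
    by rewrite /= us andbT; rewrite inE in v0s.
  rewrite set_cons sE tE; apply/setP => u; rewrite !inE.
  by case: (eqVneq u v0) => [->|]; rewrite ?v0Z 1?eq_sym ?vv0.
have /ffunP/(_ s) := bz; rewrite !ffunE (bigD1 v)//= zvs add0r (bigD1 v0) 1?eq_sym//=.
rewrite big1 ?addr0// => u /andP[uv uv0].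
have [uZ|uZ] := boolP (u \in Z); last first.
  by apply: zout => //; rewrite sE; apply/subsetP => x; rewrite !inE => /and3P[].
apply/eqP/negPn/negP => /uz /=; suff -> : u \in s by [].
by have /setP/(_ u) := sE; rewrite !inE => ->; rewrite uv uv0.
Qed.

Definition down_closed K :=
  forall s t : {set V}, s \in K -> t \subset s -> t != set0 -> t \in K.

(** Among simplicial complexes, this says that Z is a union of connected
    components. *)
Definition isolated K Z :=
  [forall u in Z, forall x, (x \notin Z) ==> ([set u; x] \notin K)].

(** A minimal nonface: the boundary of a simplex whose interior is missing. *)
Definition hollow K Z := (Z \notin K) && [forall v in Z, Z :\ v \in K].

(** For a face s and n = #|s|.+1, this says that the connected component of s has
    more than n vertices. *)
Definition crowded K n (s : {set V}) :=
  [exists w, exists u in s, (w \notin s) && ([set u; w] \in K)] &&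
  ~~ [exists Z : {set V}, [&& s \subset Z, #|Z| == n & isolated K Z]].

Lemma isolatedP K Z u x :
  isolated K Z -> u \in Z -> [set u; x] \in K -> x \in Z.
Proof.
move=> /forall_inP/(_ u) /[apply] /forallP/(_ x).
by case: (x \in Z) => //= /negbTE ->.
Qed.

Lemma isolated_simplex K Z (s : {set V}) u : down_closed K ->
  isolated K Z -> s \in K -> u \in s -> u \in Z -> s \subset Z.
Proof.
move=> dK iZ sK us uZ; apply/subsetP => x xs; apply: (isolatedP iZ uZ).
apply: (dK _ _ sK); first by apply/subsetP => y /set2P[] ->.
by apply/set0Pn; exists u; rewrite set21.
Qed.

Lemma isolated_spread K k (z : {ffun k.+2.-tuple V -> int}) Z :
  down_closed K -> is_cycle K z -> isolated K Z -> #|Z| = k.+3 ->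
  forall t0 t : k.+2.-tuple V, uniq t0 -> [set u in t0] \subset Z ->
    [set u in t] \subset Z -> z t0 = 0 -> z t = 0.
Proof.
move=> dK [[Kz altz] bz] iZ Zk; apply: cycle_spread => //.
  by move=> t /Kz /andP[].
move=> v t vZ tZ; apply/eqP/negPn/negP => /Kz /andP[_ vtK].
have ut : thead t \in t by rewrite mem_tnth.
suff /subsetP/(_ v) : [set u in [tuple of v :: t]] \subset Z.
  by rewrite set_cons setU11 (negbTE vZ) => /(_ isT).
apply: (isolated_simplex dK iZ vtK (u := thead t)).
  by rewrite !inE ut orbT.
by move/subsetP : tZ; apply; rewrite inE.
Qed.

Lemma set_behead n (t : n.+1.-tuple V) :
  [set u in [tuple of behead t]] \subset [set u in t].
Proof. by apply/subsetP => u; rewrite !inE => /mem_behead. Qed.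

Lemma thead_behead n (t : n.+1.-tuple V) :
  [tuple of thead t :: [tuple of behead t]] = t.
Proof. by rewrite [RHS]tuple_eta; exact: val_inj. Qed.

Lemma boundary_simplex_chain_cycle K k (t : k.+3.-tuple V) :
  uniq t -> (forall v, v \in t -> [set u in t] :\ v \in K) ->
  is_cycle K (boundary (simplex_chain t)).
Proof.
move=> ut tK; split; last exact/boundaryK/simplex_chain_alternating.
split; last exact/boundary_alternating/simplex_chain_alternating.
move=> s /boundary_neq0[v /simplex_chain_neq0 vst].
have : uniq (v :: s) by rewrite (perm_uniq vst).
rewrite cons_uniq => /andP[vs us].
have vt : v \in t by rewrite -(perm_mem vst) mem_head.
rewrite us/=; suff -> : [set u in s] = [set u in t] :\ v by exact: tK.
apply/setP => u; rewrite !inE -(perm_mem vst) inE.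
by case: eqVneq => //= ->; exact/negbTE.
Qed.

(** Modulo boundaries, a cycle is determined by its coefficients on one facet of each
    hollow set and on the crowded simplices. Indeed, a simplex with a neighbour that
    is not crowded lies in a component Z with one more vertex. If Z is a face, a
    multiple of its boundary can be subtracted to make the cycle vanish there; if it
    is not, the coefficient on one facet decides, and a nonzero one requires Z to be
    hollow. A simplex without neighbours supports no cycle. *)
Lemma betti_upper K k : down_closed K ->
  (betti K k.+1 <= #|[set Z : {set V} | (#|Z| == k.+3) && hollow K Z]| +
     #|[set s in K | (#|s| == k.+2) && crowded K k.+3 s]|)%N.
Proof.
move=> dK; set T := (X in (_ <= #|X| + _)%N); set B := (X in (_ <= _ + #|X|)%N).
have /fin_all_exists[f fT] (i : 'I_#|T|) : exists t : k.+2.-tuple V,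
    uniq t /\ [set u in t] \subset enum_val i.
  have /[!inE]/andP[/eqP Ti _] := enum_valP i.
  have [t [ut tE]] := set_tuple Ti.
  exists [tuple of behead t]; split; last by rewrite -tE set_behead.
  by move: ut; rewrite [t]tuple_eta => /andP[].
have /fin_all_exists[g gB] (i : 'I_#|B|) : exists t : k.+2.-tuple V,
    uniq t /\ [set u in t] = enum_val i.
  have /[!inE]/and3P[_ /eqP Bi _] := enum_valP i.
  exact: set_tuple.
(* The test simplices are the f i (one facet per hollow set) and the g i (the
   crowded simplices). *)
rewrite -[#|T|]card_ord -(size_codom f) -[#|B|]card_ord -(size_codom g) -size_cat.
apply: betti_le => z cz zL.
(* The fillable components: b is chosen so that z - boundary b vanishes on one
   facet of each, hence on all of them. *)
pose S := [set Z in K | (#|Z| == k.+3) && isolated K Z].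
have /fin_all_exists[h hS] (i : 'I_#|S|) : exists t : k.+3.-tuple V,
    uniq t /\ [set u in t] = enum_val i.
  have /[!inE]/and3P[_ /eqP Si _] := enum_valP i.
  exact: set_tuple.
have hK i : [set u in h i] \in K.
  by rewrite (hS i).2; have /[!inE]/andP[] := enum_valP i.
have hiso i : isolated K [set u in h i].
  by rewrite (hS i).2; have /[!inE]/and3P[] := enum_valP i.
have hcard i : #|[set u in h i]| = k.+3 by exact/card_set_tuple/(hS i).1.
pose b : {ffun k.+3.-tuple V -> int} :=
  \sum_(i < #|S|) simplex_chain (h i) *~ z [tuple of behead (h i)].
have bK : is_chain K b.
  split; last by apply: alternating_sum => i; exact: simplex_chain_alternating.
  move=> t /sum_neq0[i /simplex_chain_neq0 tp _].
  rewrite (perm_uniq tp) (hS i).1 /=; suff -> : [set v in t] = [set v in h i] by exact: hK.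
  by apply/setP => v; rewrite !inE (perm_mem tp).
exists b => //; apply/eqP; rewrite -subr_eq0; apply/eqP.
set z' := (X in X = 0).
have z'E t : z' t = z t - boundary b t by rewrite ffunE [X in _ + X]ffunE.
have bsupp t : boundary b t != 0 -> exists i, [set u in t] \subset [set u in h i].
  move=> /boundary_neq0[v /sum_neq0[i /simplex_chain_neq0 tp _]].
  by exists i; apply/subsetP => u; rewrite !inE -(perm_mem tp) inE orbC => ->.
have cz' : is_cycle K z'.
  case: (cz) => -[zK zalt] bz; split.
    split; last first.
      move=> s t; rewrite !z'E zalt mulrBr; congr (_ - _).
      by apply: boundary_alternating; exact: bK.2.
    move=> t; have [/eqP zt|/zK//] := boolP (z t == 0).
    rewrite z'E zt add0r oppr_eq0 => /boundary_neq0[v /bK.1 /andP[/= /andP[vt ut] vtK]].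
    rewrite ut /=; apply: (dK _ _ vtK).
      by apply/subsetP => u; rewrite !inE orbC => ->.
    by apply/set0Pn; exists (thead t); rewrite inE mem_tnth.
  by rewrite boundaryB bz boundaryK ?subr0//; exact: bK.2.
have zz' t : boundary b t = 0 -> z' t = z t.
  by move=> bt; rewrite z'E bt subr0.
have z'h i : z' [tuple of behead (h i)] = 0.
  apply/eqP; rewrite z'E subr_eq0; apply/eqP.
  rewrite [RHS]ffunE (bigD1 (thead (h i)))//= thead_behead.
  rewrite sum_ffunE (bigD1 i)//= ffunMzE simplex_chain1 ?mul1r ?(hS i).1//.
  rewrite big1 ?addr0 => [|j ji]; last first.
    rewrite ffunMzE; have [/eqP ->|/simplex_chain_neq0 hij] := boolP (simplex_chain (h j) (h i) == 0); first by rewrite mul0r.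
    case/eqP : ji; apply: enum_val_inj; rewrite -(hS i).2 -(hS j).2.
    by apply/setP => u; rewrite !inE (perm_mem hij).
  rewrite big1 ?addr0// => v vh; apply/eqP/negPn/negP => /sum_neq0[j /simplex_chain_neq0 hj _].
  have ub : thead [tuple of behead (h i)] \in [tuple of behead (h i)] by rewrite mem_tnth.
  have hij : [set u in h i] \subset [set u in h j].
    apply: (isolated_simplex dK (hiso j) (hK i) (u := thead [tuple of behead (h i)])).
      by move/subsetP : (set_behead (h i)); apply; rewrite inE.
    by rewrite inE -(perm_mem hj) inE ub orbT.
  have {}hij : [set u in h i] = [set u in h j].
    by apply/eqP; rewrite eqEcard hij !hcard leqnn.
  have : uniq [tuple of v :: [tuple of behead (h i)]] by rewrite (perm_uniq hj) (hS j).1.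
  move=> /= /andP[vb _]; have : v \in h i.
    by have /setP/(_ v) := hij; rewrite !inE -(perm_mem hj) mem_head.
  by rewrite [h i]tuple_eta inE (negbTE vh) (negbTE vb).
apply/ffunP => t; rewrite [RHS]ffunE; apply/eqP/negPn/negP => z't.
have [[z'K z'alt] bz'] := cz'; have /andP[ut tK] := z'K _ z't.
(* If z' is nonzero on t, its boundary at the face behead t has another nonzero
   term, which gives a neighbour v of the simplex t. *)
have [v vt vz'] : exists2 v, v \notin t & z' [tuple of v :: behead t] != 0.
  move: (bz') => /ffunP/(_ [tuple of behead t]); rewrite !ffunE (bigD1 (thead t))//=.
  rewrite thead_behead => /eqP; rewrite addrC addr_eq0 => bz't.
  have /existsP[v /andP[vt vz']] : [exists v, (v != thead t) && (z' [tuple of v :: behead t] != 0)].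
    apply: contraNT z't; rewrite negb_exists -oppr_eq0 -(eqP bz't) => /forallP ex.
    rewrite big1// => v vt; apply/eqP; have := ex v.
    by rewrite vt negbK.
  exists v => //; rewrite [t]tuple_eta inE negb_or vt /=.
  by have /z'K/andP[/andP[]] := vz'.
have [isoZ|niso] := boolP [exists Z : {set V},
    [&& [set u in t] \subset Z, #|Z| == k.+3 & isolated K Z]]; last first.
  have /z'K/andP[_ vtK] := vz'.
  have tB : [set u in t] \in B.
    rewrite inE tK card_set_tuple// eqxx /= /crowded niso andbT.
    apply/existsP; exists v; apply/exists_inP.
    exists (thead [tuple of behead t]).
      by move/subsetP : (set_behead t); apply; rewrite inE mem_tnth.
    rewrite inE vt; apply: (dK _ _ vtK).
      apply/subsetP => u; rewrite !inE => /orP[/eqP ->|/eqP->]; last by rewrite eqxx.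
      by rewrite [_ \in behead t]mem_tnth orbT.
    by apply/set0Pn; exists v; rewrite set22.
  have zt : z t = 0.
    have [ui uE] := gB (enum_rank_in tB [set u in t]).
    rewrite enum_rankK_in// in uE.
    apply: (alternating_perm cz.1.2 (perm_tuple_set ui ut uE)).
    by apply: zL; rewrite mem_cat codom_f orbT.
  case/eqP: z't; rewrite zz' ?zt//; apply/eqP/negPn/negP => /bsupp[i ti].
  by case/negP : niso; apply/existsP; exists [set u in h i]; rewrite ti hcard eqxx hiso.
have [Z /and3P[tZ /eqP Zk iZ]] := existsP isoZ.
(* A single nonzero coefficient spreads to all the facets of Z, which are
   therefore faces of K: Z is either a face or hollow. *)
have facets w : w \in Z -> Z :\ w \in K.
  move=> wZ; have [|s [us sE]] := @set_tuple k.+2 (Z :\ w).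
    by move: Zk; rewrite (cardsD1 w) wZ => -[].
  rewrite -sE; suff : z' s != 0 by move=> /z'K /andP[].
  apply: contra z't => /eqP zs; apply/eqP.
  by apply: (isolated_spread dK cz' iZ Zk us) => //; rewrite sE subD1set.
have [ZK|ZK] := boolP (Z \in K).
  have ZS : Z \in S by rewrite inE ZK Zk eqxx iZ.
  have hZ : [set u in h (enum_rank_in ZS Z)] = Z by rewrite (hS _).2 enum_rankK_in.
  case/eqP: z't; apply: (isolated_spread dK cz' iZ Zk _ _ tZ (z'h (enum_rank_in ZS Z))).
    by have := (hS (enum_rank_in ZS Z)).1; rewrite [h _]tuple_eta => /andP[].
  by apply: subset_trans (set_behead _) _; rewrite hZ.
have ZT : Z \in T.
  by rewrite inE Zk eqxx /hollow ZK; apply/forall_inP.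
have [ui uE] := fT (enum_rank_in ZT Z); rewrite enum_rankK_in// in uE.
have zt : z t = 0.
  apply: (isolated_spread dK cz iZ Zk ui uE tZ).
  by apply: zL; rewrite mem_cat codom_f.
case/eqP: z't; rewrite zz' ?zt//; apply/eqP/negPn/negP => /bsupp[i ti].
have hZ : [set u in h i] \subset Z.
  apply: (isolated_simplex dK iZ (hK i) (u := thead t)).
    by move/subsetP : ti; apply; rewrite inE mem_tnth.
  by move/subsetP : tZ; apply; rewrite inE mem_tnth.
case/negP: ZK; suff <- : [set u in h i] = Z by exact: hK.
by apply/eqP; rewrite eqEcard hZ hcard Zk leqnn.
Qed.

Lemma isolated_hollow K Z Z' u : down_closed K -> hollow K Z -> (2 < #|Z|)%N ->
  isolated K Z' -> u \in Z -> u \in Z' -> Z \subset Z'.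
Proof.
move=> dK /andP[_ /forall_inP ZK] Z3 iZ' uZ uZ'; apply/subsetP => x xZ.
have /card_gt0P[w] : (0 < #|Z :\ u :\ x|)%N.
  move: Z3; rewrite (cardsD1 u) uZ (cardsD1 x (Z :\ u)); case: (x \in _) => /=; lia.
rewrite !inE => /and3P[wx wu wZ].
have /subsetP : Z :\ w \subset Z'.
  by apply: (isolated_simplex dK iZ' (ZK _ wZ) (u := u)); rewrite // !inE eq_sym wu.
by apply; rewrite !inE eq_sym wx.
Qed.

Lemma simplex_chain_boundary_behead k (t : k.+2.-tuple V) :
  uniq t -> boundary (simplex_chain t) [tuple of behead t] = 1.
Proof.
move=> ut; rewrite ffunE (bigD1 (thead t))//= thead_behead simplex_chain1//.
rewrite big1 ?addr0// => v vt; apply/eqP/negPn/negP => /simplex_chain_neq0 vtp.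
have : uniq (v :: behead t) by rewrite (perm_uniq vtp).
rewrite cons_uniq => /andP[vb _].
have : v \in t by rewrite -(perm_mem vtp) mem_head.
by rewrite [t]tuple_eta inE (negbTE vt) (negbTE vb).
Qed.

(** The boundaries of the isolated hollow sets are cycles with disjoint supports, and
    no face of dimension one more can meet these supports: it would be contained in
    the hollow set, and equal to it by cardinality. *)
Lemma betti_lower K k : down_closed K ->
  (#|[set Z : {set V} | [&& #|Z| == k.+3, hollow K Z & isolated K Z]]|
    <= betti K k.+1)%N.
Proof.
move=> dK; set T := (X in (#|X| <= _)%N).
have /fin_all_exists[h hT] (i : 'I_#|T|) : exists t : k.+3.-tuple V,
    uniq t /\ [set u in t] = enum_val i.
  have /[!inE]/and3P[/eqP Ti _ _] := enum_valP i.
  exact: set_tuple.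
have hhol i : hollow K [set u in h i].
  by rewrite (hT i).2; have /[!inE]/and3P[] := enum_valP i.
have hiso i : isolated K [set u in h i].
  by rewrite (hT i).2; have /[!inE]/and3P[] := enum_valP i.
have hcard i : #|[set u in h i]| = k.+3 by exact/card_set_tuple/(hT i).1.
have hinj i j u : u \in h i -> u \in h j -> i = j.
  move=> ui uj; apply: enum_val_inj; rewrite -(hT i).2 -(hT j).2.
  apply/eqP; rewrite eqEcard !hcard leqnn andbT.
  by apply: (isolated_hollow dK (hhol i) _ (hiso j) (u := u)); rewrite ?hcard ?inE.
pose s i : k.+2.-tuple V := [tuple of behead (h i)].
have us i : uniq (s i) by have := (hT i).1; rewrite [h i]tuple_eta => /andP[].
have sh i u : u \in s i -> u \in h i by exact: mem_behead.
have sE i : [set u in s i] = [set u in h i] :\ thead (h i).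
  apply/setP => u; have := (hT i).1; rewrite [in X in X -> _](tuple_eta (h i)) => /andP[hs _].
  rewrite !inE [in RHS](tuple_eta (h i)) inE.
  by case: eqVneq => //= ->; exact/negbTE.
have sK i : [set u in s i] \in K.
  rewrite sE; have /andP[_ /forall_inP] := hhol i; apply.
  by rewrite inE mem_tnth.
apply: (@betti_ge _ _ _ (fun i => boundary (simplex_chain (h i)))).
  have sinj : injective (fun i => [set u in s i]).
    move=> i j /setP/(_ (thead (s i))); rewrite !inE mem_tnth => /esym sj.
    by apply: (@hinj i j (thead (s i))); apply: sh => //; exact: mem_tnth.
  rewrite -[X in (X <= _)%N]card_ord -(card_imset _ sinj) subset_leq_card//.
  by apply/subsetP => _ /imsetP[i _ ->]; exact: sK.
split.
  move=> i; apply: boundary_simplex_chain_cycle; first exact: (hT i).1.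
  by move=> v vh; have /andP[_ /forall_inP] := hhol i; apply; rewrite inE.
move=> a [b [bK _]] /ffunP/[swap] i /(_ (s i)).
rewrite sum_ffunE (bigD1 i)//= ffunMzE simplex_chain_boundary_behead ?(hT i).1// mul1r.
rewrite big1 ?addr0 => [->|j ji]; last first.
  rewrite ffunMzE; apply/eqP; rewrite mulf_eq0; apply/orP; left.
  apply/negPn/negP => /boundary_neq0[v /simplex_chain_neq0 vs].
  case/eqP : ji; apply: (@hinj _ _ (thead (s i))); last by apply: sh; exact: mem_tnth.
  by rewrite -(perm_mem vs) inE mem_tnth orbT.
apply/eqP/negPn/negP => /boundary_neq0[v /bK /andP[uvs vsK]].
have vsh : [set u in [tuple of v :: s i]] \subset [set u in h i].
  apply: (isolated_simplex dK (hiso i) vsK (u := thead (s i))).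
    by rewrite !inE mem_tnth orbT.
  by rewrite inE; apply: sh; exact: mem_tnth.
have /andP[/negP + _] := hhol i; apply.
suff <- : [set u in [tuple of v :: s i]] = [set u in h i] by [].
by apply/eqP; rewrite eqEcard vsh hcard card_set_tuple// ltnSn.
Qed.

(** With only k+3 vertices no simplex is crowded and the whole vertex set is isolated,
    so that the upper and lower bounds coincide. *)
Lemma betti_hollow K k : down_closed K -> #|V| = k.+3 ->
  (betti K k.+1 == 1%N) = hollow K [set: V].
Proof.
move=> dK Vk.
have eqT Z : (#|Z| == k.+3) = (Z == [set: V]).
  by rewrite -Vk eqEcard subsetT cardsT /= eqn_leq max_card.
have iT : isolated K [set: V] by apply/forall_inP => u _; apply/forallP => x; rewrite inE.
have := betti_upper k dK; have := betti_lower k dK.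
rewrite (_ : [set s in K | _] = set0); last first.
  apply/setP => s; rewrite !inE; apply/negbTE; rewrite 2!negb_and orbA; apply/orP; right.
  rewrite negb_and; apply/orP; right; rewrite negbK; apply/existsP; exists [set: V].
  by rewrite subsetT cardsT Vk eqxx.
rewrite cards0 addn0.
have [hT|hT] := boolP (hollow K [set: V]).
  rewrite (_ : [set Z : {set V} | _] = [set [set: V]]); last first.
    by apply/setP => Z; rewrite !inE eqT; case: eqVneq => // ->; rewrite hT.
  rewrite (_ : [set Z : {set V} | _] = [set [set: V]]); last first.
    by apply/setP => Z; rewrite !inE eqT; case: eqVneq => // ->; rewrite hT.
  by rewrite cards1 => lb ub; rewrite eqn_leq lb ub.
rewrite (_ : [set Z : {set V} | (#|Z| == k.+3) && hollow K Z] = set0).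
  by rewrite cards0 leqn0 => _ /eqP ->.
apply/setP => Z; rewrite !inE eqT.
by apply/negbTE/negP => /andP[/eqP ->]; exact/negP.
Qed.

Lemma betti0_upper K : (betti K 0 <= #|V|)%N.
Proof.
pose L := [seq [tuple v] | v <- enum V].
have <- : size L = #|V| by rewrite size_map -cardE.
apply: betti_le => z _ zL; exists 0.
  split; first by move=> t; rewrite ffunE eqxx.
  by move=> s t; rewrite !ffunE mulr0.
apply/ffunP => t; rewrite !ffunE; under eq_bigr do rewrite ffunE.
rewrite big1_eq; apply: zL; apply/mapP; exists (thead t); first exact: mem_enum.
by apply: val_inj => /=; case: (t) => -[|x []].
Qed.

(** A chain of edges cannot have an isolated vertex in its boundary, so the isolated
    vertices have independent classes. *)
Lemma betti0_lower K : (forall v, [set v] \in K) ->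
  (#|[set v : V | isolated K [set v]]| <= betti K 0)%N.
Proof.
move=> K1; set T := (X in (#|X| <= _)%N).
have sub1 : (#|T| <= #|K|)%N.
  rewrite -(card_imset _ (@set1_inj V)) subset_leq_card//.
  by apply/subsetP => _ /imsetP[v _ ->].
pose z (i : 'I_#|T|) : {ffun 1.-tuple V -> int} := simplex_chain [tuple enum_val i].
apply: (@betti_ge _ _ _ z) => //; split.
  move=> i; split; last exact: simplex_chain_alternating.
  move=> t /simplex_chain_neq0 ti; rewrite (perm_uniq ti)/=.
  suff -> : [set v in t] = [set enum_val i] by exact: K1.
  by apply/setP => v; rewrite !inE (perm_mem ti) inE.
move=> a [b [bK _]] /ffunP/[swap] i /(_ [tuple enum_val i]).
rewrite sum_ffunE (bigD1 i)//= ffunMzE simplex_chain1// mul1r.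
rewrite big1 ?addr0 => [->|j ji]; last first.
  rewrite ffunMzE; apply/eqP; rewrite mulf_eq0; apply/orP; left.
  apply/negPn/negP => /simplex_chain_neq0 /perm_mem/(_ (enum_val i)).
  rewrite !inE eqxx => /esym/eqP/enum_val_inj ij.
  by rewrite ij eqxx in ji.
apply/eqP/negPn/negP => /boundary_neq0[v /bK /andP[/= vi viK]].
have /[!inE] iso := enum_valP i.
have : v \in [set enum_val i].
  apply: (isolatedP iso (set11 _)).
  by move: viK; rewrite set_cons setUC; congr (_ \in K); apply/setP => u; rewrite !inE.
by rewrite inE => /eqP vE; rewrite inE vE eqxx in vi.
Qed.

End chains.

(** * Euclidean geometry of tuples *)

Local Notation edist := Defs.edist.

Section euclid.
Context {R : realType} {d : nat}.
Implicit Types (x y z u v : d.-tuple R) (a b : R).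

Definition tadd x y : d.-tuple R := [tuple tnth x i + tnth y i | i < d].
Definition tsub x y : d.-tuple R := [tuple tnth x i - tnth y i | i < d].
Definition tscale a x : d.-tuple R := [tuple a * tnth x i | i < d].
Definition tdot x y : R := \sum_(i < d) tnth x i * tnth y i.

Lemma tnth_tadd x y i : tnth (tadd x y) i = tnth x i + tnth y i.
Proof. by rewrite tnth_mktuple. Qed.
Lemma tnth_tsub x y i : tnth (tsub x y) i = tnth x i - tnth y i.
Proof. by rewrite tnth_mktuple. Qed.
Lemma tnth_tscale a x i : tnth (tscale a x) i = a * tnth x i.
Proof. by rewrite tnth_mktuple. Qed.
Lemma tnth_origin i : tnth (origin : d.-tuple R) i = 0.
Proof. by rewrite tnth_mktuple. Qed.
Definition tE := (tnth_tadd, tnth_tsub, tnth_tscale, tnth_origin).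

Lemma tdotC x y : tdot x y = tdot y x.
Proof. by apply: eq_bigr => i _; rewrite mulrC. Qed.

Lemma tdotDl x y z : tdot (tadd x y) z = tdot x z + tdot y z.
Proof. by rewrite /tdot -big_split; apply: eq_bigr => i _; rewrite !tE mulrDl. Qed.

Lemma tdotDr x y z : tdot z (tadd x y) = tdot z x + tdot z y.
Proof. by rewrite tdotC tdotDl !(tdotC z). Qed.

Lemma tdotBl x y z : tdot (tsub x y) z = tdot x z - tdot y z.
Proof.
rewrite /tdot -sumrB; apply: eq_bigr => i _; by rewrite !tE mulrBl.
Qed.

Lemma tdotBr x y z : tdot z (tsub x y) = tdot z x - tdot z y.
Proof. by rewrite tdotC tdotBl !(tdotC z). Qed.

Lemma tdotZl a x z : tdot (tscale a x) z = a * tdot x z.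
Proof. by rewrite /tdot mulr_sumr; apply: eq_bigr => i _; rewrite !tE mulrA. Qed.

Lemma tdotZr a x z : tdot z (tscale a x) = a * tdot z x.
Proof. by rewrite tdotC tdotZl tdotC. Qed.

Lemma tdot_ge0 x : 0 <= tdot x x.
Proof. by apply: sumr_ge0 => i _; rewrite -expr2 sqr_ge0. Qed.

Lemma tdot_eq0 x : tdot x x = 0 -> x = origin.
Proof.
move=> x0; apply: eq_from_tnth => i; rewrite tnth_origin.
have /psumr_eq0P x00 := x0; apply/eqP; rewrite -sqrf_eq0 expr2.
by apply/eqP/x00 => // j _; rewrite -expr2 sqr_ge0.
Qed.

Lemma enormE x : enorm x = Num.sqrt (tdot x x).
Proof. by congr Num.sqrt; apply: eq_bigr => i _; rewrite expr2. Qed.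

Lemma enorm_ge0 x : 0 <= enorm x. Proof. exact: sqrtr_ge0. Qed.

Lemma enorm_sqr x : enorm x ^+ 2 = tdot x x.
Proof. by rewrite enormE sqr_sqrtr ?tdot_ge0. Qed.

Lemma enorm0 : enorm (origin : d.-tuple R) = 0.
Proof.
by rewrite enormE (_ : tdot _ _ = 0) ?sqrtr0// /tdot big1// => i _; rewrite !tE mulr0.
Qed.

Lemma enormZ a x : enorm (tscale a x) = `|a| * enorm x.
Proof.
by rewrite !enormE tdotZl tdotZr mulrA -expr2 sqrtrM ?sqr_ge0// sqrtr_sqr.
Qed.

Lemma tdot_cauchy_schwarz x y : tdot x y ^+ 2 <= tdot x x * tdot y y.
Proof.
have [y0|y0] := eqVneq (tdot y y) 0.
  suff -> : tdot x y = 0 by rewrite y0 mulr0 expr0n.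
  by rewrite (tdot_eq0 y0) /tdot big1// => i _; rewrite !tE mulr0.
have yp : 0 < tdot y y by rewrite lt_neqAle eq_sym y0 tdot_ge0.
have := tdot_ge0 (tsub (tscale (tdot y y) x) (tscale (tdot x y) y)).
rewrite !(tdotBl, tdotBr, tdotZl, tdotZr) (tdotC y x) => h.
have {}h : 0 <= tdot y y * (tdot x x * tdot y y - tdot x y ^+ 2) by move: h; lra.
by rewrite -subr_ge0; move: h; rewrite pmulr_rge0.
Qed.

Lemma tdot_le_enorm x y : tdot x y <= enorm x * enorm y.
Proof.
rewrite (le_trans (ler_norm _))// -(@ler_pXn2r _ 2)// ?nnegrE ?mulr_ge0 ?enorm_ge0//.
by rewrite real_normK ?num_real// exprMn !enorm_sqr tdot_cauchy_schwarz.
Qed.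

Lemma enorm_triangle x y : enorm (tadd x y) <= enorm x + enorm y.
Proof.
rewrite -(@ler_pXn2r _ 2)// ?nnegrE ?addr_ge0 ?enorm_ge0// enorm_sqr.
rewrite tdotDl !tdotDr sqrrD !enorm_sqr (tdotC y x).
by have := tdot_le_enorm x y; lra.
Qed.

Lemma edistE x y : edist x y = enorm (tsub x y). Proof. by []. Qed.

Lemma edistC x y : edist x y = edist y x.
Proof.
rewrite !edistE !enormE; congr Num.sqrt; apply: eq_bigr => i _; rewrite !tE; lra.
Qed.

Lemma edist_triangle y x z : edist x z <= edist x y + edist y z.
Proof.
rewrite !edistE; have -> : tsub x z = tadd (tsub x y) (tsub y z).
  by apply: eq_from_tnth => i; rewrite !tE; lra.
exact: enorm_triangle.
Qed.

Lemma edistxx x : edist x x = 0.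
Proof.
rewrite edistE (_ : tsub x x = origin) ?enorm0//.
by apply: eq_from_tnth => i; rewrite !tE; lra.
Qed.

Lemma edist_tadd v x y : edist (tadd v x) (tadd v y) = edist x y.
Proof.
by rewrite !edistE; congr enorm; apply: eq_from_tnth => i; rewrite !tE; lra.
Qed.

Lemma edist0 x : edist origin x = enorm x.
Proof.
rewrite edistC edistE; congr enorm; apply: eq_from_tnth => i; rewrite !tE; lra.
Qed.

Lemma taddK v x : tadd v (tadd (tscale (-1) v) x) = x.
Proof. by apply: eq_from_tnth => i; rewrite !tE; lra. Qed.

Lemma taddKV v x : tadd (tscale (-1) v) (tadd v x) = x.
Proof. by apply: eq_from_tnth => i; rewrite !tE; lra. Qed.

Lemma tadd0 x : tadd x origin = x.
Proof. by apply: eq_from_tnth => i; rewrite !tE addr0. Qed.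

Lemma taddC x y : tadd x y = tadd y x.
Proof. by apply: eq_from_tnth => i; rewrite !tE addrC. Qed.

(** The reflection in the hyperplane orthogonal to u; as x / 0 = 0, it is the identity
    when u is the origin. *)
Definition householder u x := tsub x (tscale (2 * tdot u x / tdot u u) u).

Lemma householderD u x y :
  householder u (tadd x y) = tadd (householder u x) (householder u y).
Proof. by apply: eq_from_tnth => i; rewrite !tE tdotDr mulrDr mulrDl; lra. Qed.

Lemma householderB u x y :
  householder u (tsub x y) = tsub (householder u x) (householder u y).
Proof. by apply: eq_from_tnth => i; rewrite !tE tdotBr mulrBr mulrBl; lra. Qed.

Lemma tdot_householder u x : tdot (householder u x) (householder u x) = tdot x x.
Proof.
rewrite /householder; have [u0|u0] := eqVneq (tdot u u) 0.
  by rewrite !(tdotBl, tdotBr, tdotZl, tdotZr) u0 invr0 !mulr0 !mul0r !subr0.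
rewrite !(tdotBl, tdotBr, tdotZl, tdotZr) (tdotC x u).
by field.
Qed.

Lemma enorm_householder u x : enorm (householder u x) = enorm x.
Proof. by rewrite !enormE tdot_householder. Qed.

Lemma edist_householder u x y : edist (householder u x) (householder u y) = edist x y.
Proof. by rewrite !edistE -householderB enorm_householder. Qed.

Lemma householderK u : involutive (householder u).
Proof.
move=> x; apply: eq_from_tnth => i; rewrite /householder !tE.
have [u0|u0] := eqVneq (tdot u u) 0; first by rewrite u0 invr0 !mulr0 !mul0r !subr0.
rewrite tdotBr tdotZr; by field.
Qed.

Lemma householder0 u : householder u origin = origin.
Proof.
apply: eq_from_tnth => i; rewrite !tE; have -> : tdot u origin = 0.
  by rewrite /tdot big1// => j _; rewrite !tE mulr0.
by rewrite mulr0 mul0r mul0r subr0.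
Qed.

(** Reflections act transitively on spheres, so they can replace rotations. *)
Lemma householder_swap x y : enorm x = enorm y -> householder (tsub x y) x = y.
Proof.
move=> xy; have {}xy : tdot x x = tdot y y by rewrite -!enorm_sqr xy.
have [u0|u0] := eqVneq (tdot (tsub x y) (tsub x y)) 0.
  have xy0 := tdot_eq0 u0; have -> : y = x.
    apply: eq_from_tnth => i; have := congr1 (fun t => tnth t i) xy0.
    by rewrite !tE => /eqP; rewrite subr_eq0 => /eqP.
  apply: eq_from_tnth => i; rewrite /householder !tE; lra.
have h : 2 * tdot (tsub x y) x = tdot (tsub x y) (tsub x y).
  by rewrite !(tdotBl, tdotBr) xy (tdotC y x); lra.
by apply: eq_from_tnth => i; rewrite /householder h divff// !tE; lra.
Qed.

Lemma enorm_le_coord (x : d.-tuple R) (e : R) : 0 <= e ->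
  (forall i, `|tnth x i| <= e / d%:R) -> enorm x <= e.
Proof.
move=> e0 xe; rewrite -(@ler_pXn2r _ 2)// ?nnegrE ?enorm_ge0// enorm_sqr.
have [d0|d0] := posnP d.
  by rewrite /tdot big1 ?exprn_ge0// => -[i id]; exfalso; rewrite d0 in id.
have dR0 : 0 < d%:R :> R by rewrite ltr0n.
have d1 : 1 <= d%:R :> R by rewrite ler1n.
apply: (@le_trans _ _ (\sum_(i < d) (e / d%:R) ^+ 2)).
  apply: ler_sum => i _; rewrite -expr2 -real_normK ?num_real//.
  by rewrite ler_pXn2r ?nnegrE// divr_ge0// ltW.
rewrite sumr_const card_ord -[_ *+ d]mulr_natl.
have -> : d%:R * (e / d%:R) ^+ 2 = e ^+ 2 / d%:R by field; exact: lt0r_neq0.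
by rewrite ler_pdivrMr// ler_peMr// exprn_ge0.
Qed.

End euclid.

(** * Betti numbers of Cech complexes through local counts *)

Section cech_counts.
Import boot.fintype boot.finset.
Local Open Scope set_scope.

(** Each of the W, of cardinality m, contains at most 2 ^ m sets. *)
Lemma card_covered (J : finType) (A F : {set {set J}}) m :
  (forall I, I \in A -> exists2 W, W \in F & I \subset W) ->
  (forall W, W \in F -> #|W| = m) -> (#|A| <= 2 ^ m * #|F|)%N.
Proof.
move=> AF Fm; apply: (@leq_trans #|cover [set powerset W | W in F]|).
  apply/subset_leq_card/subsetP => I /AF[W WF IW].
  apply/bigcupP; exists (powerset W); first exact: imset_f.
  by rewrite powersetE.
apply: leq_trans (leq_card_cover _) _.
apply: (@leq_trans (\sum_(B in [set powerset W | W in F]) 2 ^ m)%N).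
  by apply: leq_sum => _ /imsetP[W WF ->]; rewrite card_powerset Fm.
by rewrite sum_nat_const mulnC leq_mul// leq_imset_card.
Qed.

Context {R : realType} {d : nat} (J : finType) (x : J -> d.-tuple R).
Implicit Types (I W O : {set J}) (Y : {fset d.-tuple R}).

Definition cechx I := exists z, forall i, i \in I -> edist (x i) z <= 1.

Definition hollowx I := `[< ~ cechx I /\ forall i, i \in I -> cechx (I :\ i) >].

(** The bound 6 is that of crowded_cluster. *)
Definition clusterx m I :=
  (#|I| == m) && [forall i in I, forall j in I, edist (x i) (x j) <= 6].

Lemma cech_edist I i j : cechx I -> i \in I -> j \in I -> edist (x i) (x j) <= 2.
Proof.
move=> [z Iz] iI jI; apply: le_trans (edist_triangle z _ _) _.
by have := Iz _ iI; have := Iz _ jI; rewrite (edistC z); lra.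
Qed.

(** If two indices of I had the same point, removing one of them would keep the
    common point of the balls: I would satisfy the Cech condition. *)
Lemma hollowx_inj I : (1 < #|I|)%N -> hollowx I -> {in I &, injective x}.
Proof.
move=> I1 /asboolP[nI fI] i j iI jI xij; apply/eqP/negPn/negP => ij.
apply: nI; have [z Iz] := fI i iI; exists z => l lI.
have [->|li] := eqVneq l i; last by apply: Iz; rewrite !inE li.
by rewrite xij; apply: Iz; rewrite !inE eq_sym ij.
Qed.

(** Two points of a hollow set of at least three points lie in a common proper
    subset, the balls around which intersect. *)
Lemma hollowx_edist I i j : (2 < #|I|)%N -> hollowx I -> i \in I -> j \in I ->
  edist (x i) (x j) <= 2.
Proof.
move=> I2 /asboolP[_ fI] iI jI; have /card_gt0P[l] : (0 < #|I :\ i :\ j|)%N.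
  move: I2; rewrite (cardsD1 i) iI (cardsD1 j (I :\ i)); case: (j \in _) => /=; lia.
rewrite !inE => /and3P[lj li lI].
by apply: (cech_edist (fI l lI)); rewrite !inE eq_sym ?li ?lj.
Qed.

Lemma mem_cech Y (Z : {set Y}) : Z != set0 ->
  reflect (exists z, forall v, v \in Z -> edist (val v) z <= 1) (Z \in cech Y 1).
Proof.
move=> Z0; rewrite inE Z0 /=.
apply: (iffP (asboolP _)) => -[z Zz]; exists z => v vZ; exact: Zz.
Qed.

Lemma cech_down Y : down_closed (cech Y 1).
Proof.
move=> s t sK ts t0; have s0 : s != set0.
  by apply: contra_neq t0 => s0; apply/eqP; rewrite -subset0 -s0.
have /(mem_cech s0)[z sz] := sK; apply/(mem_cech t0); exists z => v vt.
by apply: sz; move/subsetP : ts; apply.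
Qed.

Lemma cech1 Y (v : Y) : [set v] \in cech Y 1.
Proof.
apply/mem_cech; first by apply/set0Pn; exists v; rewrite set11.
by exists (val v) => u /set1P ->; rewrite edistxx ler01.
Qed.

Lemma cech_pair Y (s : {set Y}) u v : s \in cech Y 1 -> u \in s -> v \in s ->
  edist (val u) (val v) <= 2.
Proof.
move=> sK us vs; have s0 : s != set0 by apply/set0Pn; exists u.
have /(mem_cech s0)[z sz] := sK.
apply: le_trans (edist_triangle z _ _) _.
by have := sz _ us; have := sz _ vs; rewrite (edistC z); lra.
Qed.

(** The vertices of the complex on Y that correspond to an index set; index sets are
    what expectations can be summed over, vertex sets are what homology speaks of. *)
Definition ximage Y I : {set Y} := [set v : Y | [exists i in I, x i == val v]].

Lemma ximage_mem Y I i (iY : x i \in Y) : i \in I -> [` iY]%fset \in ximage Y I.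
Proof. by move=> iI; rewrite inE; apply/exists_inP; exists i. Qed.

Lemma cech_ximage Y I : (forall i, i \in I -> x i \in Y) -> I != set0 ->
  reflect (cechx I) (ximage Y I \in cech Y 1).
Proof.
move=> IY I0; have X0 : ximage Y I != set0.
  have /set0Pn[i0 i0I] := I0; apply/set0Pn; exists [` IY _ i0I]%fset.
  exact: ximage_mem.
apply: (iffP (mem_cech X0)) => -[z Iz]; exists z.
  by move=> i iI; have /= := Iz [` IY i iI]%fset; apply; exact: ximage_mem.
by move=> v; rewrite inE => /exists_inP[i iI /eqP <-]; exact: Iz.
Qed.

Lemma ximageD1 Y I i (iY : x i \in Y) : {in I &, injective x} -> i \in I ->
  ximage Y I :\ [` iY]%fset = ximage Y (I :\ i).
Proof.
move=> xI iI; apply/setP => v; rewrite !inE; apply/andP/exists_inP => [[vi]|].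
  move=> /exists_inP[j jI jv]; exists j => //; rewrite !inE jI andbT.
  apply: contra vi => /eqP ji; apply/eqP/val_inj => /=; by rewrite -ji (eqP jv).
move=> [j]; rewrite !inE => /andP[ji jI] jv; split; last by apply/exists_inP; exists j.
apply: contra ji => /eqP/(congr1 val)/= vi; apply/eqP/xI => //.
by rewrite (eqP jv).
Qed.

Lemma hollow_ximage Y I : (1 < #|I|)%N -> (forall i, i \in I -> x i \in Y) ->
  {in I &, injective x} -> hollow (cech Y 1) (ximage Y I) = hollowx I.
Proof.
move=> I1 IY xI; have I0 : I != set0 by rewrite -card_gt0 ltnW.
have ID i : i \in I -> I :\ i != set0.
  by move=> iI; move: I1; rewrite (cardsD1 i) iI -card_gt0.
apply/andP/asboolP => -[nI fI]; split.
- by move=> /(cech_ximage IY I0); exact/negP.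
- move=> i iI; have /forall_inP/(_ [` IY _ iI]%fset (ximage_mem _ iI)) := fI.
  rewrite ximageD1// => /cech_ximage; apply; last exact: ID.
  by move=> j /setD1P[_]; exact: IY.
- by apply/negP => /(cech_ximage IY I0).
- apply/forall_inP => v; rewrite inE => /exists_inP[i iI iv].
  have -> : v = [` IY _ iI]%fset by apply: val_inj; rewrite /= (eqP iv).
  rewrite ximageD1//; apply/cech_ximage; [|exact: ID|exact: fI].
  by move=> j /setD1P[_]; exact: IY.
Qed.

Lemma card_ximage Y I : (forall i, i \in I -> x i \in Y) ->
  {in I &, injective x} -> #|ximage Y I| = #|I|.
Proof.
move=> IY xI.
have [->|/set0Pn[i0 i0I]] := eqVneq I set0.
  rewrite cards0; apply/eqP; rewrite cards_eq0; apply/eqP/setP => v; rewrite !inE.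
  by apply/exists_inP => -[i]; rewrite inE.
pose f i : Y := odflt [` IY _ i0I]%fset (insub (x i)).
have fE i : i \in I -> val (f i) = x i by move=> iI; rewrite /f insubT ?IY.
rewrite -(card_in_imset (f := f)) => [|i j iI jI /(congr1 val)]; last first.
  by rewrite !fE//; exact: xI.
apply: eq_card => v; rewrite inE; apply/exists_inP/imsetP => -[i iI].
  by move=> /eqP iv; exists i => //; apply: val_inj; rewrite fE.
by move=> ->; exists i; rewrite ?fE.
Qed.

Section bounds.
Variables (O : {set J}) (Y : {fset d.-tuple R}).
Hypothesis OY : forall v, v \in Y <-> exists2 i, i \in O & x i = v.

Let OY1 i : i \in O -> x i \in Y. Proof. by move=> iO; apply/OY; exists i. Qed.

Definition clusters m := [set I : {set J} | (I \subset O) && clusterx m I].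

Let card_clusters m I : I \in clusters m -> #|I| = m.
Proof. by rewrite inE => /and3P[_ /eqP]. Qed.

Let index_section : exists f : Y -> J, forall v, f v \in O /\ x (f v) = val v.
Proof.
suff /fin_all_exists[f fP] (v : Y) : exists i, i \in O /\ x i = val v by exists f.
by have /OY[i iO iv] := valP v; exists i.
Qed.

(** For an index set I that is not touched, no outside point of O can be linked to
    the vertices ximage Y I, which makes them isolated. *)
Definition touched I := [exists i in I, exists j in O :\: I, edist (x i) (x j) <= 2].

Lemma isolated_ximage I : I \subset O -> ~~ touched I ->
  isolated (cech Y 1) (ximage Y I).
Proof.
move=> IO nI; apply/forall_inP => v; rewrite inE => /exists_inP[i iI /eqP iv].
apply/forallP => w; apply/implyP => wI; apply/negP => vwK.
have /OY[j jO jw] := valP w.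
case/negP: nI; apply/exists_inP; exists i => //; apply/exists_inP; exists j.
  rewrite inE jO andbT; apply: contra wI => jI.
  by rewrite inE; apply/exists_inP; exists j => //; apply/eqP.
by rewrite iv jw; apply: (cech_pair vwK); rewrite !inE eqxx ?orbT.
Qed.

Lemma ximage_inj I I' : I \subset O -> ~~ touched I -> I' \subset O ->
  ximage Y I = ximage Y I' -> I' \subset I.
Proof.
move=> IO nI I'O II'; apply/subsetP => i iI'; have iO := subsetP I'O _ iI'.
have := ximage_mem (OY1 iO) iI'; rewrite -II' inE => /exists_inP[j jI /eqP /= ji].
apply/negPn/negP => niI; case/negP: nI; apply/exists_inP; exists j => //.
apply/exists_inP; exists i; first by rewrite inE niI.
by rewrite ji edistxx.
Qed.

(** The simplex s has diameter at most 2. It has a neighbour w outside of s, and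
    w |: s, which is not isolated, has a neighbour z in turn; each addition increases
    the diameter by at most 2. *)
Lemma crowded_cluster k (s : {set Y}) : #|s| = k.+2 -> s \in cech Y 1 ->
  crowded (cech Y 1) k.+3 s ->
  exists W : {set Y}, [/\ s \subset W, #|W| = k.+4 &
    forall u v, u \in W -> v \in W -> edist (val u) (val v) <= 6].
Proof.
move=> sk sK /andP[/existsP[w /exists_inP[u us /andP[ws uwK]]]].
(* w |: s has k.+3 elements, so it is a candidate that crowded excludes. *)
rewrite negb_exists => /forallP/(_ (w |: s)).
rewrite subsetUr cardsU1 ws sk eqxx /= negb_forall => /existsP[y].
rewrite negb_imply => /andP[yZ]; rewrite negb_forall => /existsP[z].
rewrite negb_imply negbK => /andP[zZ yzK].
have s2 a b : a \in s -> b \in s -> edist (val a) (val b) <= 2 by exact: cech_pair.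
have w4 a : a \in s -> edist (val a) (val w) <= 4.
  move=> sa; have := edist_triangle (val u) (val a) (val w); have := s2 _ _ sa us.
  have : edist (val u) (val w) <= 2 by apply: (cech_pair uwK); rewrite !inE eqxx ?orbT.
  lra.
have Z4 a b : a \in w |: s -> b \in w |: s -> edist (val a) (val b) <= 4.
  move=> /setU1P[->|sa] /setU1P[->|sb].
  - by rewrite edistxx.
  - by rewrite edistC w4.
  - by rewrite w4.
  - by have := s2 _ _ sa sb; lra.
have z6 a : a \in w |: s -> edist (val a) (val z) <= 6.
  move=> Za; have := edist_triangle (val y) (val a) (val z); have := Z4 _ _ Za yZ.
  have : edist (val y) (val z) <= 2 by apply: (cech_pair yzK); rewrite !inE eqxx ?orbT.
  lra.
exists (z |: (w |: s)); split.
- by apply/subsetP => a sa; rewrite !inE sa !orbT.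
- by rewrite cardsU1 zZ cardsU1 ws sk.
- move=> a b /setU1P[->|Za] /setU1P[->|Zb].
  + by rewrite edistxx.
  + by rewrite edistC z6.
  + by rewrite z6.
  + by have := Z4 _ _ Za Zb; lra.
Qed.

Definition hollows k := [set I : {set J} | [&& I \subset O, #|I| == k & hollowx I]].

(** By betti_upper, what has to be counted besides the hollow sets are the crowded
    simplices, each of which is contained in a cluster of two more points. *)
Lemma betti_cech_le k :
  (betti (cech Y 1) k.+1 <= #|hollows k.+3| + 2 ^ k.+4 * #|clusters k.+4|)%N.
Proof.
have [f fP] := index_section.
have finj : injective f by move=> u v uv; apply: val_inj; rewrite -(fP u).2 uv (fP v).2.
have fO (Z : {set Y}) : f @: Z \subset O.
  by apply/subsetP => _ /imsetP[v _ ->]; exact: (fP v).1.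
apply: leq_trans (betti_upper k (@cech_down Y)) (leq_add _ _).
  rewrite -(card_imset _ (imset_inj finj)); apply/subset_leq_card/subsetP => _ /imsetP[Z + ->].
  rewrite !inE fO card_imset// => /andP[/eqP Zk hZ]; rewrite Zk eqxx /=.
  rewrite -(@hollow_ximage Y); last 3 first.
  - by rewrite card_imset// Zk.
  - by move=> i /(subsetP (fO Z)); exact: OY1.
  - by move=> _ _ /imsetP[u uZ ->] /imsetP[v vZ ->]; rewrite !(fP _).2 => /val_inj ->.
  suff -> : ximage Y (f @: Z) = Z by [].
  apply/setP => v; rewrite inE; apply/exists_inP/idP => [[_ /imsetP[u uZ ->]]|vZ].
    by rewrite (fP u).2 => /eqP/val_inj <-.
  by exists (f v); rewrite ?imset_f ?(fP v).2.
apply: (@leq_trans (2 ^ k.+4 * #|[set W : {set Y} | (#|W| == k.+4) &&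
    [forall u in W, forall v in W, (edist (val u) (val v) <= 6)%R]]|)%N).
  apply: card_covered => [s|W]; last by rewrite inE => /andP[/eqP].
  rewrite inE => /and3P[sK /eqP sk /(crowded_cluster sk sK)[W [sW Wk W6]]].
  exists W => //; rewrite inE Wk eqxx /=.
  by apply/forall_inP => u uW; apply/forall_inP => v vW; exact: W6.
rewrite leq_mul2l; apply/orP; right; rewrite -(card_imset _ (imset_inj finj)).
apply/subset_leq_card/subsetP => _ /imsetP[Z + ->].
rewrite !inE fO /clusterx card_imset// => /andP[-> /= /forall_inP Z6].
apply/forall_inP => _ /imsetP[u uZ ->]; apply/forall_inP => _ /imsetP[v vZ ->].
by rewrite !(fP _).2; have /forall_inP := Z6 _ uZ; exact.
Qed.

(** By betti_lower, only the isolated hollow sets have to be found. A hollow set that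
    is touched forms a cluster with the touching point. *)
Lemma betti_cech_ge k :
  (#|hollows k.+3| <= betti (cech Y 1) k.+1 + 2 ^ k.+4 * #|clusters k.+4|)%N.
Proof.
pose A := [set I in hollows k.+3 | touched I].
rewrite -(cardsID A) addnC leq_add//; last first.
  apply: (@leq_trans #|A|); first exact/subset_leq_card/subsetIr.
  apply: card_covered; last exact: card_clusters.
  move=> I; rewrite !inE => /andP[/and3P[IO /eqP Ik hI]].
  move=> /exists_inP[i iI /exists_inP[j /setDP[jO jI] ij]].
  exists (j |: I); last exact: subsetUr.
  rewrite inE /clusterx cardsU1 jI Ik eqxx subUset sub1set jO IO /=.
  have I2 a b : a \in I -> b \in I -> edist (x a) (x b) <= 2.
    by apply: hollowx_edist; rewrite ?Ik.
  have j4 a : a \in I -> edist (x a) (x j) <= 4.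
    by move=> aI; have := edist_triangle (x i) (x a) (x j); have := I2 _ _ aI iI; lra.
  apply/forall_inP => a /setU1P[->|aI]; apply/forall_inP => b /setU1P[->|bI].
  - by rewrite edistxx.
  - by rewrite edistC; have := j4 _ bI; lra.
  - by have := j4 _ aI; lra.
  - by have := I2 _ _ aI bI; lra.
apply: leq_trans (betti_lower k (@cech_down Y)).
have inA I : I \in hollows k.+3 :\: A ->
    [/\ I \subset O, #|I| = k.+3, hollowx I & ~~ touched I].
  rewrite !inE => /andP[+ /and3P[IO /eqP Ik hI]].
  by rewrite IO Ik eqxx hI.
have xI I : I \in hollows k.+3 :\: A -> {in I &, injective x}.
  by move=> /inA[_ Ik hI _]; apply: hollowx_inj => //; rewrite Ik.
have IY I : I \in hollows k.+3 :\: A -> forall i, i \in I -> x i \in Y.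
  by move=> /inA[IO _ _ _] i /(subsetP IO); exact: OY1.
rewrite -(card_in_imset (f := ximage Y)) => [|I I' II I'I]; last first.
  have [IO _ _ nI] := inA _ II; have [I'O _ _ nI'] := inA _ I'I => xII'.
  apply/eqP; rewrite eqEsubset; apply/andP; split.
    by apply: ximage_inj (esym xII').
  by apply: ximage_inj xII'.
apply/subset_leq_card/subsetP => _ /imsetP[I II ->].
have [IO Ik hI nI] := inA _ II; rewrite inE card_ximage ?Ik ?eqxx//=; [|exact: IY|exact: xI].
rewrite hollow_ximage ?Ik ?hI//=; [|exact: IY|exact: xI].
exact: isolated_ximage.
Qed.

Lemma betti0_cech_le : (betti (cech Y 1) 0 <= #|O|)%N.
Proof.
have [f fP] := index_section; apply: leq_trans (betti0_upper _) _.
have finj : injective f by move=> u v uv; apply: val_inj; rewrite -(fP u).2 uv (fP v).2.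
rewrite -(card_codom finj); apply/subset_leq_card/subsetP => _ /codomP[v ->].
exact: (fP v).1.
Qed.

(** A point which is not isolated has a point within distance 2, and the pair is a
    cluster. *)
Lemma betti0_cech_ge :
  (#|O| <= betti (cech Y 1) 0 + 2 ^ 2 * #|clusters 2|)%N.
Proof.
pose A := [set i in O | touched [set i]].
rewrite -(cardsID A) addnC leq_add//; last first.
  rewrite -(card_imset _ (@set1_inj J)).
  apply: card_covered; last exact: card_clusters.
  move=> _ /imsetP[i + ->].
  rewrite !inE => /andP[iO /andP[_ /exists_inP[_ /set1P -> /exists_inP[j /setDP[jO ji] ij]]]].
  exists (j |: [set i]); last exact: subsetUr.
  rewrite inE /clusterx cardsU1 ji cards1 eqxx subUset !sub1set jO iO /=.
  apply/forall_inP => a /set2P[]->; apply/forall_inP => b /set2P[]->;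
    rewrite ?edistxx//; rewrite 1?edistC; move: ij; rewrite 1?edistC; lra.
apply: leq_trans (betti0_lower (@cech1 Y)).
have inA i : i \in O :\: A -> i \in O /\ ~~ touched [set i].
  by rewrite !inE => /andP[+ iO]; rewrite iO.
have [->|/set0Pn[i0 /inA[i0O _]]] := eqVneq (O :\: A) set0; first by rewrite cards0.
pose f i : Y := odflt [` OY1 i0O]%fset (insub (x i)).
have fE i : i \in O -> val (f i) = x i by move=> iO; rewrite /f insubT ?OY1.
have fX i : i \in O -> ximage Y [set i] = [set f i].
  move=> iO; apply/setP => v; rewrite !inE; apply/exists_inP/eqP => [[_ /set1P -> iv]|->].
    by apply: val_inj; rewrite fE ?(eqP iv).
  by exists i; rewrite ?fE ?set11.
rewrite -(card_in_imset (f := f)) => [|i j /inA[iO ni] /inA[jO nj] fij]; last first.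
  apply/set1_inj/eqP; rewrite eqEsubset; apply/andP; split.
    by apply: ximage_inj => //; rewrite ?sub1set// !fX// fij.
  by apply: ximage_inj => //; rewrite ?sub1set// !fX// fij.
apply/subset_leq_card/subsetP => _ /imsetP[i /inA[iO ni] ->].
by rewrite inE -fX//; apply: isolated_ximage => //; rewrite sub1set.
Qed.

End bounds.

Lemma T_set_ximage Y I k : (forall v, v \in Y <-> exists2 i, i \in I & x i = v) ->
  #|I| = k.+3 -> T_set k.+1 Y = hollowx I.
Proof.
move=> IY Ik; have IY1 i : i \in I -> x i \in Y by move=> iI; apply/IY; exists i.
have YI : ximage Y I = [set: Y].
  apply/setP => v; rewrite !inE; apply/exists_inP.
  by have /IY[i iI iv] := valP v; exists i => //; apply/eqP.
apply/andP/idP => [[/eqP Yk bY]|hI].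
  have xI : {in I &, injective x}.
    have /card_gt0P[i0 i0I] : (0 < #|I|)%N by rewrite Ik.
    pose f i : Y := odflt [` IY1 _ i0I]%fset (insub (x i)).
    have fE i : i \in I -> val (f i) = x i by move=> iI; rewrite /f insubT ?IY1.
    suff fI : {in I &, injective f}.
      by move=> i j iI jI xij; apply: fI => //; apply: val_inj; rewrite !fE.
    apply/imset_injP; rewrite Ik -Yk cardfE -cardsT; apply/eqP/eq_card => v.
    rewrite !inE; apply/imsetP; have /IY[i iI iv] := valP v.
    by exists i => //; apply: val_inj; rewrite fE.
  rewrite -(@hollow_ximage Y) ?Ik// YI -(@betti_hollow _ _ k) ?(eqP bY)//.
    exact: cech_down.
  by rewrite -cardfE.
have xI : {in I &, injective x} by apply: hollowx_inj hI; rewrite Ik.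
have Yk : #|` Y| = k.+3 by rewrite cardfE -cardsT -YI card_ximage.
rewrite Yk eqxx; split => //; rewrite betti_hollow ?YI -?cardfE//.
  by rewrite -YI hollow_ximage ?Ik.
exact: cech_down.
Qed.

End cech_counts.

(** * Product measures and joint laws *)

Section tuple_measure_theory.
Context {d} {T : measurableType d} {R : realType}.
Variable m : {sigma_finite_measure set T -> \bar R}.

Definition tbox n (A : 'I_n -> set T) : set (n.-tuple T) :=
  [set t | forall i, A i (tnth t i)].

Lemma tboxE n (A : 'I_n -> set T) :
  tbox A = \bigcap_(i in [set: 'I_n]) ((@tnth n T)^~ i @^-1` A i).
Proof. by apply/seteqP; split => t tA i; [move=> _|]; exact: (tA i). Qed.

Lemma measurable_tbox n (A : 'I_n -> set T) :
  (forall i, measurable (A i)) -> measurable (tbox A).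
Proof.
move=> mA; rewrite tboxE; apply: fin_bigcap_measurable => [|i _].
  exact: finite_finset.
by rewrite -[_ @^-1` _]setTI; exact: measurable_tnth.
Qed.

Lemma measurable_tupleE n : @measurable _ (n.-tuple T) =
  <<s [set X | exists2 A : 'I_n -> set T, (forall i, measurable (A i)) & X = tbox A] >>.
Proof.
apply/seteqP; split; last first.
  apply: smallest_sub; first exact: sigma_algebra_measurable.
  by move=> _ [A mA ->]; exact: measurable_tbox.
apply: smallest_sub; first exact: smallest_sigma_algebra.
move=> X; rewrite -bigcup_seq => -[i _ [B mB <-]].
apply: sub_sigma_algebra; exists (fun j => if j == i then B else setT).
  by move=> j; case: ifP.
apply/seteqP; split => t /=.
  by move=> [_ Bt] j; case: eqP => // ->.
by move=> /(_ i); rewrite eqxx.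
Qed.

(** Boxes form a pi-system that generates the sigma-algebra of tuples, and boxes with
    equal sides of finite measure exhaust the space. *)
Lemma tuple_measure_unique n (nu : {measure set (n.-tuple T) -> \bar R}) :
  (forall A : 'I_n -> set T, (forall i, measurable (A i)) ->
    nu (tbox A) = (\prod_(i < n) m (A i))%E) ->
  forall X, measurable X -> tuple_measure m n X = nu X.
Proof.
move=> nubox X mX.
have tmE A (mA : forall i, measurable (A i)) :
  tuple_measure m n (tbox A) = (\prod_(i < n) m (A i))%E := tuple_measure_box m mA.
have /sigma_finiteP[F [FT ndF mF]] := sigma_finiteT m.
apply: (measure_unique _ (fun k => tbox (fun=> F k)) (measurable_tupleE n)) => //.
- move=> _ _ [A mA ->] [B mB ->]; exists (fun i => A i `&` B i).
    by move=> i; exact: measurableI.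
  apply/seteqP; split => t /=; first by move=> [At Bt] i; split; [exact: At|exact: Bt].
  by move=> AB; split => i; have [] := AB i.
- by move=> k; exists (fun=> F k) => // _; exact: (mF k).1.
- apply/seteqP; split => // t _.
  have tF i : exists k, F k (tnth t i).
    by have : [set: T] (tnth t i) by []; rewrite FT => -[k _ ?]; exists k.
  have [k kF] := choice tF.
  exists (\max_(i < n) k i)%N => //= i.
  by have /subsetPset := ndF _ _ (leq_bigmax i : (k i <= \max_(i < n) k i)%N); apply.
- by move=> _ [A mA ->]; rewrite nubox// [LHS]tmE.
- move=> k; rewrite [X in (X < _)%E]tmE; last by move=> i; exact: (mF k).1.
  rewrite ltey_eq prode_fin_num// => i _.
  by rewrite ge0_fin_numE// (mF k).2.
Qed.

Lemma tuple_fubini_tonelli n (f : n.+1.-tuple T -> \bar R) :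
  measurable_fun [set: n.+1.-tuple T] f -> (forall t, (0 <= f t)%E) ->
  (\int[tuple_measure m n.+1]_t f t =
   \int[m]_x \int[tuple_measure m n]_y f [tuple of x :: y])%E.
Proof.
move=> mf f0.
have mcons : measurable_fun setT (fun p : T * n.-tuple T => [the n.+1.-tuple T of p.1 :: p.2]).
  exact: measurable_cons.
transitivity (\int[pushforward (m \x tuple_measure m n)%E
    (fun p : T * n.-tuple T => [the n.+1.-tuple T of p.1 :: p.2])]_t f t)%E.
  by [].
rewrite ge0_integral_pushforward//.
rewrite fubini_tonelli1//=; first exact: sigma_finiteT.
exact: (measurableT_comp mf mcons).
Qed.

Lemma tuple_integral_prod n (g : 'I_n -> T -> R) :
  (forall i, measurable_fun setT (g i)) -> (forall i x, 0 <= g i x) ->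
  (\int[tuple_measure m n]_t (\prod_(i < n) g i (tnth t i))%:E =
   \prod_(i < n) \int[m]_x (g i x)%:E)%E.
Proof.
elim: n g => [|n IH] g mg g0.
  rewrite big_ord0; under eq_integral do rewrite big_ord0.
  rewrite integral_cst// mul1e; change (tuple_measure m 0 setT = 1%E).
  by rewrite /tuple_measure /dirac indicE mem_set.
have mprod k (h : 'I_k -> T -> R) : (forall i, measurable_fun setT (h i)) ->
    measurable_fun setT (fun t : k.-tuple T => \prod_(i < k) h i (tnth t i)).
  move=> mh; apply: measurable_prod => i _.
  by apply: measurableT_comp => //; exact: measurable_tnth.
rewrite tuple_fubini_tonelli; last 2 first.
- by apply/measurable_EFinP; apply: (mprod _ g).
- by move=> t; rewrite lee_fin; apply: prodr_ge0 => i _.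
transitivity (\int[m]_x ((g ord0 x)%:E *
    \int[tuple_measure m n]_y (\prod_(i < n) g (lift ord0 i) (tnth y i))%:E))%E.
  apply: eq_integral => x _; rewrite -ge0_integralZl_EFin//; last 2 first.
  - by move=> y _; rewrite lee_fin; apply: prodr_ge0 => i _.
  - by apply/measurable_EFinP; apply: (mprod _ (fun i => g (lift ord0 i))).
  apply: eq_integral => y _; rewrite big_ord_recl -EFinM; congr ((_ * _)%:E).
  by apply: eq_bigr => i _; rewrite tnthS.
rewrite (IH (fun i => g (lift ord0 i)))// big_ord_recl; under eq_integral do rewrite muleC.
rewrite ge0_integralZl//; first by rewrite muleC.
- exact/measurable_EFinP.
- by move=> x _; rewrite lee_fin.
- by apply: prode_ge0 => i _; apply: integral_ge0 => x _; rewrite lee_fin.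
Qed.

(** For finite measures, the whole space is a box that exhausts it. *)
Lemma tuple_measure_ext n (nu1 nu2 : {measure set (n.-tuple T) -> \bar R}) :
  (forall A : 'I_n -> set T, (forall i, measurable (A i)) ->
    nu1 (tbox A) = nu2 (tbox A)) ->
  (nu1 setT < +oo)%E -> forall X, measurable X -> nu1 X = nu2 X.
Proof.
move=> nu12 nu1T X mX.
apply: (measure_unique _ (fun k => setT) (measurable_tupleE n)) => //.
- move=> _ _ [A mA ->] [B mB ->]; exists (fun i => A i `&` B i).
    by move=> i; exact: measurableI.
  apply/seteqP; split => t /=; first by move=> [At Bt] i; split; [exact: At|exact: Bt].
  by move=> AB; split => i; have [] := AB i.
- by move=> k; exists (fun=> setT) => //; apply/seteqP; split.
- by apply/seteqP; split => // t _; exists 0%N.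
- by move=> _ [A mA ->]; exact: nu12.
Qed.

End tuple_measure_theory.

Section density_measure.
Local Open Scope ereal_scope.
Context {d} {T : measurableType d} {R : realType}.
Variables (m : {measure set T -> \bar R}) (f : T -> R).
Hypotheses (mf : measurable_fun setT f) (f0 : forall x, (0 <= f x)%R).

Definition density_measure (A : set T) := \int[m]_(x in A) (f x)%:E.

Let density_measure0 : density_measure set0 = 0.
Proof. exact: integral_set0. Qed.

Let density_measure_ge0 A : 0 <= density_measure A.
Proof. by apply: integral_ge0 => x _; rewrite lee_fin. Qed.

Let density_measure_additive : semi_sigma_additive density_measure.
Proof.
move=> F mF tF mUF; rewrite /density_measure ge0_integral_bigcup//=.
- by apply: is_cvg_ereal_nneg_natsum => n _; exact: density_measure_ge0.
- by apply/measurable_EFinP; exact: measurable_funTS.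
- by move=> x _; rewrite lee_fin.
Qed.

Lemma density_measureP :
  {mu : {measure set T -> \bar R} | density_measure = mu :> (_ -> _)}.
Proof.
pose M := isMeasure.Build _ _ _ density_measure density_measure0
  density_measure_ge0 density_measure_additive.
pose mu : {measure set T -> \bar R} := HB.pack density_measure M.
by exists mu.
Qed.

End density_measure.

Section joint_law.
Context {R : realType} {dT} {T : measurableType dT} {dO} {Omega : measurableType dO}.
Context (m : {sigma_finite_measure set T -> \bar R}) (P : probability Omega R).
Variables (X : nat -> {RV P >-> T}) (f : T -> R).
Hypotheses (mf : measurable_fun setT f) (f0 : forall x, 0 <= f x).
Hypothesis Xf : forall i A, measurable A ->
  P (X i @^-1` A) = (\int[m]_(x in A) (f x)%:E)%E.
Hypothesis Xind : forall (J : {fset nat}) (A : nat -> set T),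
    (forall i, measurable (A i)) ->
    P (\bigcap_(i in [set` J]) X i @^-1` A i) =
    (\prod_(i <- J) P (X i @^-1` A i))%E.

Lemma measurable_vector n (s : n.-tuple nat) :
  measurable_fun setT (fun w => [tuple X (tnth s i) w | i < n]).
Proof.
apply/measurable_fun_tnthP => i.
rewrite (_ : _ \o _ = X (tnth s i)); first exact: measurable_funP.
by apply/funext => w /=; rewrite tnth_mktuple.
Qed.

(** On a box, independence turns the probability into a product of integrals, which
    is the integral of the product density. Finite measures that agree on boxes are
    equal. *)
Lemma joint_law n (s : n.-tuple nat) (A : set (n.-tuple T)) :
  uniq s -> measurable A ->
  P [set w | A [tuple X (tnth s i) w | i < n]] =
  (\int[tuple_measure m n]_(t in A) (\prod_(i < n) f (tnth t i))%:E)%E.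
Proof.
move=> us mA.
have mprod : measurable_fun setT (fun t : n.-tuple T => \prod_(i < n) f (tnth t i)).
  apply: measurable_prod => i _.
  by apply: measurableT_comp => //; exact: measurable_tnth.
have prod0 (t : n.-tuple T) : 0 <= \prod_(i < n) f (tnth t i).
  by apply: prodr_ge0 => i _.
have [nu2 nu2E] := density_measureP (tuple_measure m n) mprod prod0.
pose nu1 : {measure set _ -> \bar R} :=
  measure_function_pushforward__canonical__measure_function_Measure P (measurable_vector s).
rewrite -[RHS]/(density_measure _ _ A) nu2E.
suff : nu1 A = nu2 A by [].
apply: tuple_measure_ext => //; last first.
  by rewrite /nu1 /= /pushforward preimage_setT probability_setT ltry.
move=> B mB; rewrite -nu2E /density_measure integral_mkcond.
transitivity (\int[tuple_measure m n]_t
    (\prod_(i < n) (f (tnth t i) * \1_(B i) (tnth t i)))%:E)%E; last first.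
  apply: eq_integral => t _; rewrite /patch; case: ifPn => [|tB].
    rewrite inE => tB; congr EFin; apply: eq_bigr => i _.
    by rewrite indicE mem_set ?mulr1//; exact: tB.
  have [i tBi] : exists i, ~ B i (tnth t i).
    by apply: contrapT => /forallNP tB'; case/negP : tB; rewrite inE => i; exact: contrapT.
  by rewrite (bigD1 i)//= indicE memNset// mulr0 mul0r.
rewrite (tuple_integral_prod m (g := fun i x => f x * \1_(B i) x)); last 2 first.
- by move=> i; apply: measurable_funM => //; exact: measurable_indic.
- by move=> i x; rewrite mulr_ge0// indicE.
have /eqP szs := size_tuple s.
(* The box is indexed by positions in s, independence by sample indices. *)
pose B' j := if (insub (index j s) : option 'I_n) is Some i then B i else setT.
have B'E i : B' (tnth s i) = B i.
  by rewrite /B' (tnth_nth 0%N) index_uniq ?size_tuple// valK.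
have mB' j : measurable (B' j) by rewrite /B'; case: insub.
transitivity (P (\bigcap_(j in [set` [fset j in tval s]%fset]) X j @^-1` B' j)).
  rewrite /nu1 /= /pushforward; congr (P _); apply/seteqP; split => w /=.
    move=> wB j; rewrite /= inE => /tnthP[i ->].
    by rewrite B'E; have := wB i; rewrite tnth_mktuple.
  move=> wB i; rewrite tnth_mktuple -B'E; apply: wB.
  by rewrite /= inE mem_tnth.
have sp : perm_eq (enum_fset [fset j in tval s]%fset) (tval s).
  by apply: uniq_perm; rewrite ?fset_uniq// => j; rewrite inE.
rewrite Xind// (perm_big _ sp) /=.
rewrite big_tuple; apply: eq_bigr => i _; rewrite B'E Xf// integral_mkcond.
apply: eq_integral => x _; rewrite /patch indicE.
by case: ifPn; rewrite ?mulr1 ?mulr0.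
Qed.

End joint_law.

(** * Invariance of Lebesgue measure under translations and reflections *)

Section measure_preserving.
Context {d} {T : measurableType d} {R : realType}.
Variable m : {sigma_finite_measure set T -> \bar R}.

Lemma ge0_integral_preserving d' (S : measurableType d') (nu : {measure set S -> \bar R})
    (phi : S -> S) (f : S -> \bar R) :
  measurable_fun setT phi ->
  (forall A, measurable A -> nu (phi @^-1` A) = nu A) ->
  measurable_fun setT f -> (forall x, (0 <= f x)%E) ->
  (\int[nu]_x f (phi x) = \int[nu]_x f x)%E.
Proof.
move=> mphi nuphi mf f0.
rewrite -[LHS](ge0_integral_pushforward mphi nu measurableT mf)//.
by apply: eq_measure_integral => A mA _; exact: nuphi.
Qed.

Lemma measurable_tnth_comp d' (S : measurableType d') n (f : S -> n.-tuple T) i :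
  measurable_fun setT f -> measurable_fun setT (fun s => tnth (f s) i).
Proof. by move=> mf; apply: (measurableT_comp (measurable_tnth i) mf). Qed.

Lemma measurable_tuple_map n (phi : 'I_n -> T -> T) :
  (forall i, measurable_fun setT (phi i)) ->
  measurable_fun setT (fun t : n.-tuple T => [tuple phi i (tnth t i) | i < n]).
Proof.
move=> mphi; apply/measurable_fun_tnthP => i.
rewrite (_ : _ \o _ = phi i \o (@tnth n T)^~ i).
  by apply: measurableT_comp => //; exact: measurable_tnth.
by apply/funext => t /=; rewrite tnth_mktuple.
Qed.

Lemma tuple_measure_map n (phi : 'I_n -> T -> T) X :
  (forall i, measurable_fun setT (phi i)) ->
  (forall i A, measurable A -> m (phi i @^-1` A) = m A) -> measurable X ->
  tuple_measure m n ((fun t => [tuple phi i (tnth t i) | i < n]) @^-1` X) =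
  tuple_measure m n X.
Proof.
move=> mphi phim mX.
pose nu : {measure set (n.-tuple T) -> \bar R} :=
  measure_function_pushforward__canonical__measure_function_Measure
  (tuple_measure m n) (measurable_tuple_map mphi).
apply/esym; change (tuple_measure m n X = nu X).
apply: tuple_measure_unique => // A mA.
transitivity (tuple_measure m n (tbox (fun i => phi i @^-1` A i))).
  rewrite /nu /= /pushforward; congr (tuple_measure m n _).
  by apply/seteqP; split => t tA i; have := tA i; rewrite /= tnth_mktuple.
rewrite [LHS]tuple_measure_box; last first.
  by move=> i; rewrite -[X in measurable X]setTI; exact: (mphi i measurableT _ (mA i)).
by apply: eq_bigr => i _; exact: phim.
Qed.

End measure_preserving.

Section lebesgue_line.
Context {R : realType}.

Lemma lebesgueR_translation (v : R) (A : set R) : measurable A ->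
  lebesgueR (+%R v @^-1` A) = lebesgueR A.
Proof.
move=> mA; have mv : measurable_fun setT (+%R v : measurableTypeR R -> measurableTypeR R).
  exact: measurable_funD.
pose nu : {measure set (measurableTypeR R) -> \bar R} :=
  measure_function_pushforward__canonical__measure_function_Measure
  (@lebesgue_measure R) mv.
apply/esym; change (lebesgue_measure A = nu A).
apply: lebesgue_measure_unique => // _ [[a b]] _ <-.
rewrite /nu /= /pushforward (_ : +%R v @^-1` _ = `]a - v, b - v]%classic).
  rewrite !lebesgue_measure_itv /= !lte_fin ltrD2r.
  by case: ifP => // _; rewrite -!EFinD; congr EFin; lra.
by apply/seteqP; split => x /=; rewrite !in_itv/=; lra.
Qed.

Lemma lebesgueR_scale (c : R) (A : set R) : 0 < c -> measurable A ->
  (c%:E * lebesgueR ( *%R c @^-1` A) = lebesgueR A)%E.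
Proof.
move=> c0 mA; have mc : measurable_fun setT ( *%R c : measurableTypeR R -> measurableTypeR R).
  exact: measurable_funM.
pose nu : {measure set (measurableTypeR R) -> \bar R} :=
  measure_function_pushforward__canonical__measure_function_Measure
  (@lebesgue_measure R) mc.
apply/esym; change (lebesgue_measure A = mscale (NngNum (ltW c0)) nu A).
apply: lebesgue_measure_unique => // _ [[a b]] _ <-.
change (lebesgue_measure `]a, b]%classic =
  c%:E * lebesgue_measure ( *%R c @^-1` `]a, b]%classic))%E.
rewrite (_ : *%R c @^-1` _ = `]a / c, b / c]%classic).
  rewrite !lebesgue_measure_itv /= !lte_fin ltr_pM2r ?invr_gt0//.
  case: ifP => _; last by rewrite mule0.
  by rewrite -!EFinD -EFinM; congr EFin; field; exact: lt0r_neq0.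
apply/seteqP; split => x /=; rewrite !in_itv/= ler_pdivlMr// ltr_pdivrMr//;
  by rewrite (mulrC c).
Qed.

End lebesgue_line.

Section lebesgue_space.
Context {R : realType} {d : nat}.
Local Notation E := (d.-tuple R).
Local Notation lam := (@lebesgue_tuple R d).

Lemma measurable_mktuple d' (S : measurableType d') (h : 'I_d -> S -> R) :
  (forall i, measurable_fun setT (h i)) ->
  measurable_fun setT (fun t => [tuple h i t | i < d]).
Proof.
move=> mh; apply/measurable_fun_tnthP => i.
rewrite (_ : _ \o _ = h i) //.
by apply/funext => t /=; rewrite tnth_mktuple.
Qed.

Lemma measurable_tadd d' (S : measurableType d') (f g : S -> E) :
  measurable_fun setT f -> measurable_fun setT g ->
  measurable_fun setT (fun s => tadd (f s) (g s)).
Proof.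
move=> mf mg; apply: measurable_mktuple => i.
by apply: measurable_funD; exact: measurable_tnth_comp.
Qed.

Lemma measurable_tsub d' (S : measurableType d') (f g : S -> E) :
  measurable_fun setT f -> measurable_fun setT g ->
  measurable_fun setT (fun s => tsub (f s) (g s)).
Proof.
move=> mf mg; apply: measurable_mktuple => i.
by apply: measurable_funB; exact: measurable_tnth_comp.
Qed.

Lemma measurable_tscale d' (S : measurableType d') (c : S -> R) (f : S -> E) :
  measurable_fun setT c -> measurable_fun setT f ->
  measurable_fun setT (fun s => tscale (c s) (f s)).
Proof.
move=> mc mf; apply: measurable_mktuple => i.
by apply: measurable_funM => //; exact: measurable_tnth_comp.
Qed.

Lemma measurable_tdot d' (S : measurableType d') (f g : S -> E) :
  measurable_fun setT f -> measurable_fun setT g ->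
  measurable_fun setT (fun s => tdot (f s) (g s)).
Proof.
move=> mf mg; apply: measurable_sum => i.
by apply: measurable_funM; exact: measurable_tnth_comp.
Qed.

Lemma measurable_enorm d' (S : measurableType d') (f : S -> E) :
  measurable_fun setT f -> measurable_fun setT (fun s => enorm (f s)).
Proof.
move=> mf; under eq_fun do rewrite enormE.
have msqrt : measurable_fun setT (@Num.sqrt R : R -> R).
  by apply: continuous_measurable_fun; exact: sqrt_continuous.
exact: (measurableT_comp msqrt (measurable_tdot mf mf)).
Qed.

Lemma measurable_edist d' (S : measurableType d') (f g : S -> E) :
  measurable_fun setT f -> measurable_fun setT g ->
  measurable_fun setT (fun s => edist (f s) (g s)).
Proof. by move=> mf mg; apply: measurable_enorm; exact: measurable_tsub. Qed.

Lemma measurable_householder u : measurable_fun setT (householder u : E -> E).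
Proof.
apply: measurable_tsub => //; apply: measurable_tscale => //.
apply: measurable_funM => //; apply: measurable_funM => //.
exact: measurable_tdot.
Qed.

Lemma measurable_preimageT d' d'' (S : measurableType d') (S' : measurableType d'')
    (f : S -> S') (A : set S') :
  measurable_fun setT f -> measurable A -> measurable (f @^-1` A).
Proof. by move=> mf mA; rewrite -[X in measurable X]setTI; exact: mf. Qed.

Lemma lebesgue_translation v (A : set E) : measurable A ->
  lam (tadd v @^-1` A) = lam A.
Proof.
move=> mA; rewrite -[RHS](@tuple_measure_map _ _ _ lebesgueR d (fun i => +%R (tnth v i)))//.
  by move=> i; exact: measurable_funD.
by move=> i; exact: lebesgueR_translation.
Qed.

Lemma lebesgue_scale (c : R) (A : set E) : 0 < c -> measurable A ->
  ((c ^+ d)%:E * lam (tscale c @^-1` A) = lam A)%E.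
Proof.
move=> c0 mA; have cd0 : 0 <= c ^+ d by rewrite exprn_ge0// ltW.
have mc : measurable_fun setT (tscale c : E -> E) by exact: measurable_tscale.
pose nu : {measure set E -> \bar R} :=
  measure_function_pushforward__canonical__measure_function_Measure lam mc.
apply/esym; change (tuple_measure lebesgueR d A = mscale (NngNum cd0) nu A).
apply: tuple_measure_unique => // B mB.
change ((c ^+ d)%:E * lam (tscale c @^-1` tbox B) =
  \prod_(i < d) lebesgueR (B i))%E.
rewrite (_ : _ @^-1` _ = tbox (fun i => *%R c @^-1` B i)); last first.
  by apply/seteqP; split => t tA i; have := tA i; rewrite /= tE.
have mcB i : measurable ( *%R c @^-1` B i) by apply: measurable_preimageT => //; exact: measurable_funM.
rewrite [X in (_ * X)%E](tuple_measure_box lebesgueR mcB).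
rewrite -[X in c ^+ X]card_ord -prodr_const -prodEFin -big_split.
by apply: eq_bigr => i _; rewrite /= lebesgueR_scale.
Qed.

(** The integral of 1_A x * 1_B (x + y) against the product of mu and Lebesgue measure
    is mu A * lam B if y is integrated first. If x is integrated first and translated
    by y, the roles of A and B are exchanged, and A is reflected through the origin.
    Thus mu is proportional to Lebesgue measure. *)
Lemma translation_invariant_unique (mu : {sigma_finite_measure set E -> \bar R}) A B :
  (forall v C, measurable C -> mu (tadd v @^-1` C) = mu C) ->
  measurable A -> measurable B ->
  (mu A * lam B = mu B * lam (tscale (-1) @^-1` A))%E.
Proof.
move=> muT mA mB.
have mi d' (S : measurableType d') (f : S -> E) (C : set E) :
    measurable_fun setT f -> measurable C -> measurable_fun setT (fun s => \1_C (f s) : R).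
  move=> mf mC; have mI : measurable_fun setT (\1_C : E -> R) by exact: measurable_indic.
  exact: (measurableT_comp mI mf).
have mN : measurable_fun setT (tscale (-1) : E -> E) by exact: measurable_tscale.
have mNA : measurable (tscale (-1) @^-1` A) by exact: measurable_preimageT.
pose F (p : E * E) : \bar R := (\1_A p.1 * \1_B (tadd p.1 p.2))%:E.
pose G (p : E * E) : \bar R := (\1_A (tadd (tscale (-1) p.2) p.1) * \1_B p.1)%:E.
have mF : measurable_fun setT F.
  apply/measurable_EFinP; apply: measurable_funM; apply: mi => //.
  exact: measurable_tadd.
have mG : measurable_fun setT G.
  apply/measurable_EFinP; apply: measurable_funM; apply: mi => //.
  by apply: measurable_tadd => //; apply: measurable_tscale.
have F0 p : (0 <= F p)%E by rewrite lee_fin mulr_ge0// indicE.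
have G0 p : (0 <= G p)%E by rewrite lee_fin mulr_ge0// indicE.
have indic_ge0 (C : set E) x : 0 <= \1_C x :> R by rewrite indicE.
have intI (nu : {measure set E -> \bar R}) (k : R) (C : set E) : 0 <= k -> measurable C ->
    (\int[nu]_x (k * \1_C x)%:E = k%:E * nu C)%E.
  move=> k0 mC; under eq_integral do rewrite EFinM.
  rewrite ge0_integralZl_EFin ?integral_indic ?setIT//.
  by apply/measurable_EFinP; exact: measurable_indic.
have LF x : (\int[lam]_y F (x, y) = (\1_A x)%:E * lam B)%E.
  rewrite -(lebesgue_translation x mB) -(intI lam) ?indic_ge0//.
  by apply: measurable_preimageT => //; exact: measurable_tadd.
have RF y : (\int[mu]_x F (x, y) = \int[mu]_x G (x, y))%E.
  rewrite -(ge0_integral_preserving (phi := tadd y) (nu := mu) (f := fun x => G (x, y)))//; last 3 first.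
  - exact: measurable_tadd.
  - by move=> C mC; exact: muT.
  - by apply: measurableT_comp => //; exact: pair2_measurable.
  by apply: eq_integral => x _; rewrite /F /G /= taddKV (taddC x).
have RG x : (\int[lam]_y G (x, y) = (\1_B x)%:E * lam (tscale (-1)%R @^-1` A))%E.
  rewrite -(lebesgue_translation (tscale (-1) x) mNA) -(intI lam) ?indic_ge0//; last first.
    by apply: measurable_preimageT => //; exact: measurable_tadd.
  apply: eq_integral => y _; rewrite /G /= mulrC; congr ((_ * _)%:E).
  have xyE : tscale (-1) (tadd (tscale (-1) x) y) = tadd (tscale (-1) y) x.
    by apply: eq_from_tnth => i; rewrite !tE; lra.
  rewrite !indicE; suff -> : (y \in tadd (tscale (-1) x) @^-1` (tscale (-1) @^-1` A)) = (tadd (tscale (-1) y) x \in A) by [].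
  by apply/idP/idP; rewrite !inE /preimage /= xyE.
have intr (nu : {measure set E -> \bar R}) (k : \bar R) (C : set E) : (0 <= k)%E -> measurable C ->
    (\int[nu]_x ((\1_C x)%:E * k) = nu C * k)%E.
  move=> k0 mC; rewrite ge0_integralZr ?integral_indic ?setIT//.
  by apply/measurable_EFinP; exact: measurable_indic.
rewrite -!intr//; under eq_integral do rewrite -LF.
under [RHS]eq_integral do rewrite -RG.
transitivity (\int[mu]_x \int[lam]_y F (x, y))%E; first by [].
rewrite (fubini_tonelli (m1 := mu) (m2 := lam) F mF F0).
transitivity (\int[mu]_x \int[lam]_y G (x, y))%E; last by [].
rewrite (fubini_tonelli (m1 := mu) (m2 := lam) G mG G0).
by apply: eq_integral => y _; exact: RF.
Qed.

End lebesgue_space.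

(** * Polar coordinates *)

Section integral_density.
Local Open Scope ereal_scope.
Context {d} {T : measurableType d} {R : realType}.
Variables (m nu : {measure set T -> \bar R}) (f : T -> R).
Hypotheses (mf : measurable_fun setT f) (f0 : forall x, (0 <= f x)%R).
Hypothesis nuf : forall A, measurable A -> nu A = \int[m]_(x in A) (f x)%:E.

Import HBNNSimple.

Let integral_density_nnsfun (h : {nnsfun T >-> R}) :
  \int[nu]_x (h x)%:E = \int[m]_x ((h x)%:E * (f x)%:E).
Proof.
have mh r : measurable (h @^-1` [set r]) by [].
under [LHS]eq_integral do rewrite fimfunE -fsumEFin//.
rewrite [LHS]ge0_integral_fsum//; last 2 first.
  - by move=> r; exact/measurable_EFinP/measurableT_comp.
  - by move=> n x _; rewrite EFinM nnfun_muleindic_ge0.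
under [RHS]eq_integral.
  move=> x xD; rewrite fimfunE -fsumEFin// muleC ge0_mule_fsumr; last first.
    by move=> r; rewrite EFinM nnfun_muleindic_ge0.
  over.
rewrite [RHS]ge0_integral_fsum//; last 2 first.
  - move=> r; apply: emeasurable_funM; first exact/measurable_EFinP.
    exact/measurable_EFinP/measurableT_comp.
  - by move=> n x _; apply: mule_ge0; [rewrite lee_fin|rewrite EFinM nnfun_muleindic_ge0].
apply: eq_fsbigr => r; rewrite inE /= => -[t _ htr].
have r0 : (0 <= r)%R by rewrite -htr.
under [LHS]eq_integral do rewrite EFinM.
rewrite ge0_integralZl_EFin//; last by apply/measurable_EFinP; exact: measurable_indic.
rewrite integral_indic// setIT nuf//.
under [RHS]eq_integral do rewrite EFinM muleCA.
rewrite ge0_integralZl_EFin//; last 2 first.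
  - by move=> x _; apply: mule_ge0; rewrite lee_fin// indicE.
  - apply: emeasurable_funM; first exact/measurable_EFinP.
    by apply/measurable_EFinP; exact: measurable_indic.
congr (_ * _); rewrite integral_mkcond; apply: eq_integral => x _.
by rewrite /patch indicE; case: ifPn; rewrite ?mule1 ?mule0.
Qed.

(** The identity holds for indicators, hence for simple functions, and passes to
    monotone limits. *)
Lemma integral_density (g : T -> \bar R) :
  measurable_fun setT g -> (forall x, 0 <= g x) ->
  \int[nu]_x g x = \int[m]_x (g x * (f x)%:E).
Proof.
move=> mg g0; pose g_ := nnsfun_approx measurableT mg.
have g_g x : EFin \o g_ ^~ x @ \oo --> g x.
  by apply: cvg_nnsfun_approx => // *; exact: g0.
transitivity (limn (fun n => \int[nu]_x (g_ n x)%:E)).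
  rewrite -monotone_convergence//=.
  - by apply: eq_integral => x _; apply/esym/cvg_lim => //; exact: g_g.
  - by move=> n; apply: measurableT_comp.
  - by move=> n x _; rewrite lee_fin.
  - by move=> x _ a b ab; rewrite lee_fin//; exact/lefP/nd_nnsfun_approx.
rewrite (_ : \int[m]_x _ = limn (fun n => \int[m]_x ((g_ n x)%:E * (f x)%:E))).
  by congr (limn _); apply/funext => n /=; exact: integral_density_nnsfun.
rewrite -monotone_convergence//=.
- apply: eq_integral => x _; apply/esym/cvg_lim => //.
  by apply: cvgeZr => //; exact: g_g.
- move=> n; apply: emeasurable_funM; last exact/measurable_EFinP.
  by apply: measurableT_comp.
- by move=> n x _; apply: mule_ge0; rewrite lee_fin.
- move=> x _ a b ab; apply: lee_wpmul2r; rewrite lee_fin//.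
  exact/lefP/nd_nnsfun_approx.
Qed.

End integral_density.

Section unit_ball.
Context {R : realType} {d : nat}.
Hypothesis d0 : (0 < d)%N.
Local Notation E := (d.-tuple R).
Local Notation lam := (@lebesgue_tuple R d).

Lemma eball_origin (r : R) : eball r origin = [set x : E | enorm x <= r].
Proof. by apply/seteqP; split => x /=; rewrite /eball /= edist0. Qed.

Lemma measurable_norm_le (r : R) : measurable [set x : E | enorm x <= r].
Proof.
have -> : [set x : E | enorm x <= r] = (fun x : E => enorm x) @^-1` `]-oo, r]%classic.
  by apply/seteqP; split => x /=; rewrite in_itv.
by apply: measurable_preimageT => //; exact: measurable_enorm.
Qed.

Lemma tnth_le_enorm (x : E) i : `|tnth x i| <= enorm x.
Proof.
rewrite -(@ler_pXn2r _ 2)// ?nnegrE ?enorm_ge0// enorm_sqr real_normK ?num_real//.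
rewrite /tdot (bigD1 i)//= -expr2 lerDl sumr_ge0// => j _.
by rewrite -expr2 sqr_ge0.
Qed.

Lemma lebesgue_cube (a b : R) : a <= b ->
  lam (tbox (fun=> `[a, b]%classic)) = ((b - a) ^+ d)%:E.
Proof.
move=> ab; rewrite [LHS]lebesgue_tuple_box//.
rewrite -[X in (b - a) ^+ X]card_ord -prodr_const -prodEFin.
apply: eq_bigr => i _; rewrite lebesgue_measure_itv /= lte_fin.
case: ltP => // ba; have -> : b = a by apply/eqP; rewrite eq_le ba ab.
by rewrite subrr.
Qed.

Lemma norm_le_sub_cube (r : R) :
  [set x : E | enorm x <= r] `<=` tbox (fun=> `[- r, r]%classic).
Proof.
move=> x /= xr i /=; rewrite in_itv/= -ler_norml.
exact: le_trans (tnth_le_enorm _ _) xr.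
Qed.

Lemma measurable_cube (a b : R) : measurable (tbox (fun=> `[a, b]%classic) : set E).
Proof. exact: measurable_tbox. Qed.

Lemma lebesgue_norm_le_lty (r : R) : (lam [set x : E | (enorm x <= r)%R] < +oo)%E.
Proof.
have [r0|r0] := leP 0 r; last first.
  rewrite (_ : [set x : E | _] = set0) ?measure0 ?ltry//.
  apply/seteqP; split => // x /= xr.
  by have := enorm_ge0 x; rewrite leNgt (le_lt_trans xr r0).
apply: (@le_lt_trans _ _ (lam (tbox (fun _ : 'I_d => `[- r, r]%classic : set R)))).
  apply: le_measure; rewrite ?inE; [exact: measurable_norm_le|exact: measurable_cube|].
  exact: norm_le_sub_cube.
by rewrite lebesgue_cube ?ltry//; lra.
Qed.

Definition ball_volume : R := fine (lam [set x : E | enorm x <= 1]).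

Lemma ball_volumeE : lam [set x : E | enorm x <= 1] = ball_volume%:E.
Proof. by rewrite fineK// ge0_fin_numE// lebesgue_norm_le_lty. Qed.

(** The unit ball contains the cube of half-side 1 / d. *)
Lemma ball_volume_gt0 : 0 < ball_volume.
Proof.
rewrite -lte_fin -ball_volumeE.
have iv0 : 0 < d%:R^-1 :> R by rewrite invr_gt0 ltr0n.
have sub : tbox (fun _ : 'I_d => `[- d%:R^-1, d%:R^-1]%classic : set R) `<=` [set x : E | enorm x <= 1].
  move=> x xd; apply: enorm_le_coord => // i.
  by have := xd i; rewrite /= in_itv/= -ler_norml div1r.
apply: (@lt_le_trans _ _ (lam (tbox (fun _ : 'I_d => `[- d%:R^-1, d%:R^-1]%classic : set R)))).
  by rewrite lebesgue_cube ?lte_fin ?exprn_gt0//; lra.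
by apply: le_measure; rewrite ?inE; [exact: measurable_cube|exact: measurable_norm_le|].
Qed.

(** The image of Lebesgue measure by a reflection is translation invariant, hence
    proportional to Lebesgue measure; the constant is 1 since the unit ball is
    preserved. *)
Lemma lebesgue_householder u (A : set E) : measurable A ->
  lam (householder u @^-1` A) = lam A.
Proof.
move=> mA; pose mu0 : {measure set E -> \bar R} :=
  measure_function_pushforward__canonical__measure_function_Measure
  lam (measurable_householder u).
have mH (B : set E) : measurable B -> measurable (householder u @^-1` B).
  by apply: measurable_preimageT; exact: measurable_householder.
have HK (B : set E) : householder u @^-1` (householder u @^-1` B) = B.
  by apply/seteqP; split => x /=; rewrite householderK.
have mu0_sf : sigma_finite setT mu0.
  have /sigma_finiteP[F [FT ndF mF]] := sigma_finiteT lam.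
  exists (fun k => householder u @^-1` F k).
    apply/seteqP; split => // x _; have : [set: E] (householder u x) by [].
    by rewrite FT => -[k _ Fk]; exists k.
  move=> k; split; first by apply: mH; exact: (mF k).1.
  by rewrite /mu0 /= /pushforward HK; exact: (mF k).2.
have [mu muE] := sigma_finite_structure mu0_sf.
have muA B : mu B = lam (householder u @^-1` B) by rewrite -muE.
have muT v C : measurable C -> mu (tadd v @^-1` C) = mu C.
  move=> mC; rewrite !muA -[RHS](lebesgue_translation (householder u v)); last exact: mH.
  congr (lam _); apply/seteqP; split => x /=; by rewrite householderD householderK.
have := translation_invariant_unique muT (measurable_norm_le 1) mA.
rewrite !muA.
have -> : householder u @^-1` [set x | enorm x <= 1] = [set x : E | enorm x <= 1].
  by apply/seteqP; split => x /=; rewrite enorm_householder.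
have -> : tscale (-1) @^-1` [set x | enorm x <= 1] = [set x : E | enorm x <= 1].
  by apply/seteqP; split => x /=; rewrite enormZ normrN1 mul1r.
rewrite ball_volumeE muleC => /(congr1 (fun z => z * (ball_volume^-1)%:E)%E).
have b0 := lt0r_neq0 ball_volume_gt0.
by rewrite -!muleA -EFinM divff// !mule1.
Qed.

(** By scaling for positive radii, the ball of radius 0 being contained in arbitrarily
    small balls. *)
Lemma lebesgue_norm_le (r : R) :
  lam [set x : E | enorm x <= r] = (ball_volume * Num.max r 0 ^+ d)%:E.
Proof.
have pos c : 0 < c -> lam [set x : E | enorm x <= c] = (ball_volume * c ^+ d)%:E.
  move=> c0; rewrite -(lebesgue_scale c0 (measurable_norm_le c)).
  rewrite (_ : _ @^-1` _ = [set x : E | enorm x <= 1]) ?ball_volumeE -?EFinM 1?mulrC//.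
  by apply/seteqP; split => x /=; rewrite enormZ gtr0_norm// -ler_pdivlMl// mulVf ?lt0r_neq0.
have [r0|r0] := ltP 0 r; first by rewrite pos.
rewrite expr0n eqn0Ngt d0 mulr0.
have ball0 : lam [set x : E | enorm x <= 0] = 0%E.
  apply/eqP; rewrite eq_le measure_ge0 andbT; apply/lee_addgt0Pr => e e0.
  rewrite add0e.
  pose c := Num.min 1 (e / ball_volume).
  have b0 := ball_volume_gt0.
  have c0 : 0 < c by rewrite lt_min ltr01 divr_gt0.
  apply: (@le_trans _ _ (lam [set x : E | enorm x <= c])).
    apply: le_measure; rewrite ?inE; [exact: measurable_norm_le|exact: measurable_norm_le|].
    by move=> x /= /le_trans; apply; exact: ltW.
  rewrite pos// lee_fin -ler_pdivlMl// mulrC.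
  apply: (@le_trans _ _ c); last by rewrite /c ge_min lexx orbT.
  have c1 : c <= 1 by rewrite /c ge_min lexx.
  by rewrite -[leRHS]expr1 ler_wiXn2l// ltW.
apply/eqP; rewrite eq_le measure_ge0 andbT -[X in (_ <= X)%E]ball0.
apply: le_measure; rewrite ?inE; [exact: measurable_norm_le|exact: measurable_norm_le|].
by move=> x /= /le_trans; apply.
Qed.

End unit_ball.

Lemma continuous_sum (T : topologicalType) (R : realType) (I : Type) (s : seq I)
    (P : pred I) (h : I -> T -> R) :
  (forall i, continuous (h i)) -> continuous (fun v => \sum_(i <- s | P i) h i v).
Proof.
move=> ch; elim: s => [|i s IH].
  by under eq_fun do rewrite big_nil; exact: cst_continuous.
under eq_fun do rewrite big_cons; case: (P i) => // v.
by apply: cvgD; [exact: ch|exact: IH].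
Qed.

Section polar.
Context {R : realType} {d : nat}.
Hypothesis d0 : (0 < d)%N.
Local Notation E := (d.-tuple R).
Local Notation lam := (@lebesgue_tuple R d).
Local Notation mu := (@lebesgue_measure R).
Local Notation vol := (@ball_volume R d).

(** The derivative of the volume of the ball of radius t; d * vol is the area of the
    unit sphere by sphere_areaE. *)
Definition polar_density (t : R) : R :=
  d%:R * vol * t ^+ d.-1 * \1_(`]0, +oo[%classic) t.

Lemma polar_density_ge0 t : 0 <= polar_density t.
Proof.
rewrite /polar_density indicE; case: (boolP (t \in _)) => t0; last by rewrite mulr0.
move: t0; rewrite inE/= in_itv/= andbT => t0.
by rewrite mulr1 !mulr_ge0// ?exprn_ge0// ltW// ball_volume_gt0.
Qed.

Lemma measurable_polar_density : measurable_fun setT polar_density.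
Proof.
apply: measurable_funM; last exact: measurable_indic.
exact: measurable_funM.
Qed.

Lemma integral_power (a b : R) : 0 <= a -> a < b ->
  (\int[mu]_(t in `[a, b]) (d%:R * vol * t ^+ d.-1)%:E =
   (vol * b ^+ d - vol * a ^+ d)%:E)%E.
Proof.
move=> a0 ab.
have dF (t : R) : is_derive t 1 (fun t => vol * t ^+ d) (d%:R * vol * t ^+ d.-1).
  have -> : (fun t => vol * t ^+ d) = vol \*: (@id R ^+ d).
    by apply/funext => z; rewrite /= exprfctE.
  apply: is_derive_eq; rewrite /GRing.scale /= mulr1 mulrCA mulrA//.
have cF : continuous (fun t : R => vol * t ^+ d).
  by move=> t; apply: cvgM; [exact: cvg_cst|exact: exprn_continuous].
rewrite (@continuous_FTC2 _ _ (fun t => vol * t ^+ d)) ?EFinB//.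
- apply: continuous_subspaceT => t.
  by apply: cvgM; [exact: cvg_cst|exact: exprn_continuous].
- split.
  + by move=> t _; have [] := dF t.
  + exact/cvg_at_right_filter/cF.
  + exact/cvg_at_left_filter/cF.
- by move=> t _; rewrite derive1E; have [] := dF t.
Qed.

(** The law of the norm under Lebesgue measure is determined by the volumes of
    centred shells, that is, by lebesgue_norm_le. *)
Lemma polar_measure (B : set R) : measurable B ->
  lam [set x : E | B (enorm x)] = (\int[mu]_(t in B) (polar_density t)%:E)%E.
Proof.
move=> mB.
have mn : measurable_fun setT (@enorm R d : E -> measurableTypeR R).
  exact: measurable_enorm.
pose nu1 : {measure set (measurableTypeR R) -> \bar R} :=
  measure_function_pushforward__canonical__measure_function_Measure lam mn.
have [nu2 nu2E] := density_measureP mu measurable_polar_density polar_density_ge0.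
rewrite -[RHS]/(density_measure mu polar_density B) nu2E.
change (nu1 B = nu2 B).
apply: (@measure_unique _ R (measurableTypeR R) (@ocitv R)
  (fun n => `](- n%:R), n%:R]%classic)) => //.
- exact: ocitvI.
- by move=> n; exact: is_ocitv.
- apply/seteqP; split => // x _; have [n xn] : exists n, `|x| < n%:R.
    by exists (Num.truncn `|x|).+1; exact: truncnS_gt.
  exists n => //=; rewrite in_itv/=.
  by move: xn; rewrite ltr_norml => /andP[-> /ltW ->].
- move=> _ /ocitvP[->|[[a b] /= ab ->]]; first by rewrite !measure0.
  rewrite -nu2E /density_measure.
  have -> : nu1 `]a, b]%classic = lam ([set x : E | enorm x <= b] `\` [set x : E | enorm x <= a]).
    rewrite /nu1 /= /pushforward; congr (lam _); apply/seteqP; split => x /=.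
      by rewrite in_itv/= => /andP[ax xb]; split => //; apply/negP; rewrite -ltNge.
    by move=> [xb /negP]; rewrite -ltNge in_itv/= => -> .
  rewrite measureD; [|exact: measurable_norm_le|exact: measurable_norm_le|exact: lebesgue_norm_le_lty].
  rewrite setIidr; last by move=> x /= /le_trans; apply; exact: ltW.
  rewrite [X in (X - _)%E](lebesgue_norm_le d0) [X in (_ - X)%E](lebesgue_norm_le d0) -EFinB.
  (* Balls of negative radius are empty, and polar_density vanishes on ]-oo, 0]. *)
  pose a' := Num.max a 0; pose b' := Num.max b 0.
  transitivity (\int[mu]_(t in `]a', b']) (d%:R * vol * t ^+ d.-1)%:E)%E; last first.
    rewrite [LHS]integral_mkcond [RHS]integral_mkcond; apply: eq_integral => t _.
    rewrite /patch /polar_density indicE !mem_setE /= !in_itv/= andbT.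
    rewrite /a' /b' gt_max le_max.
    case: (ltP 0 t) => t0; rewrite ?andbT ?andbF ?mulr0 ?mulr1; last by case: ifP.
    by rewrite orbF.
  have [b0|b0] := leP b 0.
    rewrite /a' /b' !max_r// ?(le_trans (ltW ab))// subrr set_itvoc0 integral_set0//.
  have ab' : a' < b' by rewrite /a' /b' lt_max gt_max ab b0.
  have bb' : b' = b by rewrite /b' max_l// ltW.
  rewrite integral_itv_obnd_cbnd ?integral_power ?bb'//.
    by rewrite /a' le_max lexx orbT.
    by rewrite -bb'.
  have mp : measurable_fun setT (fun t : R => (d%:R * vol * t ^+ d.-1)%:E).
    by apply/measurable_EFinP; exact: measurable_funM.
  exact: (measurable_funTS mp).
- move=> n; apply: le_lt_trans (lebesgue_norm_le_lty (d := d) (n%:R : R)).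
  pose I : set R := `](- n%:R), n%:R]%classic.
  change (lam (@enorm R d @^-1` I) <= lam [set x : E | (enorm x <= n%:R :> R)%R])%E.
  apply: le_measure; rewrite ?inE; [|exact: measurable_norm_le|].
    apply: measurable_preimageT; first exact: mn.
    exact: measurable_itv.
  by move=> x; rewrite /I /preimage /= in_itv/= => /andP[].
Qed.

Lemma polar_integral (g : R -> \bar R) : measurable_fun setT g ->
  (forall t, (0 <= g t)%E) ->
  (\int[lam]_x g (enorm x) =
   \int[mu]_(t in `]0%R, +oo[) (g t * (d%:R * vol * t ^+ d.-1)%:E))%E.
Proof.
move=> mg g0.
have mn : measurable_fun setT (@enorm R d : E -> measurableTypeR R).
  exact: measurable_enorm.
pose nu1 : {measure set (measurableTypeR R) -> \bar R} :=
  measure_function_pushforward__canonical__measure_function_Measure lam mn.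
transitivity (\int[nu1]_t g t)%E.
  by rewrite /nu1 ge0_integral_pushforward.
rewrite (@integral_density _ (measurableTypeR R) R mu nu1 polar_density
  measurable_polar_density polar_density_ge0)//; last first.
  by move=> A mA; exact: polar_measure.
rewrite [RHS]integral_mkcond; apply: eq_integral => t _.
rewrite /patch /polar_density indicE; case: ifPn => t0; first by rewrite mulr1.
by rewrite mulr0 mule0.
Qed.

(** The tube around the sphere is the shell between the radii 1 - e and 1 + e, of
    volume vol * ((1 + e) ^+ d - (1 - e) ^+ d); divided by 2 * e, this tends to
    the derivative d * vol. *)
Lemma sphere_areaE : sphere_area R d = d%:R * vol.
Proof.
have tube_vol (e : R) : 0 < e < 1 ->
    lam (\bigcup_(u in [set u : E | enorm u = 1]) eball e u) =
    (vol * (1 + e) ^+ d - vol * (1 - e) ^+ d)%:E.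
  move=> /andP[e0 e1].
  have -> : \bigcup_(u in [set u : E | enorm u = 1]) eball e u =
      [set x : E | `[1 - e, 1 + e]%classic (enorm x)].
    apply/seteqP; split => x /=.
      move=> [u /= u1 xu]; rewrite in_itv/=.
      have := enorm_triangle (tsub x u) u; have := enorm_triangle (tsub u x) x.
      rewrite /eball /= in xu; rewrite -!edistE (edistC x u) u1.
      have -> : tadd (tsub u x) x = u by apply: eq_from_tnth => i; rewrite !tE; lra.
      have -> : tadd (tsub x u) u = x by apply: eq_from_tnth => i; rewrite !tE; lra.
      rewrite u1 => h1 h2; apply/andP; split; lra.
    rewrite in_itv/= => /andP[h1 h2].
    have x0 : 0 < enorm x by lra.
    exists (tscale (enorm x)^-1 x) => /=.
      by rewrite enormZ gtr0_norm ?invr_gt0// mulVf// lt0r_neq0.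
    rewrite /eball /= edistE (_ : tsub _ _ = tscale ((enorm x)^-1 - 1) x); last first.
      by apply: eq_from_tnth => i; rewrite !tE mulrBl mul1r.
    rewrite enormZ -[X in _ * X](gtr0_norm x0) -normrM mulrBl mulVf ?lt0r_neq0//.
    by rewrite mul1r ler_norml; apply/andP; split; lra.
  rewrite polar_measure; last exact: measurable_itv.
  rewrite -integral_power; [|lra|lra].
  apply: eq_integral => t; rewrite inE /= in_itv/= => /andP[t1 t2].
  by rewrite /polar_density indicE mem_set ?mulr1//= in_itv/= andbT; lra.
have fact (e : R) : 0 < e < 1 ->
    fine (lam (\bigcup_(u in [set u : E | enorm u = 1]) eball e u)) / (2 * e) =
    vol * \sum_(i < d) (1 + e) ^+ (d.-1 - i) * (1 - e) ^+ i.
  move=> e01; rewrite tube_vol// -mulrBr /= subrXX.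
  have -> : 1 + e - (1 - e) = 2 * e by lra.
  have e0 : e != 0 by apply: lt0r_neq0; case/andP: e01.
  by field.
apply: cvg_lim => //.
pose q (e : R) := vol * \sum_(i < d) (1 + e) ^+ (d.-1 - i) * (1 - e) ^+ i.
have q0 : q 0 = d%:R * vol.
  rewrite /q mulrC; congr (_ * _).
  under eq_bigr do rewrite addr0 subr0 !expr1n mulr1.
  by rewrite sumr_const card_ord.
have cq : q e @[e --> 0] --> q 0.
  apply: cvgM; first exact: cvg_cst.
  apply: continuous_sum => i e; apply: cvgM.
    apply: (@continuous_comp _ _ _ (fun e : R => 1 + e) (fun x => x ^+ _)).
      by apply: cvgD; [exact: cvg_cst|exact: cvg_id].
    exact: exprn_continuous.
  apply: (@continuous_comp _ _ _ (fun e : R => 1 - e) (fun x => x ^+ _)).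
    by apply: cvgB; [exact: cvg_cst|exact: cvg_id].
  exact: exprn_continuous.
rewrite -q0; apply: cvg_trans (cvg_at_right_filter cq).
apply: near_eq_cvg; near=> e.
rewrite fact//; apply/andP; split; near: e.
  exact: nbhs_right_gt.
exact: nbhs_right_lt.
Unshelve. all: by end_near. Qed.

End polar.

(** * Norms near a remote point of the first axis *)

Section first_axis.
Context {R : realType} {d : nat}.
Hypothesis d0 : (0 < d)%N.
Local Notation E := (d.-tuple R).

Definition axis : E := [tuple ((i : nat) == 0)%:R | i < d].

Lemma tdot_axis (y : E) : tdot axis y = (y : seq R)`_0.
Proof.
rewrite /tdot (bigD1 (Ordinal d0))//= tnth_mktuple eqxx mul1r (tnth_nth 0)/=.
rewrite big1 ?addr0// => i i0; rewrite tnth_mktuple.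
by rewrite (_ : ((i : nat) == 0) = false) ?mul0r//; apply: contraNF i0 => /eqP i0; apply/eqP/val_inj.
Qed.

Lemma enorm_axis_sqr (k : R) (y : E) :
  enorm (tadd (tscale k axis) y) ^+ 2 = (k + (y : seq R)`_0) ^+ 2 + (enorm y ^+ 2 - ((y : seq R)`_0) ^+ 2).
Proof.
have a1 : tdot axis axis = 1.
  by rewrite tdot_axis -[0%N]/(nat_of_ord (Ordinal d0)) -tnth_nth tnth_mktuple.
rewrite !enorm_sqr !(tdotDl, tdotDr, tdotZl, tdotZr) a1 (tdotC y axis) tdot_axis.
by ring.
Qed.

Lemma enorm_axis (k : R) : 0 <= k -> enorm (tscale k axis) = k.
Proof.
move=> k0; rewrite enormZ ger0_norm// (_ : enorm axis = 1) ?mulr1//.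
have := enorm_axis_sqr 1 origin.
rewrite -[X in X`_0]/(tval origin) -[0%N]/(nat_of_ord (Ordinal d0)) -tnth_nth tE.
rewrite tadd0 enorm0 expr0n subr0 !addr0 expr1n enormZ normr1 mul1r => /eqP.
by rewrite sqrp_eq1 ?enorm_ge0// => /eqP.
Qed.

Lemma first_coord_le (y : E) : ((y : seq R)`_0) ^+ 2 <= enorm y ^+ 2.
Proof.
rewrite -[0%N]/(nat_of_ord (Ordinal d0)) -tnth_nth.
have := tnth_le_enorm y (Ordinal d0).
by rewrite -(@ler_pXn2r _ 2)// ?nnegrE ?enorm_ge0// real_normK ?num_real.
Qed.

(** Write N for the norm and a = t + y_0. Then N ^+ 2 = (r + a) ^+ 2 + s where s is
    the squared norm of the other coordinates of y, so that N - r - a, which equals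
    s / (N + r + a), lies between 0 and s / (r + a) for large r: far away, spheres become
    hyperplanes orthogonal to the axis. *)
Lemma axis_excess_cvg (r : R^nat) (t : R) (y : E) : r n @[n --> \oo] --> +oo ->
  (enorm (tadd (tscale (r n + t) axis) y) - r n) @[n --> \oo] --> t + (y : seq R)`_0.
Proof.
move=> roo; have /cvgryPgt rgt := roo; have /cvgryPge rge := roo.
set y1 := (y : seq R)`_0; pose a := t + y1.
pose N n := enorm (tadd (tscale (r n + t) axis) y).
pose s := enorm y ^+ 2 - y1 ^+ 2.
have s0 : 0 <= s by rewrite subr_ge0 first_coord_le.
have NE n : N n ^+ 2 = (r n + a) ^+ 2 + s by rewrite /N enorm_axis_sqr /a [r n + (t + y1)]addrA.
have N0 n : 0 <= N n by exact: enorm_ge0.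
have bnd : \forall n \near \oo, a <= N n - r n <= a + s / (r n + a).
  near=> n; have ra : 0 < r n + a.
    rewrite -ltrBlDr sub0r; near: n; exact: rgt.
  have raN : r n + a <= N n.
    by rewrite -(@ler_pXn2r _ 2) ?nnegrE ?(ltW ra)// NE lerDl.
  apply/andP; split; first by lra.
  rewrite -lerBlDl ler_pdivlMr//.
  have : (N n - r n - a) * (N n + (r n + a)) = s.
    by have := NE n; rewrite !expr2 => h; lra.
  have : 0 <= (N n - r n - a) * N n by apply: mulr_ge0 => //; lra.
  move=> h1 h2; lra.
apply: (squeeze_cvgr bnd); first exact: cvg_cst.
rewrite -[X in _ --> X]addr0; apply: cvgD; first exact: cvg_cst.
rewrite -[X in _ --> X](mulr0 s); apply: cvgM; first exact: cvg_cst.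
have pos : \forall n \near \oo, 0 < r n + a.
  near=> n; rewrite -ltrBlDr sub0r; near: n; exact: rgt.
apply/(gtr0_cvgV0 pos)/cvgryPge => B; near=> n; rewrite -lerBlDr; near: n; exact: rge.
Unshelve. all: by end_near. Qed.

Lemma cvg_prod_ord m (u : 'I_m -> R^nat) (l : 'I_m -> R) :
  (forall i, u i n @[n --> \oo] --> l i) ->
  (\prod_(i < m) u i n) @[n --> \oo] --> \prod_(i < m) l i.
Proof.
elim: m u l => [|m IH] u l ul.
  by rewrite big_ord0; under eq_fun do rewrite big_ord0; exact: cvg_cst.
rewrite big_ord_recl; under eq_fun do rewrite big_ord_recl.
by apply: cvgM; [exact: ul|apply: IH => i; exact: ul].
Qed.

(** The density at x divided by its value on the sphere of radius rho, and cut to zero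
    inside the ball. It is at most 1, which makes dominated convergence possible. *)
Definition outer_weight (rho : R) (x : E) : R :=
  (rho < enorm x)%R%:R * expR (rho - enorm x).

(** The exponential converges by axis_excess_cvg. The indicator does too, provided
    that the limit t + y_0 of the excess is nonzero. *)
Lemma outer_weight_cvg (r : R^nat) (t : R) (y : E) : r n @[n --> \oo] --> +oo ->
  (y : seq R)`_0 != - t ->
  outer_weight (r n) (tadd (tscale (r n + t) axis) y) @[n --> \oo] -->
  (- t < (y : seq R)`_0)%R%:R * expR (- (t + (y : seq R)`_0)).
Proof.
move=> roo yt; have ex := @axis_excess_cvg r t y roo.
apply: cvgM.
  have [ty|ty] := ltP (- t) (y : seq R)`_0.
    apply: cvg_near_cst; near=> n.
    have : 0 < enorm (tadd (tscale (r n + t) axis) y) - r n.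
      near: n; apply: (cvgr_gt _ ex); lra.
    by rewrite subr_gt0 => ->.
  have {}ty : (y : seq R)`_0 < - t by rewrite lt_neqAle yt.
  apply: cvg_near_cst; near=> n.
  have : enorm (tadd (tscale (r n + t) axis) y) - r n < 0.
    near: n; apply: (cvgr_lt _ ex); lra.
  by rewrite subr_lt0 => h; rewrite ltNge (ltW h).
have -> : (fun n => expR (r n - enorm (tadd (tscale (r n + t) axis) y))) =
   (fun n => expR (- (enorm (tadd (tscale (r n + t) axis) y) - r n))).
  by apply/funext => n; rewrite opprB.
apply: continuous_cvg; first exact: continuous_expR.
exact: cvgN.
Unshelve. all: by end_near. Qed.

Lemma outer_weight_ge0 rho x : 0 <= outer_weight rho x.
Proof. by rewrite /outer_weight mulr_ge0// expR_ge0. Qed.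

Lemma outer_weight_le1 rho x : outer_weight rho x <= 1.
Proof.
rewrite /outer_weight; case: ltP => h; rewrite ?mul0r ?ler01// mul1r.
by rewrite -expR0 ler_expR subr_le0 ltW.
Qed.

Lemma measurable_outer_weight d' (S : measurableType d') (rho : R) (f : S -> E) :
  measurable_fun setT f -> measurable_fun setT (fun s => outer_weight rho (f s)).
Proof.
move=> mf; have mn := measurable_enorm mf.
apply: measurable_funM; last first.
  apply: (measurableT_comp (@measurable_expR R)); exact: measurable_funB.
apply: (measurableT_comp (f := fun b : bool => b%:R : R)) => //.
exact: measurable_fun_ltr.
Qed.

End first_axis.

(** * The mass of clusters far from the origin *)

Lemma integral_expR_div {R : realType} (a : R) : 0 < a ->
  (\int[@lebesgue_measure R]_(t in `[0%R, +oo[) (expR (- (t / a)))%:E = a%:E)%E.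
Proof.
move=> a0; have an0 : a != 0 by exact: lt0r_neq0.
have dF (t : R) : is_derive t 1 (fun t => - a * expR (- (t / a))) (expR (- (t / a))).
  by apply: is_derive_eq; rewrite /GRing.scale /=; field.
have cF : continuous (fun t : R => - a * expR (- (t / a))).
  by move=> t; apply: differentiable_continuous; apply/derivable1_diffP; have [] := dF t.
have cf : continuous (fun t : R => expR (- (t / a))).
  move=> t; apply: continuous_comp; last exact: continuous_expR.
  by apply: cvgN; apply: cvgM; [exact: cvg_id|exact: cvg_cst].
rewrite (@ge0_continuous_FTC2y _ _ (fun t => - a * expR (- (t / a))) 0 0).
- by rewrite mul0r oppr0 expR0 mulr1 sub0e -EFinN opprK.
- by move=> x _; exact: expR_ge0.
- exact: continuous_subspaceT.
- rewrite -[X in _ --> X](mulr0 (- a)); apply: cvgM; first exact: cvg_cst.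
  apply: (@cvg_comp _ _ _ (fun t : R => t / a) (fun t => expR (- t)) _ (+oo)%R);
    last exact: cvgr_expR.
  apply/cvgryPge => B; near=> t; rewrite ler_pdivlMr//; near: t.
- by move=> x _; have [] := dF x.
- exact/cvg_at_right_filter/cF.
- by move=> x _; rewrite derive1E; have [] := dF x.
Unshelve. all: by end_near. Qed.

Lemma ge0_integral_tuple_map d {T : measurableType d} {R : realType}
    (m : {sigma_finite_measure set T -> \bar R}) n (phi : T -> T)
    (f : n.-tuple T -> \bar R) :
  measurable_fun setT phi ->
  (forall A, measurable A -> m (phi @^-1` A) = m A) ->
  measurable_fun [set: n.-tuple T] f -> (forall t, (0 <= f t)%E) ->
  (\int[tuple_measure m n]_t f [tuple phi (tnth t i) | i < n] =
   \int[tuple_measure m n]_t f t)%E.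
Proof.
move=> mphi phim mf f0.
pose H (t : n.-tuple T) := [tuple phi (tnth t i) | i < n].
have mH : measurable_fun setT H by exact: (measurable_tuple_map (phi := fun=> phi)).
apply: (ge0_integral_preserving (phi := H) (nu := tuple_measure m n)) => // B mB.
exact: (tuple_measure_map (phi := fun=> phi)).
Qed.

Section cluster.
Context {R : realType} {d : nat} (m : nat).
Hypothesis d0 : (0 < d)%N.
Local Notation E := (d.-tuple R).
Local Notation lam := (@lebesgue_tuple R d).
Local Notation Lam := (tuple_measure (@lebesgue_tuple R d) m).
Local Notation mu := (@lebesgue_measure R).
Local Notation axis := (@axis R d).
Variable A : set (m.+1.-tuple E).
Hypothesis mA : measurable A.
Hypothesis A_tadd : forall v t, A [tuple tadd v (tnth t i) | i < m.+1] <-> A t.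
Hypothesis A_householder :
  forall u t, A [tuple householder u (tnth t i) | i < m.+1] <-> A t.

(** By translation invariance, the indicator of A on a tuple only depends on the
    positions y of the last m points relative to the first one. *)
Definition pinned (y : m.-tuple E) : R := \1_A [tuple of origin :: y].

Lemma pinned_tadd x y :
  \1_A [tuple of x :: [tuple tadd x (tnth y i) | i < m]] = pinned y.
Proof.
rewrite /pinned !indicE; congr ((nat_of_bool _)%:R).
have -> : [tuple of x :: [tuple tadd x (tnth y i) | i < m]] =
    [tuple tadd x (tnth [tuple of origin :: y] i) | i < m.+1].
  apply: eq_from_tnth => i; rewrite tnth_mktuple.
  case: (unliftP ord0 i) => [j ->|->]; last by rewrite tadd0.
  by rewrite !tnthS tnth_mktuple.
by apply/idP/idP; rewrite !inE => /A_tadd.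
Qed.

Lemma pinned_householder u y :
  pinned [tuple householder u (tnth y i) | i < m] = pinned y.
Proof.
rewrite /pinned !indicE; congr ((nat_of_bool _)%:R).
have -> : [tuple of origin :: [tuple householder u (tnth y i) | i < m]] =
    [tuple householder u (tnth [tuple of origin :: y] i) | i < m.+1].
  apply: eq_from_tnth => i; rewrite tnth_mktuple.
  case: (unliftP ord0 i) => [j ->|->]; last by rewrite householder0.
  by rewrite !tnthS tnth_mktuple.
by apply/idP/idP; rewrite !inE => /A_householder.
Qed.

Lemma pinned_ge0 y : 0 <= pinned y. Proof. by rewrite /pinned indicE. Qed.

Lemma measurable_pinned d' (S : measurableType d') (g : S -> m.-tuple E) :
  measurable_fun setT g -> measurable_fun setT (fun s => pinned (g s)).
Proof.
move=> mg; have mI : measurable_fun setT (\1_A : m.+1.-tuple E -> R).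
  exact: measurable_indic.
apply: (measurableT_comp mI); exact: measurable_cons.
Qed.

Definition outer_pinned (rho : R) (x : E) (y : m.-tuple E) : R :=
  pinned y * \prod_(i < m) outer_weight rho (tadd x (tnth y i)).

Lemma outer_pinned_ge0 rho x y : 0 <= outer_pinned rho x y.
Proof.
by rewrite mulr_ge0 ?pinned_ge0// prodr_ge0// => i _; exact: outer_weight_ge0.
Qed.

Lemma measurable_outer_pinned d' (S : measurableType d') rho (f : S -> E)
    (g : S -> m.-tuple E) : measurable_fun setT f -> measurable_fun setT g ->
  measurable_fun setT (fun s => outer_pinned rho (f s) (g s)).
Proof.
move=> mf mg; apply: measurable_funM; first exact: measurable_pinned.
apply: measurable_prod => i _; apply: measurable_outer_weight.
by apply: measurable_tadd => //; exact: measurable_tnth_comp.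
Qed.

(** Up to constants, the mass of the configurations whose first point is x and whose
    last points are outside of the ball of radius rho. *)
Definition outer_mass rho x : \bar R := (\int[Lam]_y (outer_pinned rho x y)%:E)%E.

Lemma outer_mass_ge0 rho x : (0 <= outer_mass rho x)%E.
Proof. by apply: integral_ge0 => y _; rewrite lee_fin outer_pinned_ge0. Qed.

Lemma measurable_outer_mass d' (S : measurableType d') rho (f : S -> E) :
  measurable_fun setT f -> measurable_fun setT (fun s => outer_mass rho (f s)).
Proof.
move=> mf; have mG : measurable_fun setT (outer_mass rho).
  apply: (measurable_fun_fubini_tonelli_F (m2 := Lam)
    (fun p : E * m.-tuple E => (outer_pinned rho p.1 p.2)%:E)).
  - by apply/measurable_EFinP; exact: measurable_outer_pinned.
  - by move=> p; rewrite lee_fin outer_pinned_ge0.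
exact: (measurableT_comp mG mf).
Qed.

(** The reflection that sends x to the point of the axis with the same norm preserves
    the integrand and Lebesgue measure. *)
Lemma outer_mass_axis rho x :
  outer_mass rho x = outer_mass rho (tscale (enorm x) axis).
Proof.
pose u := tsub x (tscale (enorm x) axis).
have Hx : householder u x = tscale (enorm x) axis.
  by apply: householder_swap; rewrite enorm_axis ?enorm_ge0.
have mf : measurable_fun setT (fun y : m.-tuple E => (outer_pinned rho x y)%:E).
  by apply/measurable_EFinP; exact: measurable_outer_pinned.
have f0 (y : m.-tuple E) : (0 <= (outer_pinned rho x y)%:E)%E.
  by rewrite lee_fin outer_pinned_ge0.
have := ge0_integral_tuple_map (measurable_householder u)
  (fun B mB => lebesgue_householder d0 u mB) mf f0.
rewrite /outer_mass => <-.
apply: eq_integral => y _; congr EFin; rewrite /outer_pinned pinned_householder.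
congr (_ * _); apply: eq_bigr => i _; rewrite tnth_mktuple /outer_weight.
suff -> : enorm (tadd x (householder u (tnth y i))) =
  enorm (tadd (tscale (enorm x) axis) (tnth y i)) by [].
by rewrite -(enorm_householder u) householderD householderK Hx.
Qed.

Variable c : R.
Hypothesis c_gt0 : 0 < c.

(** The probability that m+1 given sample points are outside of the ball of radius rho
    and form a configuration in A. *)
Definition cluster_mass (rho : R) : \bar R :=
  (\int[tuple_measure lam m.+1]_(t in A `&` [set t | forall i, (rho < enorm (tnth t i))%R])
     (\prod_(i < m.+1) f_e c (tnth t i))%:E)%E.

Lemma f_e_outer_weight rho (x : E) :
  (rho < enorm x)%R%:R * f_e c x = c * expR (- rho) * outer_weight rho x.
Proof.
rewrite /f_e /outer_weight [RHS]mulrC -!mulrA; congr (_ * _).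
by rewrite [RHS]mulrC -mulrA -expRD; congr (_ * expR _); lra.
Qed.

Lemma measurable_outer rho n :
  measurable [set t : n.-tuple E | forall i, rho < enorm (tnth t i)].
Proof.
have -> : [set t : n.-tuple E | forall i, rho < enorm (tnth t i)] =
    tbox (fun=> ~` [set x : E | enorm x <= rho]).
  apply/seteqP; split => t tr i; have := tr i; rewrite /= ltNge; first by move/negP.
  by move/negP.
by apply: measurable_tbox => i; apply: measurableC; exact: measurable_norm_le.
Qed.

(** Integrate over the first point x last, and use coordinates relative to x for the
    other points; each point contributes a factor c * expR (- rho). *)
Lemma cluster_massE rho :
  cluster_mass rho = (((c * expR (- rho)) ^+ m.+1)%:E *
    \int[lam]_x ((outer_weight rho x)%:E * outer_mass rho x))%E.
Proof.
have cr0 : 0 <= c * expR (- rho) by rewrite mulr_ge0 ?expR_ge0 ?ltW.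
have mW : measurable_fun setT (fun t : m.+1.-tuple E =>
    \1_A t * \prod_(i < m.+1) (c * expR (- rho) * outer_weight rho (tnth t i)) : R).
  apply: measurable_funM; first exact: measurable_indic.
  apply: measurable_prod => i _; apply: measurable_funM => //.
  by apply: measurable_outer_weight; exact: measurable_tnth_comp.
have W0 (t : m.+1.-tuple E) :
    0 <= \1_A t * \prod_(i < m.+1) (c * expR (- rho) * outer_weight rho (tnth t i)) :> R.
  by rewrite mulr_ge0 ?indicE// prodr_ge0// => i _; rewrite mulr_ge0// outer_weight_ge0.
rewrite /cluster_mass integral_mkcond.
transitivity (\int[tuple_measure lam m.+1]_t (\1_A t *
    \prod_(i < m.+1) (c * expR (- rho) * outer_weight rho (tnth t i)))%:E)%E.
  apply: eq_integral => t _; rewrite /patch; case: ifPn => [|nt].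
    rewrite inE => -[tA tr]; rewrite indicE mem_set// mul1r; congr EFin.
    by apply: eq_bigr => i _; rewrite -f_e_outer_weight tr mul1r.
  rewrite indicE; case: (boolP (t \in A)) => [/set_mem tA|_]; last by rewrite mul0r.
  rewrite mul1r; have [i ri] : exists i, ~~ (rho < enorm (tnth t i)).
    apply: contrapT => /forallNP h; case/negP: nt; rewrite inE; split=> // i.
    by have /negP/negPn := h i.
  by rewrite (bigD1 i)//= -f_e_outer_weight (negbTE ri) !mul0r.
rewrite tuple_fubini_tonelli//; last exact/measurable_EFinP.
rewrite -ge0_integralZl_EFin//; last 3 first.
- by move=> x _; rewrite mule_ge0 ?outer_mass_ge0// lee_fin outer_weight_ge0.
- apply: emeasurable_funM; last exact: measurable_outer_mass.
  by apply/measurable_EFinP; exact: measurable_outer_weight.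
- exact: exprn_ge0.
apply: eq_integral => x _.
pose f (y : m.-tuple E) := (\1_A [tuple of x :: y] * \prod_(i < m.+1)
   (c * expR (- rho) * outer_weight rho (tnth [tuple of x :: y] i)))%:E.
have mf : measurable_fun setT f.
  apply: (measurableT_comp (f := EFin)) => //.
  by apply: (measurableT_comp mW); exact: measurable_cons.
have mx : measurable_fun setT (tadd x : E -> E) by exact: measurable_tadd.
have := ge0_integral_tuple_map mx (fun B mB => lebesgue_translation x mB) mf
  (fun y => W0 [tuple of x :: y]).
rewrite /f => <-.
rewrite muleA -EFinM -ge0_integralZl_EFin//; last 3 first.
- by move=> y _; rewrite lee_fin outer_pinned_ge0.
- by apply/measurable_EFinP; exact: measurable_outer_pinned.
- by rewrite mulr_ge0 ?outer_weight_ge0// exprn_ge0.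
apply: eq_integral => y _; rewrite -EFinM; congr EFin.
rewrite pinned_tadd big_split /= prodr_const card_ord big_ord_recl /outer_pinned.
under eq_bigr do rewrite tnthS tnth_mktuple.
by rewrite tnth0; ring.
Qed.

Lemma ge0_integral_shift (K : R -> \bar R) (rho : R) :
  measurable_fun setT K -> (forall t, (0 <= K t)%E) ->
  (\int[mu]_t K t = \int[mu]_t K (rho + t)%R)%E.
Proof.
move=> mK K0.
apply/esym/(@ge0_integral_preserving R _ (measurableTypeR R) mu (+%R rho) K) => //.
  exact: measurable_funD.
by move=> B mB; exact: lebesgueR_translation.
Qed.

Let area := sphere_area R d.

Lemma area_gt0 : 0 < area.
Proof. by rewrite /area sphere_areaE// mulr_gt0 ?ltr0n// ball_volume_gt0. Qed.

(** By outer_mass_axis the integrand is a function of the norm of x; polar coordinates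
    apply, with the radius written rho + t. *)
Lemma cluster_mass_polar rho : 0 < rho ->
  cluster_mass rho = (((c * expR (- rho)) ^+ m.+1)%:E *
    \int[mu]_(t in `[0%R, +oo[) ((expR (- t) * (area * (rho + t) ^+ d.-1))%:E *
      outer_mass rho (tscale (rho + t)%R axis)))%E.
Proof.
move=> rho0; rewrite cluster_massE; congr (_ * _)%E.
pose g t := (((rho < t)%R%:R * expR (rho - t))%:E * outer_mass rho (tscale t axis))%E.
have mexp (a : R) : measurable_fun setT (fun t : R => expR (a - t)).
  by apply: (measurableT_comp (@measurable_expR R)); exact: measurable_funB.
have maxis (a : R) : measurable_fun setT (fun t : R => tscale (a + t) axis).
  by apply: measurable_tscale => //; exact: measurable_funD.
have mg : measurable_fun setT g.
  apply: emeasurable_funM; last first.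
    by apply: measurable_outer_mass; exact: measurable_tscale.
  apply/measurable_EFinP; apply: measurable_funM => //.
  apply: (measurableT_comp (f := fun b : bool => b%:R : R)) => //.
  exact: measurable_fun_ltr.
have g0 t : (0 <= g t)%E.
  by apply: mule_ge0; [rewrite lee_fin mulr_ge0 ?expR_ge0|exact: outer_mass_ge0].
transitivity (\int[lam]_x g (enorm x))%E.
  by apply: eq_integral => x _; rewrite outer_mass_axis.
rewrite (polar_integral d0 mg g0) -sphere_areaE//= -/area.
(* Extending the integrand by zero turns the shift of radius into a translation
   of the whole line. *)
pose K : R -> \bar R := (fun t => g t * (area * t ^+ d.-1)%:E)%E \_ `]0, +oo[.
rewrite integral_mkcond -/K.
have K0 t : (0 <= K t)%E.
  rewrite /K /patch; case: ifPn => //; rewrite inE /= in_itv/= andbT => t0.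
  by apply: mule_ge0 => //; rewrite lee_fin mulr_ge0 ?exprn_ge0 ?ltW// area_gt0.
have mK : measurable_fun setT K.
  apply/(measurable_restrictT _ _).1; first exact: measurable_itv.
  apply: measurable_funTS; apply: emeasurable_funM => //.
  by apply/measurable_EFinP; apply: measurable_funM => //; exact: measurable_funX.
rewrite (ge0_integral_shift rho mK K0) -[RHS]integral_itv_obnd_cbnd; last first.
  apply: measurable_funTS; apply: emeasurable_funM; last exact: measurable_outer_mass.
  apply/measurable_EFinP; apply: measurable_funM.
    by apply: (measurableT_comp (@measurable_expR R)); exact: measurable_funN.
  apply: measurable_funM => //; apply: measurable_funX.
  exact: measurable_funD.
rewrite [RHS]integral_mkcond; apply: eq_integral => t _.
rewrite /K /patch !mem_setE /= !in_itv/= !andbT /g.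
have [t0|t0] := ltP 0 t.
  rewrite addr_gt0// ltrDl t0 mul1r muleAC -EFinM; congr (_ * _)%E.
  by congr ((expR _ * _)%:E); lra.
by case: ifP => // _; rewrite ltrDl ltNge t0 /= mul0r !mul0e.
Qed.

(** What remains of the mass after division by the expected order of magnitude
    rho ^+ d.-1 * expR (- m.+1 * rho); it has a limit for fixed t and y. *)
Definition scaled_integrand rho t (y : m.-tuple E) : R :=
  expR (- t) * (1 + t / rho) ^+ d.-1 * outer_pinned rho (tscale (rho + t) axis) y.

Lemma scaled_integrand_ge0 rho t y : 0 < rho -> 0 <= t -> 0 <= scaled_integrand rho t y.
Proof.
move=> r0 t0; rewrite mulr_ge0 ?outer_pinned_ge0// mulr_ge0 ?expR_ge0// exprn_ge0//.
by rewrite addr_ge0// divr_ge0// ltW.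
Qed.

Lemma integral_scaled rho t : 0 < rho -> 0 <= t ->
  (\int[Lam]_y (scaled_integrand rho t y)%:E =
   (expR (- t) * (1 + t / rho) ^+ d.-1)%:E * outer_mass rho (tscale (rho + t)%R axis))%E.
Proof.
move=> r0 t0; rewrite -ge0_integralZl_EFin//.
- by move=> y _; rewrite lee_fin outer_pinned_ge0.
- by apply/measurable_EFinP; exact: measurable_outer_pinned.
- by rewrite mulr_ge0 ?expR_ge0// exprn_ge0// addr_ge0// divr_ge0// ltW.
Qed.

Lemma measurable_integral_scaled rho : 0 < rho ->
  measurable_fun (`[0%R, +oo[%classic : set R)
    (fun t => \int[Lam]_y (scaled_integrand rho t y)%:E)%E.
Proof.
move=> r0; have maxis : measurable_fun setT (fun t : R => tscale (rho + t) axis).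
  by apply: measurable_tscale => //; exact: measurable_funD.
have mf : measurable_fun (`[0%R, +oo[%classic : set R)
    (fun t : R => (expR (- t) * (1 + t / rho) ^+ d.-1)%:E *
    outer_mass rho (tscale (rho + t)%R axis))%E.
  apply: measurable_funTS; apply: emeasurable_funM; last exact: measurable_outer_mass.
  apply/measurable_EFinP; apply: measurable_funM.
    by apply: (measurableT_comp (@measurable_expR R)); exact: measurable_funN.
  apply: measurable_funX; apply: measurable_funD => //.
  exact: measurable_funM.
apply: eq_measurable_fun mf.
by move=> t; rewrite inE/= in_itv/= andbT => t0; rewrite integral_scaled.
Qed.

Lemma cluster_mass_scaled rho : 0 < rho ->
  (((rho ^+ d.-1 * expR (- (m.+1%:R * rho)))^-1)%:E * cluster_mass rho =
   (area * c ^+ m.+1)%:E *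
   \int[mu]_(t in `[0%R, +oo[) \int[Lam]_y (scaled_integrand rho t y)%:E)%E.
Proof.
move=> r0; have rn0 := lt0r_neq0 r0.
rewrite cluster_mass_polar// muleA -EFinM.
have maxis : measurable_fun setT (fun t : R => tscale (rho + t) axis).
  by apply: measurable_tscale => //; exact: measurable_funD.
transitivity ((((rho ^+ d.-1 * expR (- (m.+1%:R * rho)))^-1 * (c * expR (- rho)) ^+ m.+1)%:E *
  \int[mu]_(t in `[0%R, +oo[) ((area * rho ^+ d.-1)%:E *
    \int[Lam]_y (scaled_integrand rho t y)%:E))%E).
  congr (_ * _)%E; apply: eq_integral => t; rewrite inE/= in_itv/= andbT => t0.
  rewrite integral_scaled// muleA -EFinM; congr ((_)%:E * _)%E.
  have -> : rho + t = rho * (1 + t / rho) by field.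
  by rewrite exprMn; ring.
rewrite ge0_integralZl_EFin//.
- rewrite muleA -EFinM; congr ((_)%:E * _)%E.
  have -> : (c * expR (- rho)) ^+ m.+1 = c ^+ m.+1 * expR (- (m.+1%:R * rho)).
    by rewrite exprMn -expRM_natl mulrN.
  have e0 : expR (- (m.+1%:R * rho)) != 0 by rewrite lt0r_neq0// expR_gt0.
  have rd0 : rho ^+ d.-1 != 0 by rewrite expf_neq0.
  by field; rewrite e0 rd0.
- move=> t; rewrite /= in_itv/= andbT => t0.
  by apply: integral_ge0 => y _; rewrite lee_fin scaled_integrand_ge0.
- exact: measurable_integral_scaled.
- by rewrite mulr_ge0 ?exprn_ge0 ?ltW// area_gt0.
Qed.

Variable D : R.
Hypothesis A_bounded : forall t, A t -> forall i, edist (tnth t ord0) (tnth t i) <= D.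

Let ballD := [set x : E | enorm x <= D].

Definition box_volume : R := fine (lam ballD) ^+ m.

Lemma box_volumeE : Lam (tbox (fun=> ballD)) = box_volume%:E.
Proof.
rewrite [LHS]tuple_measure_box; last by move=> _; exact: measurable_norm_le.
rewrite /box_volume -[X in _ ^+ X]card_ord -prodr_const -prodEFin.
by apply: eq_bigr => i _; rewrite fineK// ge0_fin_numE// lebesgue_norm_le_lty.
Qed.

Lemma measurable_box : measurable (tbox (fun=> ballD) : set (m.-tuple E)).
Proof. by apply: measurable_tbox => _; exact: measurable_norm_le. Qed.

(** Configurations in A are bounded, so the relative positions range over a set of
    finite measure. *)
Lemma pinned_le_box y : pinned y <= \1_(tbox (fun=> ballD)) y.
Proof.
rewrite /pinned !indicE; case: (boolP (_ \in A)) => [/set_mem yA|_]; last exact: ler0n.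
rewrite mem_set// => i; have := A_bounded yA (lift ord0 i).
by rewrite tnthS /ballD /= -edist0.
Qed.

Lemma outer_pinned_le_box rho x y : outer_pinned rho x y <= \1_(tbox (fun=> ballD)) y.
Proof.
apply: le_trans (pinned_le_box y); rewrite /outer_pinned ler_piMr ?pinned_ge0//.
by apply: prodr_ile1 => i _; rewrite outer_weight_ge0 outer_weight_le1.
Qed.

(** As a point is at distance rho + t + y_0 + o(1) from the origin, the condition of
    being outside of the ball becomes - t < y_0. *)
Definition limit_integrand t (y : m.-tuple E) : R :=
  pinned y * expR (- (m.+1%:R * t + \sum_(i < m) (tnth y i)`_0)) *
    \prod_(i < m) (- t < (tnth y i)`_0)%R%:R.

Lemma scaled_integrand_cvg (r : R^nat) t (y : m.-tuple E) : r n @[n --> \oo] --> +oo ->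
  (forall i, (tnth y i : seq R)`_0 != - t) ->
  scaled_integrand (r n) t y @[n --> \oo] --> limit_integrand t y.
Proof.
move=> roo yt.
have -> : limit_integrand t y = expR (- t) * 1 ^+ d.-1 * (pinned y *
    \prod_(i < m) ((- t < (tnth y i)`_0)%R%:R * expR (- (t + (tnth y i)`_0)))).
  rewrite /limit_integrand expr1n mulr1 big_split /= -expR_sum.
  have -> : - (m.+1%:R * t + \sum_(i < m) (tnth y i)`_0) =
      - t + \sum_(i < m) - (t + (tnth y i)`_0).
    rewrite sumrN big_split /= sumr_const card_ord -[t *+ m]mulr_natl -natr1; lra.
  rewrite expRD; ring.
apply: cvgM.
  apply: cvgM; first exact: cvg_cst.
  apply: (@continuous_cvg _ _ _ _ _ _ (fun x : R => x ^+ d.-1)).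
    exact: exprn_continuous.
  rewrite -[X in _ --> X]addr0; apply: cvgD; first exact: cvg_cst.
  rewrite -[X in _ --> X](mulr0 t); apply: cvgM; first exact: cvg_cst.
  have pos : \forall n \near \oo, 0 < r n by have /cvgryPgt := roo; exact.
  exact/(gtr0_cvgV0 pos).
apply: cvgM; first exact: cvg_cst.
by apply: cvg_prod_ord => i; exact: outer_weight_cvg.
Qed.

(** The indicators converge except on the hyperplanes of equation y_0 = - t, which are
    boxes with one side of measure zero. *)
Lemma ae_first_coord t : {ae Lam, forall y : m.-tuple E, forall i, (tnth y i : seq R)`_0 != - t}.
Proof.
apply: filter_forall => i.
have mB : measurable [set x : E | (x : seq R)`_0 = - t].
  have -> : [set x : E | (x : seq R)`_0 = - t] = (@tnth d R)^~ (Ordinal d0) @^-1` [set (- t)].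
    by apply/seteqP; split => x /=; rewrite (tnth_nth 0).
  by apply: measurable_preimageT; [exact: measurable_tnth|exact: measurable_set1].
exists [set y | [set x : E | (x : seq R)`_0 = - t] (tnth y i)]; split.
- exact: (measurable_preimageT (measurable_tnth i) mB).
- have -> : [set y : m.-tuple E | [set x : E | (x : seq R)`_0 = - t] (tnth y i)] =
      tbox (fun j => if j == i then [set x : E | (x : seq R)`_0 = - t] else setT).
    apply/seteqP; split => y /=; last by move=> /(_ i); rewrite eqxx.
    by move=> yi j; case: eqP => // ->.
  rewrite [LHS]tuple_measure_box; last by move=> j; case: ifP.
  rewrite (bigD1 i)//= eqxx.
  have -> : [set x : E | (x : seq R)`_0 = - t] =
      tbox (fun j => if j == Ordinal d0 then [set (- t)] else setT).
    apply/seteqP; split => x /=.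
      by move=> xt j; case: eqP => // ->; rewrite (tnth_nth 0).
    by move=> /(_ (Ordinal d0)); rewrite eqxx (tnth_nth 0).
  rewrite [X in (X * _)%E]lebesgue_tuple_box; last first.
    by move=> j; case: ifP => // _; exact: measurable_set1.
  by rewrite (bigD1 (Ordinal d0))//= ?eqxx lebesgue_measure_set1 !mul0e.
- by move=> y /=; case: eqP.
Qed.

Lemma measurable_first_coord d' (S : measurableType d') (g : S -> m.-tuple E) i :
  measurable_fun setT g -> measurable_fun setT (fun s => (tnth (g s) i : seq R)`_0).
Proof.
move=> mg; have -> : (fun s => (tnth (g s) i : seq R)`_0) =
    (fun s => tnth (tnth (g s) i) (Ordinal d0)).
  by apply/funext => s; rewrite [RHS](tnth_nth 0).
by apply: measurable_tnth_comp; exact: measurable_tnth_comp.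
Qed.

Lemma measurable_limit_integrand d' (S : measurableType d') (f : S -> R) (g : S -> m.-tuple E) :
  measurable_fun setT f -> measurable_fun setT g ->
  measurable_fun setT (fun s => limit_integrand (f s) (g s)).
Proof.
move=> mf mg; apply: measurable_funM; last first.
  apply: measurable_prod => i _.
  apply: (measurableT_comp (f := fun b : bool => b%:R : R)) => //.
  by apply: measurable_fun_ltr; [exact: measurable_funN|exact: measurable_first_coord].
apply: measurable_funM; first exact: measurable_pinned.
apply: (measurableT_comp (@measurable_expR R)); apply: measurable_funN.
apply: measurable_funD; first exact: measurable_funM.
by apply: measurable_sum => i; exact: measurable_first_coord.
Qed.

Lemma limit_integrand_ge0 t y : 0 <= limit_integrand t y.
Proof.
rewrite mulr_ge0 ?prodr_ge0// mulr_ge0 ?pinned_ge0// expR_ge0//.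
Qed.

Lemma measurable_scaled_integrand rho t :
  measurable_fun setT (scaled_integrand rho t).
Proof. by apply: measurable_funM => //; exact: measurable_outer_pinned. Qed.

Section limit.
Variable r : R^nat.
Hypothesis r_ge1 : forall n, 1 <= r n.
Hypothesis roo : r n @[n --> \oo] --> +oo.

(* As r n >= 1, this dominates the radial factor of scaled_integrand for all n. *)
Let envelope (t : R) := expR (- t) * (1 + t) ^+ d.-1.

Lemma scaled_le_envelope n t y : 0 <= t ->
  scaled_integrand (r n) t y <= envelope t * \1_(tbox (fun=> ballD)) y.
Proof.
move=> t0; have rn := r_ge1 n; have rn0 : 0 < r n by lra.
have q0 : 0 <= 1 + t / r n by rewrite addr_ge0// divr_ge0// ltW.
apply: ler_pM; rewrite ?outer_pinned_ge0 ?outer_pinned_le_box//.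
  by rewrite mulr_ge0 ?expR_ge0// exprn_ge0.
rewrite ler_wpM2l ?expR_ge0// lerXn2r ?nnegrE//; first by rewrite addr_ge0.
by rewrite lerD2l ler_piMr// invf_le1.
Qed.

Lemma envelope_ge0 t : 0 <= t -> 0 <= envelope t.
Proof. by move=> t0; rewrite mulr_ge0 ?expR_ge0// exprn_ge0// addr_ge0. Qed.

Lemma inner_limit t : 0 <= t ->
  (\int[Lam]_y (scaled_integrand (r n) t y)%:E)%E @[n --> \oo] -->
  (\int[Lam]_y (limit_integrand t y)%:E)%E.
Proof.
move=> t0; pose g (y : m.-tuple E) := (envelope t * \1_(tbox (fun=> ballD)) y)%:E.
have mg : measurable_fun setT g.
  apply/measurable_EFinP; apply: measurable_funM => //.
  apply: measurable_indic; exact: measurable_box.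
have [||||| _ _ //] := @dominated_convergence _ _ _ Lam setT measurableT
  (fun n y => (scaled_integrand (r n) t y)%:E)
  (fun y => (limit_integrand t y)%:E) g.
- by move=> n; apply/measurable_EFinP; exact: measurable_scaled_integrand.
- by apply/measurable_EFinP; exact: measurable_limit_integrand.
- apply: filterS (ae_first_coord t) => y yt _.
  by apply: cvg_EFin; [exact: nearW|exact: scaled_integrand_cvg].
- apply/integrableP; split => //.
  rewrite (eq_integral (fun y => (envelope t)%:E * (\1_(tbox (fun=> ballD)) y)%:E)%E); last first.
    move=> y _; rewrite /g gee0_abs ?EFinM// lee_fin.
    by rewrite mulr_ge0 ?envelope_ge0// indicE.
  rewrite ge0_integralZl_EFin ?envelope_ge0//; last first.
    by apply/measurable_EFinP; apply: measurable_indic; exact: measurable_box.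
  rewrite integral_indic//; last exact: measurable_box.
  by rewrite setIT [X in (_ * X)%E]box_volumeE -EFinM ltry.
- apply: aeW => y n _; rewrite /= lee_fin ger0_norm ?scaled_le_envelope//.
  by rewrite scaled_integrand_ge0// (lt_le_trans ltr01).
Qed.

(** A power is dominated by an exponential: 1 + t <= 2 d (1 + t / (2 d)), and the d-th
    power of 1 + t / (2 d) is at most expR (t / 2). *)
Lemma envelope_le t : 0 <= t ->
  envelope t <= (2 * d%:R) ^+ d.-1 * expR (- (t / 2)).
Proof.
move=> t0; have dR : 1 <= d%:R :> R by rewrite ler1n.
have dR0 : 0 < d%:R :> R by lra.
have q1 : 1 <= 1 + t / (2 * d%:R) by rewrite lerDl divr_ge0//; lra.
have h1 : 1 + t <= 2 * d%:R * (1 + t / (2 * d%:R)).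
  have -> : 2 * d%:R * (1 + t / (2 * d%:R)) = 2 * d%:R + t by field; exact: lt0r_neq0.
  lra.
have h2 : (1 + t / (2 * d%:R)) ^+ d.-1 <= expR (t / 2).
  apply: (@le_trans _ _ ((1 + t / (2 * d%:R)) ^+ d)).
    by apply: ler_weXn2l => //; exact: leq_pred.
  apply: (@le_trans _ _ (expR (t / (2 * d%:R)) ^+ d)).
    apply: lerXn2r; rewrite ?nnegrE ?expR_ge0//; first by lra.
    exact: expR_ge1Dx.
  rewrite -expRM_natl ler_expR le_eqVlt; apply/orP; left; apply/eqP.
  by field; exact: lt0r_neq0.
rewrite /envelope.
have -> : expR (- (t / 2)) = expR (- t) * expR (t / 2) by rewrite -expRD; congr expR; lra.
rewrite mulrCA ler_wpM2l ?expR_ge0//.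
apply: (@le_trans _ _ ((2 * d%:R * (1 + t / (2 * d%:R))) ^+ d.-1)).
  by apply: lerXn2r; rewrite ?nnegrE//; lra.
by rewrite exprMn ler_wpM2l// exprn_ge0//; lra.
Qed.

Lemma integrable_envelope (k : R) : 0 <= k ->
  mu.-integrable `[0%R, +oo[ (fun t => (envelope t * k)%:E).
Proof.
move=> k0.
have mE : measurable_fun (`[0%R, +oo[%classic : set R) (fun t => (envelope t * k)%:E).
  apply/measurable_EFinP; apply: measurable_funTS; apply: measurable_funM => //.
  apply: measurable_funM.
    by apply: (measurableT_comp (@measurable_expR R)); exact: measurable_funN.
  by apply: measurable_funX; exact: measurable_funD.
have mexp : measurable_fun (`[0%R, +oo[%classic : set R) (fun t : R => (expR (- (t / 2)))%:E).
  apply/measurable_EFinP; apply: measurable_funTS.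
  apply: (measurableT_comp (@measurable_expR R)); apply: measurable_funN.
  exact: measurable_funM.
apply/integrableP; split; first exact: mE.
pose C := (2 * d%:R) ^+ d.-1 * k.
have C0 : 0 <= C by rewrite mulr_ge0// exprn_ge0// mulr_ge0.
apply: (@le_lt_trans _ _ (\int[mu]_(t in `[0%R, +oo[) (C%:E * (expR (- (t / 2)))%:E))%E).
  apply: ge0_le_integral => //.
  - apply: measurableT_comp => //; exact: mE.
  - exact: measurable_funeM.
  - move=> t; rewrite /= in_itv/= andbT => t0.
    rewrite -EFinM lee_fin (ger0_norm (mulr_ge0 (envelope_ge0 t0) k0)).
    have -> : C * expR (- (t / 2)) = (2 * d%:R) ^+ d.-1 * expR (- (t / 2)) * k by rewrite /C mulrAC.
    by rewrite ler_wpM2r// envelope_le.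
rewrite ge0_integralZl_EFin//.
by rewrite integral_expR_div// -EFinM ltry.
Qed.

Definition cluster_limit : \bar R :=
  (\int[mu]_(t in `[0%R, +oo[) \int[Lam]_y (limit_integrand t y)%:E)%E.

Lemma box_volume_ge0 : 0 <= box_volume.
Proof. by rewrite exprn_ge0// fine_ge0. Qed.

Lemma integral_scaled_le n t : 0 <= t ->
  (\int[Lam]_y (scaled_integrand (r n) t y)%:E <= (envelope t * box_volume)%:E)%E.
Proof.
move=> t0; have rn0 : 0 < r n by apply: lt_le_trans (r_ge1 n).
apply: (@le_trans _ _ (\int[Lam]_y ((envelope t)%:E * (\1_(tbox (fun=> ballD)) y)%:E))%E).
  apply: ge0_le_integral => //.
  - by move=> y _; rewrite lee_fin scaled_integrand_ge0.
  - by apply/measurable_EFinP; exact: measurable_scaled_integrand.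
  - apply: measurable_funeM; apply/measurable_EFinP; apply: measurable_indic.
    exact: measurable_box.
  - by move=> y _; rewrite -EFinM lee_fin scaled_le_envelope.
rewrite ge0_integralZl_EFin ?envelope_ge0//; last first.
  by apply/measurable_EFinP; apply: measurable_indic; exact: measurable_box.
rewrite integral_indic//; last exact: measurable_box.
by rewrite setIT [X in (_ * X)%E]box_volumeE.
Qed.

(** Dominated convergence in y for fixed t is inner_limit; it is applied again in t,
    with the envelope times the volume of the box as the bound. *)
Lemma outer_limit : cluster_limit \is a fin_num /\
  (\int[mu]_(t in `[0%R, +oo[) \int[Lam]_y (scaled_integrand (r n) t y)%:E)%E @[n --> \oo]
    --> cluster_limit.
Proof.
have r0 n : 0 < r n by apply: lt_le_trans (r_ge1 n).
have mlim : measurable_fun setT (fun t : R => \int[Lam]_y (limit_integrand t y)%:E)%E.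
  apply: (measurable_fun_fubini_tonelli_F (m2 := Lam)
    (fun p : R * m.-tuple E => (limit_integrand p.1 p.2)%:E)).
  - by apply/measurable_EFinP; exact: measurable_limit_integrand.
  - by move=> p; rewrite lee_fin limit_integrand_ge0.
have [||||| int _ cv] := @dominated_convergence _ (measurableTypeR R) R mu
  `[0%R, +oo[%classic (measurable_itv _)
  (fun n t => \int[Lam]_y (scaled_integrand (r n) t y)%:E)%E
  (fun t => \int[Lam]_y (limit_integrand t y)%:E)%E
  (fun t => (envelope t * box_volume)%:E).
- by move=> n; exact: measurable_integral_scaled.
- exact: measurable_funTS.
- by apply: aeW => t; rewrite /= in_itv/= andbT => t0; exact: inner_limit.
- by apply: integrable_envelope; exact: box_volume_ge0.
- apply: aeW => t n; rewrite /= in_itv/= andbT => t0.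
  rewrite gee0_abs; last by apply: integral_ge0 => y _; rewrite lee_fin scaled_integrand_ge0.
  exact: integral_scaled_le.
- by split; [exact: integrable_fin_num|exact: cv].
Qed.

Lemma cluster_mass_cvg :
  (((r n ^+ d.-1 * expR (- (m.+1%:R * r n)))^-1)%:E * cluster_mass (r n))%E @[n --> \oo]
    --> ((area * c ^+ m.+1)%:E * cluster_limit)%E.
Proof.
have [lf cv] := outer_limit.
have r0 n : 0 < r n by apply: lt_le_trans (r_ge1 n).
under eq_fun do rewrite cluster_mass_scaled//.
by apply: cvgeZl.
Qed.

End limit.

End cluster.

(** The limit only depends on large n, so r can be replaced by its maximum with 1. *)
Lemma cluster_mass_cvg_pinfty {R : realType} {d m : nat} (d0 : (0 < d)%N)
    (A : set (m.+1.-tuple (d.-tuple R))) (c D : R) (r : R^nat) :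
  measurable A ->
  (forall v t, A [tuple tadd v (tnth t i) | i < m.+1] <-> A t) ->
  (forall u t, A [tuple householder u (tnth t i) | i < m.+1] <-> A t) ->
  (forall t, A t -> forall i, edist (tnth t ord0) (tnth t i) <= D) ->
  0 < c -> r n @[n --> \oo] --> +oo ->
  cluster_limit A \is a fin_num /\
  (((r n ^+ d.-1 * expR (- (m.+1%:R * r n)))^-1)%:E * cluster_mass A c (r n))%E @[n --> \oo]
    --> ((sphere_area R d * c ^+ m.+1)%:E * cluster_limit A)%E.
Proof.
move=> mA At Ah Ab c0 roo.
pose r' n := Num.max 1 (r n).
have r'1 n : 1 <= r' n by rewrite le_max lexx.
have r'r : \forall n \near \oo, r' n = r n.
  near=> n; apply: max_r; near: n.
  by move/cvgryPge : roo; exact.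
have r'oo : r' n @[n --> \oo] --> +oo.
  apply: cvg_trans roo; apply: near_eq_cvg.
  by apply: filterS r'r => n ->.
split; first exact: (outer_limit d0 mA Ab r'1 r'oo).1.
apply: cvg_trans (cluster_mass_cvg d0 mA At Ah c0 Ab r'1 r'oo).
by apply: near_eq_cvg; apply: filterS r'r => n ->.
Unshelve. all: by end_near. Qed.

(** * Configurations defined by the Cech condition *)

Section measurable_cech.
Context {R : realType} {d : nat}.
Local Notation E := (d.-tuple R).

Lemma rational_approx (z : E) (e : R) : 0 < e ->
  exists q : d.-tuple rat, edist z [tuple ratr (tnth q i) | i < d] <= e.
Proof.
move=> e0; have /fin_all_exists[q hq] (i : 'I_d) :
    exists q : rat, `|tnth z i - ratr q| <= e / d%:R.
  have h0 : 0 < e / d%:R by rewrite divr_gt0// ltr0n (leq_ltn_trans _ (ltn_ord i)).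
  have [|q] := @rat_in_itvoo R (tnth z i) (tnth z i + e / d%:R); first by lra.
  rewrite in_itv/= => /andP[q1 q2]; exists q; rewrite ler_norml; apply/andP; split; lra.
exists [tuple q i | i < d]; rewrite edistE; apply: enorm_le_coord; first exact: ltW.
by move=> i; rewrite tE !tnth_mktuple.
Qed.

(** The infimum over z of the largest distance is attained, by compactness; it is at
    most 1 as soon as rational centres do better than 1 + 1 / k for all k. This
    replaces a union over all centres by countable operations. *)
Lemma cechx_approx n (t : n.-tuple E) (I : {set 'I_n}) :
  cechx (tnth t) I <-> forall k : nat, exists q : d.-tuple rat, forall i, i \in I ->
    edist (tnth t i) [tuple ratr (tnth q j) | j < d] <= 1 + k.+1%:R^-1.
Proof.
split=> [[z Iz] k|app].
  have [q zq] := @rational_approx z k.+1%:R^-1 ltac:(by rewrite invr_gt0 ltr0n).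
  exists q => i iI; apply: le_trans (edist_triangle z _ _) _.
  by rewrite lerD// Iz.
have [I0|/finset.set0Pn[i0 i0I]] := eqVneq I finset.set0.
  by exists origin => i; rewrite I0 finset.inE.
(* Compactness is that of row vectors, into which tuples are transported. *)
pose tup (v : 'rV[R]_d) : E := [tuple v ord0 j | j < d].
(* The total excess over distance 1 is continuous, and zero exactly on the common
   points of the balls. *)
pose f (v : 'rV[R]_d) : R := \sum_(i in I) Num.max 0 (edist (tnth t i) (tup v) - 1).
have cd i : continuous (fun v => edist (tnth t i) (tup v)).
  move=> v; rewrite /edist.
  have -> : (fun v => Defs.edist (tnth t i) (tup v)) =
      (fun v => Num.sqrt (\sum_(j < d) (tnth (tnth t i) j - v ord0 j) ^+ 2)).
    apply/funext => w; congr Num.sqrt; apply: eq_bigr => j _.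
    by rewrite !tnth_mktuple.
  apply: (@continuous_comp _ _ _ (fun v : 'rV[R]_d =>
    \sum_(j < d) (tnth (tnth t i) j - v ord0 j) ^+ 2) Num.sqrt); last exact: sqrt_continuous.
  apply: (@continuous_sum 'rV[R]_d R) => j w.
  apply: (@continuous_comp _ _ _ (fun w : 'rV[R]_d => tnth (tnth t i) j - w ord0 j)
    (fun x => x ^+ 2)); last exact: exprn_continuous.
  apply: (@continuousB R R 'rV[R]_d (fun=> tnth (tnth t i) j) (fun w => w ord0 j)).
    exact: cst_continuous.
  exact: coord_continuous.
have cf : continuous f.
  apply: (@continuous_sum 'rV[R]_d R) => i v.
  apply: (@continuous_max R 'rV[R]_d (fun=> 0) (fun v => edist (tnth t i) (tup v) - 1)).
    exact: cst_continuous.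
  apply: (@continuousB R R 'rV[R]_d (fun v => edist (tnth t i) (tup v)) (fun=> 1)).
    exact: cd.
  exact: cst_continuous.
pose K : set 'rV[R]_d := [set v | forall j,
  `[tnth (tnth t i0) j - 2, tnth (tnth t i0) j + 2]%classic (v ord0 j)].
have cK : compact K.
  apply: (rV_compact (A := fun j => `[tnth (tnth t i0) j - 2, tnth (tnth t i0) j + 2]%classic)) => j.
  exact: segment_compact.
pose vq (q : d.-tuple rat) : 'rV[R]_d := \row_j ratr (tnth q j).
have tupq q : tup (vq q) = [tuple ratr (tnth q j) | j < d].
  by apply: eq_from_tnth => j; rewrite !tnth_mktuple mxE.
have Kq q : edist (tnth t i0) (tup (vq q)) <= 2 -> K (vq q).
  move=> q2 j /=; rewrite in_itv/=.
  have := le_trans (tnth_le_enorm (tsub (tnth t i0) (tup (vq q))) j) q2.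
  rewrite tE tnth_mktuple ler_norml => /andP[h1 h2].
  by apply/andP; split; lra.
have K0 : K !=set0.
  have [q hq] := app 0%N; exists (vq q); apply: Kq; rewrite tupq.
  by have := hq _ i0I; rewrite invr1.
have [v /set_mem Kv fmin] := EVT_min_rV K0 cK (continuous_subspaceT cf).
have f0 : f v <= 0.
  apply/ler_addgt0Pr => e e0; rewrite add0r.
  pose k := Num.truncn (#|I|%:R / e).
  have [q hq] := app k.
  have k1 : k.+1%:R^-1 <= 1 :> R by rewrite invf_le1 ?ler1n ?ltr0n.
  apply: (@le_trans _ _ (f (vq q))).
    apply: fmin; apply/mem_set/Kq; rewrite tupq.
    by apply: le_trans (hq _ i0I) _; rewrite -[leRHS]/(1 + 1) lerD2l.
  apply: (@le_trans _ _ (\sum_(i in I) k.+1%:R^-1)).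
    apply: ler_sum => i iI; rewrite ge_max invr_ge0 ler0n/= lerBlDl tupq.
    exact: hq.
  rewrite sumr_const -[_ *+ #|I|]mulr_natl ler_pdivrMr ?ltr0n// mulrC -ler_pdivrMr//.
  by apply/ltW; exact: truncnS_gt.
exists (tup v) => i iI; rewrite -subr_le0.
apply: le_trans f0; rewrite /f (bigD1 i)//=.
apply: (@le_trans _ _ (Num.max 0 (edist (tnth t i) (tup v) - 1))).
  by rewrite le_max lexx orbT.
by rewrite lerDl sumr_ge0// => j _; rewrite le_max lexx.
Qed.

Lemma measurable_cechx n (I : {set 'I_n}) :
  measurable [set t : n.-tuple E | cechx (tnth t) I].
Proof.
have -> : [set t : n.-tuple E | cechx (tnth t) I] =
    \bigcap_k \bigcup_(q : d.-tuple rat) [set t : n.-tuple E | forall i,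
      (fun x : E => i \in I -> edist x [tuple ratr (tnth q j) | j < d] <= 1 + k.+1%:R^-1) (tnth t i)].
  apply/seteqP; split => t /=.
    by move=> /cechx_approx h k _; have [q hq] := h k; exists q.
  by move=> h; apply/cechx_approx => k; have [q _ hq] := h k Logic.I; exists q.
apply: bigcap_measurable => [|k _]; first by exists 0%N.
apply: countable_bigcupT_measurable => [|q]; first exact: countableP.
apply: (@measurable_tbox _ E n (fun i x => i \in I -> edist x [tuple ratr (tnth q j) | j < d] <= 1 + k.+1%:R^-1)) => i.
case: (i \in I); last first.
  by rewrite (_ : (fun _ => _) = setT)//; apply/seteqP; split.
rewrite (_ : (fun _ => _) = (fun x : E => edist x [tuple ratr (tnth q j) | j < d]) @^-1`
    `]-oo, (1 + k.+1%:R^-1)]%classic); last first.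
  apply/seteqP; split => x /=; rewrite in_itv/=; first by move=> /(_ isT).
  by [].
by apply: measurable_preimageT => //; exact: measurable_edist.
Qed.

End measurable_cech.

Definition hollow_tuples {R : realType} {d : nat} (k : nat) : set (k.+3.-tuple (d.-tuple R)) :=
  [set t | hollowx (tnth t) finset.setT].
Arguments hollow_tuples {R d} k t.

(** The bound 6 matches clusterx. *)
Definition close_tuples {R : realType} {d : nat} (m : nat) : set (m.-tuple (d.-tuple R)) :=
  [set t | forall i j, edist (tnth t i) (tnth t j) <= 6].
Arguments close_tuples {R d} m t.

Section cluster_sets.
Context {R : realType} {d : nat}.
Local Notation E := (d.-tuple R).

Lemma cechx_isometry (J : finType) (x : J -> E) (phi psi : E -> E) (I : {set J}) :
  (forall a b, edist (phi a) (phi b) = edist a b) -> cancel psi phi ->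
  cechx (fun i => phi (x i)) I <-> cechx x I.
Proof.
move=> iso psiK; split=> -[z Iz].
  by exists (psi z) => i iI; rewrite -iso psiK; exact: Iz.
by exists (phi z) => i iI; rewrite iso; exact: Iz.
Qed.

Lemma hollowx_isometry (J : finType) (x : J -> E) (phi psi : E -> E) (I : {set J}) :
  (forall a b, edist (phi a) (phi b) = edist a b) -> cancel psi phi ->
  hollowx (fun i => phi (x i)) I = hollowx x I.
Proof.
move=> iso psiK; have h K := cechx_isometry x K iso psiK.
apply/asboolP/asboolP => -[nI fI]; split.
- by move=> /h.
- by move=> i /fI /h.
- by move=> /h.
- by move=> i /fI /h.
Qed.

Lemma hollowx_imset (J J' : finType) (x : J -> E) (g : J' -> J) : injective g ->
  hollowx (x \o g) finset.setT = hollowx x (g @: finset.setT)%SET.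
Proof.
move=> ginj.
have h (K : {set J'}) : cechx (x \o g) K <-> cechx x (g @: K)%SET.
  split=> -[z Kz]; exists z; first by move=> _ /imsetP[i iK ->]; exact: Kz.
  by move=> i iK; apply: Kz; exact: imset_f.
have gD i : (g @: (finset.setT :\ i) = g @: finset.setT :\ g i)%SET.
  apply/setP => j; rewrite !finset.inE; apply/imsetP/andP => [[a]|[ji /imsetP[a _ ja]]].
    by rewrite !finset.inE andbT => ai ->; rewrite (inj_eq ginj) ai imset_f.
  by exists a => //; rewrite !finset.inE andbT; apply: contra ji => /eqP <-; rewrite ja.
apply/asboolP/asboolP => -[nI fI]; split.
- by move=> /h.
- by move=> _ /imsetP[i _ ->]; rewrite -gD; apply/h/fI; rewrite finset.inE.
- by move=> /h.
- by move=> i _; apply/h; rewrite gD; apply: fI; exact: imset_f.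
Qed.

Lemma measurable_hollow_tuples k : measurable (hollow_tuples k : set (k.+3.-tuple E)).
Proof.
have -> : (hollow_tuples k : set (k.+3.-tuple E)) =
    ~` [set t | cechx (tnth t) (finset.setT : {set 'I_k.+3})] `&`
    \bigcap_(i in [set: 'I_k.+3]) [set t | cechx (tnth t) (finset.setT :\ i)%SET].
  apply/seteqP; split => t /=.
    by move=> /asboolP[nt ft]; split => // i _; apply: ft; rewrite finset.inE.
  by move=> [nt ft]; apply/asboolP; split => // i _; exact: ft.
apply: measurableI; first by apply: measurableC; exact: measurable_cechx.
apply: fin_bigcap_measurable => [|i _]; first exact: finite_finset.
exact: measurable_cechx.
Qed.

Lemma measurable_close_tuples m : measurable (close_tuples m : set (m.-tuple E)).
Proof.
have -> : (close_tuples m : set (m.-tuple E)) = \bigcap_(i in [set: 'I_m]) \bigcap_(j in [set: 'I_m])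
    [set t : m.-tuple E | edist (tnth t i) (tnth t j) <= 6].
  by apply/seteqP; split => t h i => [_ j _|j]; [exact: h|exact: (h i I j I)].
apply: fin_bigcap_measurable => [|i _]; first exact: finite_finset.
apply: fin_bigcap_measurable => [|j _]; first exact: finite_finset.
have -> : [set t : m.-tuple E | edist (tnth t i) (tnth t j) <= 6] =
    (fun t : m.-tuple E => edist (tnth t i) (tnth t j)) @^-1` `]-oo, 6]%classic.
  by apply/seteqP; split => t /=; rewrite in_itv.
apply: measurable_preimageT => //; apply: measurable_edist; exact: measurable_tnth.
Qed.

Lemma hollow_tuples_tadd k (v : E) t :
  hollow_tuples k [tuple tadd v (tnth t i) | i < k.+3] <-> hollow_tuples k t.
Proof.
have -> : hollow_tuples k [tuple tadd v (tnth t i) | i < k.+3] =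
    hollowx (fun i => tadd v (tnth t i)) finset.setT.
  by congr (is_true (hollowx _ _)); apply/funext => i; rewrite tnth_mktuple.
rewrite (@hollowx_isometry _ _ _ (tadd (tscale (-1) v)))//.
  exact: edist_tadd.
exact: taddK.
Qed.

Lemma hollow_tuples_householder k (u : E) t :
  hollow_tuples k [tuple householder u (tnth t i) | i < k.+3] <-> hollow_tuples k t.
Proof.
have -> : hollow_tuples k [tuple householder u (tnth t i) | i < k.+3] =
    hollowx (fun i => householder u (tnth t i)) finset.setT.
  by congr (is_true (hollowx _ _)); apply/funext => i; rewrite tnth_mktuple.
rewrite (@hollowx_isometry _ _ _ (householder u))//.
  exact: edist_householder.
exact: householderK.
Qed.

Lemma close_tuples_tadd m (v : E) t :
  close_tuples m [tuple tadd v (tnth t i) | i < m] <-> close_tuples m t.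
Proof.
by split=> h i j; have := h i j; rewrite !tnth_mktuple edist_tadd.
Qed.

Lemma close_tuples_householder m (u : E) t :
  close_tuples m [tuple householder u (tnth t i) | i < m] <-> close_tuples m t.
Proof.
by split=> h i j; have := h i j; rewrite !tnth_mktuple edist_householder.
Qed.

Lemma hollow_tuples_bounded k (t : k.+3.-tuple E) : hollow_tuples k t ->
  forall i, edist (tnth t ord0) (tnth t i) <= 2.
Proof.
by move=> ht i; apply: (hollowx_edist _ ht); rewrite ?finset.inE// cardsT card_ord.
Qed.

(** With k+3 distinct points, a Betti number equal to 1 means a minimal nonface; if the
    points are not distinct both sides are false. *)
Lemma T_zeroE k (y : k.+2.-tuple E) :
  T_zero y = `[< hollow_tuples k [tuple of origin :: y] >].
Proof.
rewrite /T_zero (T_set_ximage (x := tnth [tuple of origin :: y]) (I := finset.setT)).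
- by apply/idP/asboolP.
- move=> v; split.
    move=> vY; have /tnthP[i ->] : v \in [tuple of origin :: y].
      by move: vY; rewrite !finmap.inE.
    by exists i; rewrite ?finset.inE.
  move=> [i _ <-]; have : tnth [tuple of origin :: y] i \in [tuple of origin :: y].
    exact: mem_tnth.
  by rewrite !finmap.inE.
- by rewrite cardsT card_ord.
Qed.

End cluster_sets.

(** * Expected numbers of clusters *)

Section lower_integral.
Local Open Scope ereal_scope.
Context {d} {T : measurableType d} {R : realType}.
Variable mu : {measure set T -> \bar R}.

Import HBNNSimple.

(** The integral of a nonnegative function is a supremum over the simple functions
    below it, so it is monotone even where measurability is unknown, as it is for the
    Betti numbers. *)
Lemma ge0_le_integralT (f g : T -> \bar R) : (forall x, 0 <= f x) ->
  (forall x, f x <= g x) -> \int[mu]_x f x <= \int[mu]_x g x.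
Proof.
move=> f0 fg; have g0 x : 0 <= g x by exact: le_trans (fg x).
rewrite !ge0_integralTE//; apply: le_ereal_sup => _ [h hf <-].
by exists h => // x; exact: le_trans (fg x).
Qed.

End lower_integral.

Section expectations.
Context {R : realType} {d : nat} {dO : measure_display} {Omega : measurableType dO}.
Context {P : probability Omega R}.
Local Notation E := (d.-tuple R).
Local Notation lam := (@lebesgue_tuple R d).
Variables (c : R) (X : nat -> {RV P >-> d.-tuple R}).
Hypothesis c_gt0 : 0 < c.
Hypothesis X_density : forall i, has_density (X i) (f_e c).
Hypothesis X_independent : mutually_independent X.

(** The elements of I in increasing order; the default 0 is reached only if I has fewer
    than m elements. *)
Definition index_tuple m n (I : {set 'I_n}) : m.-tuple nat :=
  [tuple nth 0%N (map val (enum I)) i | i < m].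

Lemma index_tupleP m n (I : {set 'I_n}) : #|I| = m ->
  exists g : 'I_m -> 'I_n, [/\ injective g, (g @: finset.setT)%SET = I &
    forall i, tnth (index_tuple m I) i = g i].
Proof.
move=> Im; have [t [ut tI]] := set_tuple Im.
have sz : size (enum I) == m by rewrite -cardE Im.
pose s : m.-tuple 'I_n := Tuple sz.
exists (tnth s); split.
- by apply/tuple_uniqP; exact: enum_uniq.
- apply/setP => j; apply/imsetP/idP => [[i _ ->]|jI].
    by have := mem_tnth i s; rewrite mem_enum.
  have /tnthP[i ->] : j \in s by rewrite mem_enum.
  by exists i; rewrite ?finset.inE.
- move=> i; rewrite tnth_mktuple (nth_map (tnth s i)) ?(eqP sz)//.
  by rewrite [in RHS](tnth_nth (tnth s i)).
Qed.

Definition sample_tuple m n (I : {set 'I_n}) (w : Omega) : m.-tuple E :=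
  [tuple X (tnth (index_tuple m I) i) w | i < m].

Definition outer_cluster m (A : set (m.-tuple E)) (rho : R) : set (m.-tuple E) :=
  A `&` [set t | forall i, rho < enorm (tnth t i)].

Definition cluster_count m (A : set (m.-tuple E)) rho n (w : Omega) : R :=
  \sum_(I : {set 'I_n} | #|I| == m) \1_(outer_cluster A rho) (sample_tuple m I w).

Lemma measurable_outer_cluster m (A : set (m.-tuple E)) rho :
  measurable A -> measurable (outer_cluster A rho).
Proof. by move=> mA; apply: measurableI => //; exact: measurable_outer. Qed.

Lemma measurable_f_e : measurable_fun setT (f_e c : E -> R).
Proof.
apply: measurable_funM => //; apply: (measurableT_comp (@measurable_expR R)).
by apply: measurable_funN; exact: measurable_enorm.
Qed.

Lemma cluster_prob m (A : set (m.+1.-tuple E)) rho n (I : {set 'I_n}) :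
  measurable A -> #|I| = m.+1 ->
  P [set w | outer_cluster A rho (sample_tuple m.+1 I w)] = cluster_mass A c rho.
Proof.
move=> mA Im; have [g [ginj gI gE]] := index_tupleP Im.
have us : uniq (index_tuple m.+1 I).
  by apply/tuple_uniqP => i j; rewrite !gE => ij; apply: ginj; exact: val_inj.
have f0 (x : E) : 0 <= f_e c x by rewrite mulr_ge0 ?expR_ge0 ?ltW.
exact: (joint_law measurable_f_e f0 X_density X_independent us
  (measurable_outer_cluster rho mA)).
Qed.

Lemma measurable_cluster_event m (A : set (m.-tuple E)) rho n (I : {set 'I_n}) :
  measurable A -> measurable [set w | outer_cluster A rho (sample_tuple m I w)].
Proof.
move=> mA; rewrite -[X in measurable X]setTI.
apply: (measurable_vector X (index_tuple m I)) => //.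
exact: measurable_outer_cluster.
Qed.

Lemma cluster_countE m (A : set (m.-tuple E)) rho n w :
  (cluster_count A rho n w)%:E = (\sum_(I : {set 'I_n} | #|I| == m)
    (\1_([set w | outer_cluster A rho (sample_tuple m I w)]) w)%:E)%E.
Proof.
by rewrite /cluster_count -sumEFin; exact: eq_bigr.
Qed.

(** By linearity, all sets of m+1 indices having the same probability cluster_mass. *)
Lemma expectation_cluster_count m (A : set (m.+1.-tuple E)) rho n : measurable A ->
  (\int[P]_w (cluster_count A rho n w)%:E =
   ('C(n, m.+1)%:R)%:E * cluster_mass A c rho)%E.
Proof.
move=> mA.
pose f (I : {set 'I_n}) w : \bar R := if #|I| == m.+1 then
  (\1_([set w | outer_cluster A rho (sample_tuple m.+1 I w)]) w)%:E else 0%E.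
rewrite (eq_integral (fun w => \sum_(I : {set 'I_n}) f I w)%E); last first.
  by move=> w _; rewrite cluster_countE big_mkcond.
rewrite ge0_integral_sum//; last 2 first.
- move=> I; rewrite /f; case: (#|I| == m.+1) => //; apply/measurable_EFinP.
  by apply: measurable_indic; exact: measurable_cluster_event.
- by move=> I w _; rewrite /f; case: ifP => // _; rewrite lee_fin indicE.
transitivity (\sum_(I : {set 'I_n} | #|I| == m.+1) cluster_mass A c rho)%E.
  rewrite [RHS]big_mkcond; apply: eq_bigr => I _; rewrite /f.
  case: eqP => [Im|_]; last by rewrite integral0.
  rewrite integral_indic//; last exact: measurable_cluster_event.
  by rewrite setIT; exact: cluster_prob.
rewrite -[n in 'C(n, _)]card_ord -card_draws mule_natl cardsE.
exact: (@sumr_const _ _ [pred I : {set 'I_n} | #|I| == m.+1]).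
Qed.

End expectations.

(** * Asymptotics of expectations *)

Section asymptotics.
Context {R : realType}.

Lemma cvg_inv_nat : (n%:R : R)^-1 @[n --> \oo] --> (0 : R).
Proof. by rewrite -cvg_shiftS; exact: cvg_harmonic. Qed.

(** The quotient is a product of the m factors 1 - i / n, divided by m`!. *)
Lemma bin_cvg m :
  ('C(n, m)%:R / n%:R ^+ m : R) @[n --> \oo] --> (m`!%:R^-1 : R).
Proof.
have e : \forall n \near \oo, 'C(n, m)%:R / n%:R ^+ m =
    m`!%:R^-1 * \prod_(i < m) (1 - i%:R / n%:R) :> R.
  exists m.+1 => // n /= mn.
  have n0 : n%:R != 0 :> R by rewrite pnatr_eq0 -lt0n (leq_ltn_trans _ mn).
  have -> : \prod_(i < m) (1 - i%:R / n%:R) = (n ^_ m)%:R / n%:R ^+ m :> R.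
    rewrite ffact_prod natr_prod -[X in _ ^+ X]card_ord -prodr_const -prodf_div.
    apply: eq_bigr => i _; rewrite natrB; last by rewrite ltnW// (ltn_trans (ltn_ord i)).
    by field.
  rewrite -bin_ffact natrM.
  have m0 : m`!%:R != 0 :> R by rewrite pnatr_eq0 -lt0n fact_gt0.
  by field; rewrite m0 expf_neq0.
suff cv : m`!%:R^-1 * \prod_(i < m) (1 - i%:R / n%:R) @[n --> \oo] --> (m`!%:R^-1 : R).
  by apply: cvg_trans cv; apply: near_eq_cvg; apply: filterS e => n ->.
rewrite -[X in _ --> X]mulr1; apply: cvgM; first exact: cvg_cst.
have p1 : \prod_(i < m) 1 = 1 :> R by rewrite big1.
rewrite -[X in _ --> X]p1.
apply: (cvg_prod_ord (u := fun i n => 1 - i%:R / n%:R) (l := fun=> 1)) => i; rewrite -[X in _ --> X]subr0; apply: cvgB; first exact: cvg_cst.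
rewrite -[X in _ --> X](mulr0 (i%:R : R)); apply: cvgM; first exact: cvg_cst.
exact: cvg_inv_nat.
Qed.

End asymptotics.

Section expected_limits.
Context {R : realType} {d : nat} {dO : measure_display} {Omega : measurableType dO}.
Context {P : probability Omega R}.
Local Notation E := (d.-tuple R).
Hypothesis d0 : (0 < d)%N.
Variables (c : R) (X : nat -> {RV P >-> d.-tuple R}).
Hypothesis c_gt0 : 0 < c.
Hypothesis X_density : forall i, has_density (X i) (f_e c).
Hypothesis X_independent : mutually_independent X.
Variable r : R^nat.
Hypothesis r_lim : n%:R * expR (- r n) @[n --> \oo] --> (0 : R).

(** As n >= 1, expR (- r n) is at most n * expR (- r n), which tends to 0. *)
Lemma radius_pinfty : r n @[n --> \oo] --> +oo.
Proof.
apply/cvgryPge => B; near=> n.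
have : n%:R * expR (- r n) < expR (- B).
  by near: n; apply: (cvgr_lt _ r_lim); exact: expR_gt0.
have n1 : 1 <= n%:R :> R by rewrite ler1n; near: n; exact: nbhs_infty_ge.
move=> h; have : expR (- r n) < expR (- B).
  by apply: le_lt_trans h; rewrite ler_peMl ?expR_ge0.
by rewrite ltr_expR ltrN2 => /ltW.
Unshelve. all: by end_near. Qed.

Definition scale_factor m n : R :=
  (n%:R ^+ m * r n ^+ d.-1 * expR (- (m%:R * r n)))^-1.

Lemma scale_factor_ge0 m n : 0 <= r n -> 0 <= scale_factor m n.
Proof. by move=> r0; rewrite invr_ge0 !mulr_ge0 ?expR_ge0 ?exprn_ge0. Qed.

Lemma expected_count_cvg m (A : set (m.+1.-tuple E)) (D : R) : measurable A ->
  (forall v t, A [tuple tadd v (tnth t i) | i < m.+1] <-> A t) ->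
  (forall u t, A [tuple householder u (tnth t i) | i < m.+1] <-> A t) ->
  (forall t, A t -> forall i, edist (tnth t ord0) (tnth t i) <= D) ->
  cluster_limit A \is a fin_num /\
  ((scale_factor m.+1 n)%:E * \int[P]_w (cluster_count X A (r n) n w)%:E)%E @[n --> \oo]
    --> ((sphere_area R d * c ^+ m.+1 / (m.+1)`!%:R)%:E * cluster_limit A)%E.
Proof.
move=> mA At Ah Ab.
have [lf cv] := cluster_mass_cvg_pinfty d0 mA At Ah Ab c_gt0 radius_pinfty.
split=> //.
have -> : (fun n => (scale_factor m.+1 n)%:E * \int[P]_w (cluster_count X A (r n) n w)%:E)%E =
   (fun n => ('C(n, m.+1)%:R / n%:R ^+ m.+1)%:E *
     (((r n ^+ d.-1 * expR (- (m.+1%:R * r n)))^-1)%:E * cluster_mass A c (r n)))%E.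
  apply/funext => n; rewrite (expectation_cluster_count c_gt0 X_density X_independent)// !muleA -!EFinM.
  by congr (_%:E * _)%E; rewrite /scale_factor -mulrA invfM; ring.
rewrite mulrC EFinM -muleA; apply: cvgeM => //.
- by rewrite mule_def_fin// fin_numM.
- by apply: cvg_EFin; [exact: nearW|exact: bin_cvg].
Qed.

(** Clusters with one more point are rarer by the factor n * expR (- r n). *)
Lemma expected_count_negligible m (B : set (m.+2.-tuple E)) (D : R) : measurable B ->
  (forall v t, B [tuple tadd v (tnth t i) | i < m.+2] <-> B t) ->
  (forall u t, B [tuple householder u (tnth t i) | i < m.+2] <-> B t) ->
  (forall t, B t -> forall i, edist (tnth t ord0) (tnth t i) <= D) ->
  ((scale_factor m.+1 n)%:E * \int[P]_w (cluster_count X B (r n) n w)%:E)%E @[n --> \oo]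
    --> 0%E.
Proof.
move=> mB Bt Bh Bb.
have [lf cv] := expected_count_cvg mB Bt Bh Bb.
have e : \forall n \near \oo,
   ((n%:R * expR (- r n))%:E * ((scale_factor m.+2 n)%:E *
     \int[P]_w (cluster_count X B (r n) n w)%:E) =
   (scale_factor m.+1 n)%:E * \int[P]_w (cluster_count X B (r n) n w)%:E)%E.
  exists 1%N => // n /= n1; rewrite muleA -EFinM; congr (_%:E * _)%E.
  have n0 : n%:R != 0 :> R by rewrite pnatr_eq0 -lt0n.
  rewrite /scale_factor exprS.
  have -> : expR (- (m.+2%:R * r n)) = expR (- r n) * expR (- (m.+1%:R * r n)).
    by rewrite -expRD; congr expR; rewrite -[m.+2%:R]natr1; lra.
  have e0 : expR (- r n) != 0 by rewrite lt0r_neq0// expR_gt0.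
  set a := expR (- r n); set b := expR (- (m.+1%:R * r n)).
  rewrite -[n%:R * n%:R ^+ m.+1 * _ * _](_ : (n%:R * a) * (n%:R ^+ m.+1 * r n ^+ d.-1 * b) = _).
    by rewrite [in LHS]invfM mulrA divff ?mul1r// mulf_neq0.
  by ring.
suff cv0 : ((n%:R * expR (- r n))%:E * ((scale_factor m.+2 n)%:E *
     \int[P]_w (cluster_count X B (r n) n w)%:E))%E @[n --> \oo] --> 0%E.
  exact: cvg_trans (near_eq_cvg e) cv0.
set l := (X in _ --> X) in cv.
rewrite -[X in _ --> X](mul0e l); apply: cvgeM => //.
- by rewrite mule_def_fin// fin_numM.
- by apply: cvg_EFin; [exact: nearW|exact: r_lim].
Qed.

(** A quantity that differs from the number of A-clusters by at most a multiple of the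
    number of larger clusters has the same asymptotic expectation. *)
Lemma expectation_squeeze m (A : set (m.+1.-tuple E)) (B : set (m.+2.-tuple E))
    (D K : R) (b : nat -> Omega -> nat) :
  (forall n, 0 <= r n) -> 0 <= K -> measurable A ->
  (forall v t, A [tuple tadd v (tnth t i) | i < m.+1] <-> A t) ->
  (forall u t, A [tuple householder u (tnth t i) | i < m.+1] <-> A t) ->
  (forall t, A t -> forall i, edist (tnth t ord0) (tnth t i) <= D) ->
  measurable B ->
  (forall v t, B [tuple tadd v (tnth t i) | i < m.+2] <-> B t) ->
  (forall u t, B [tuple householder u (tnth t i) | i < m.+2] <-> B t) ->
  (forall t, B t -> forall i, edist (tnth t ord0) (tnth t i) <= D) ->
  (forall n w, (b n w)%:R <= cluster_count X A (r n) n w + K * cluster_count X B (r n) n w) ->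
  (forall n w, cluster_count X A (r n) n w <= (b n w)%:R + K * cluster_count X B (r n) n w) ->
  ((scale_factor m.+1 n)%:E * 'E_P[fun w => (b n w)%:R])%E @[n --> \oo]
    --> ((sphere_area R d * c ^+ m.+1 / (m.+1)`!%:R)%:E * cluster_limit A)%E.
Proof.
move=> r0 K0 mA At Ah Ab mB Bt Bh Bb ub lb.
have [lf cA] := expected_count_cvg mA At Ah Ab.
have cB := expected_count_negligible mB Bt Bh Bb.
pose SA n w := cluster_count X A (r n) n w.
pose SB n w := cluster_count X B (r n) n w.
have mcount k (C : set (k.-tuple E)) n : measurable C ->
    measurable_fun setT (cluster_count X C (r n) n : Omega -> R).
  move=> mC; have -> : cluster_count X C (r n) n = fun w => \sum_(I : {set 'I_n})
      (if #|I| == k then \1_([set w | outer_cluster C (r n) (sample_tuple X k I w)]) w else 0).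
    by apply/funext => w; rewrite /cluster_count big_mkcond.
  apply: measurable_sum => I; case: (#|I| == k); last exact: measurable_cst.
  by apply: measurable_indic; exact: measurable_cluster_event.
have count0 k (C : set (k.-tuple E)) n w : 0 <= cluster_count X C (r n) n w.
  by apply: sumr_ge0 => I _; rewrite indicE.
have KB n : (\int[P]_w (K * SB n w)%:E = K%:E * \int[P]_w (SB n w)%:E)%E.
  under eq_integral do rewrite EFinM.
  rewrite ge0_integralZl_EFin//.
  - by move=> w _; rewrite lee_fin count0.
  - by apply/measurable_EFinP; exact: mcount.
have Eb n : ('E_P[fun w => (b n w)%:R] = \int[P]_w ((b n w)%:R)%:E)%E by rewrite unlock.
have upper n : ('E_P[fun w => (b n w)%:R] <=
    \int[P]_w (SA n w)%:E + K%:E * \int[P]_w (SB n w)%:E)%E.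
  rewrite Eb -KB -ge0_integralD//; last 4 first.
  - by move=> w _; rewrite lee_fin count0.
  - by apply/measurable_EFinP; exact: mcount.
  - by move=> w _; rewrite lee_fin mulr_ge0// count0.
  - by apply/measurable_EFinP; apply: measurable_funM => //; exact: mcount.
  by apply: ge0_le_integralT => w; rewrite lee_fin ?ub.
have lower n : (\int[P]_w (SA n w)%:E <=
    'E_P[fun w => (b n w)%:R] + K%:E * \int[P]_w (SB n w)%:E)%E.
  (* The truncated difference is nonnegative, measurable and below b; it replaces b
     in the additivity of the integral. *)
  pose g w : R := Num.max 0 (SA n w - K * SB n w).
  have mg : measurable_fun setT g.
    apply: measurable_maxr => //; apply: measurable_funB; first exact: mcount.
    by apply: measurable_funM => //; exact: mcount.
  have g0 w : 0 <= g w by rewrite le_max lexx.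
  apply: (@le_trans _ _ (\int[P]_w (g w)%:E + K%:E * \int[P]_w (SB n w)%:E))%E.
    rewrite -KB -ge0_integralD//; last 4 first.
    - by move=> w _; rewrite lee_fin.
    - by apply/measurable_EFinP.
    - by move=> w _; rewrite lee_fin mulr_ge0// count0.
    - by apply/measurable_EFinP; apply: measurable_funM => //; exact: mcount.
    apply: ge0_le_integralT => w; rewrite lee_fin ?count0//.
    have : SA n w - K * SB n w <= g w by rewrite le_max lexx orbT.
    lra.
  apply: leeD => //; rewrite Eb; apply: ge0_le_integralT => w; rewrite lee_fin//.
  by rewrite ge_max ler0n/= lerBlDr lb.
have sB0 n : (0 <= \int[P]_w (SB n w)%:E)%E.
  by apply: integral_ge0 => w _; rewrite lee_fin count0.
have cKB : (K%:E * ((scale_factor m.+1 n)%:E * \int[P]_w (SB n w)%:E))%E @[n --> \oo] --> 0%E.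
  by rewrite -[X in _ --> X](mule0 K%:E); apply: cvgeZl.
have SBfin : \forall n \near \oo, ((K%:E * ((scale_factor m.+1 n)%:E * \int[P]_w (SB n w)%:E))%E) \is a fin_num.
  exact: cvg_is_fine cKB.
set L := (X in _ --> X) in cA *.
have Lfin : L \is a fin_num by rewrite fin_numM.
apply: (@squeeze_cvge _ _ _ _
  (fun n => (scale_factor m.+1 n)%:E * \int[P]_w (SA n w)%:E -
     K%:E * ((scale_factor m.+1 n)%:E * \int[P]_w (SB n w)%:E))%E
  _ (fun n => (scale_factor m.+1 n)%:E * \int[P]_w (SA n w)%:E +
     K%:E * ((scale_factor m.+1 n)%:E * \int[P]_w (SB n w)%:E))%E).
- near=> n; have sf0 := scale_factor_ge0 m.+1 (r0 n); apply/andP; split.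
    rewrite leeBlDr; last by near: n.
    rewrite muleCA -ge0_muleDr//; last 2 first.
    + by rewrite Eb; apply: integral_ge0 => w _; rewrite lee_fin.
    + by rewrite mule_ge0.
    by apply: lee_wpmul2l; rewrite ?lee_fin// lower.
  rewrite muleCA -ge0_muleDr//; last 2 first.
  + by apply: integral_ge0 => w _; rewrite lee_fin count0.
  + by rewrite mule_ge0.
  by apply: lee_wpmul2l; rewrite ?lee_fin// upper.
- rewrite -[X in _ --> X]sube0; by apply: cvgeB => //; exact: fin_num_adde_defl.
- rewrite -[X in _ --> X]adde0; by apply: cvgeD => //; exact: fin_num_adde_defl.
Unshelve. all: by end_near. Qed.

End expected_limits.

(** * From configurations to Betti numbers *)

Section counting.
Context {R : realType} {d : nat} {dO : measure_display} {Omega : measurableType dO}.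
Context {P : probability Omega R}.
Local Notation E := (d.-tuple R).
Variables (X : nat -> {RV P >-> d.-tuple R}) (rho : R) (n : nat) (w : Omega).

Let x (i : 'I_n) : E := X i w.
Let O : {set 'I_n} := [set i | rho < enorm (x i)]%SET.

Lemma sample_outsideP (v : E) :
  v \in [fset y in sample X n w | y \in ~` eball rho origin]%fset <->
  exists2 i, i \in O & x i = v.
Proof.
rewrite !finmap.inE /=; split.
  move=> /andP[/imfsetP[i _ ->]] /set_mem.
  rewrite eball_origin /= => /negP; rewrite -ltNge => hi.
  by exists i => //; rewrite finset.inE.
move=> [i]; rewrite finset.inE => hi <-; apply/andP; split; first by apply/imfsetP; exists i.
by apply/mem_set; rewrite eball_origin /= leNgt hi.
Qed.

(** The sum over index sets of indicators of configurations is a number of index sets,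
    once the property of configurations is read on index sets. *)
Lemma cluster_countP m (A : set (m.-tuple E)) (Q : pred {set 'I_n}) :
  (forall (g : 'I_m -> 'I_n), injective g ->
    A [tuple x (g i) | i < m] <-> Q (g @: finset.setT)%SET) ->
  cluster_count X A rho n w =
  #|[set I : {set 'I_n} | [&& I \subset O, #|I| == m & Q I]]%SET|%:R.
Proof.
move=> AQ; rewrite /cluster_count -sum1_card natr_sum.
rewrite [RHS](eq_bigl (fun I : {set 'I_n} => (#|I| == m) && ((I \subset O) && Q I))); last first.
  by move=> I; rewrite finset.inE andbCA.
rewrite big_mkcondr; apply: eq_bigr => I /eqP Im.
have [g [ginj gI gE]] := index_tupleP Im.
have -> : sample_tuple X m I w = [tuple x (g i) | i < m].
  by apply: eq_from_tnth => i; rewrite [RHS]tnth_mktuple [LHS]tnth_mktuple; congr (X _ w); exact: gE.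
rewrite indicE; have -> // : ([tuple x (g i) | i < m] \in outer_cluster A rho) = (I \subset O) && Q I.
  rewrite -gI; apply/idP/andP.
    rewrite inE => -[/AQ Qg Og]; split; last exact: Qg.
    apply/fintype.subsetP => _ /imsetP[i _ ->]; rewrite finset.inE.
    by have := Og i; rewrite tnth_mktuple.
  move=> [/fintype.subsetP Og Qg]; rewrite inE; split; first by apply/(AQ g ginj).
  by move=> i; rewrite tnth_mktuple; have := Og _ (imset_f g (finset.in_setT i)); rewrite finset.inE.
by case: (_ && _).
Qed.

Lemma cluster_count_hollow k :
  cluster_count X (hollow_tuples k) rho n w = #|hollows x O k.+3|%:R.
Proof.
apply: cluster_countP => g ginj; rewrite -(hollowx_imset x ginj) /hollow_tuples /=.
have -> : tnth [tuple x (g i) | i < k.+3] = x \o g; last by [].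
by apply/funext => i; rewrite tnth_mktuple.
Qed.

Lemma cluster_count_close m :
  cluster_count X (close_tuples m) rho n w = #|clusters x O m|%:R.
Proof.
rewrite (cluster_countP (Q := fun I => clusterx x m I)) => [|g ginj].
  congr (_%:R); apply: eq_card => I; rewrite !finset.inE /clusterx; congr (_ && _).
  by rewrite andbA andbb.
rewrite /clusterx card_imset// cardsT card_ord eqxx /=; split.
  move=> h; apply/forall_inP => _ /imsetP[i _ ->]; apply/forall_inP => _ /imsetP[j _ ->].
  by have := h i j; rewrite !tnth_mktuple.
move=> /forall_inP h i j; rewrite !tnth_mktuple.
by have /forall_inP := h _ (imset_f g (finset.in_setT i)); apply; exact: imset_f.
Qed.

Lemma cluster_count_points : cluster_count X (setT : set (1.-tuple E)) rho n w = #|O|%:R.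
Proof.
rewrite (cluster_countP (Q := xpredT)) => [|//].
rewrite -(card_imset _ (@finset.set1_inj 'I_n)); congr (_%:R); apply: eq_card => I.
rewrite finset.inE andbT; apply/andP/imsetP => [[IO /cards1P[i Ii]]|[i iO ->]].
  by exists i => //; rewrite Ii finset.sub1set in IO.
by rewrite finset.sub1set iO finset.cards1.
Qed.

End counting.

(** A single point has no relative position: what remains is the integral of
    expR (- t) over the positive half-line. *)
Lemma cluster_limit_points (R : realType) (d : nat) :
  cluster_limit (setT : set (1.-tuple (d.-tuple R))) = 1%E.
Proof.
rewrite /cluster_limit -[RHS](integral_expR_div ltr01); apply: eq_integral => t _.
rewrite (eq_integral (cst (expR (- (t / 1)))%:E)); last first.
  move=> y _; rewrite /limit_integrand /pinned indicT !big_ord0 mulr1 mul1r addr0 mul1r divr1//.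
by rewrite integral_cst//= /tuple_measure /dirac indicT mule1.
Qed.

Lemma hollow_limit (R : realType) (d k : nat) (c : R) :
  mu_e d c k.+1 = ((sphere_area R d * c ^+ k.+3 / (k.+3)`!%:R)%:E *
    cluster_limit (hollow_tuples k : set (k.+3.-tuple (d.-tuple R))))%E.
Proof.
congr (_ * _)%E; apply: eq_integral => t _; apply: eq_integral => y _.
by rewrite /limit_integrand /pinned indicE T_zeroE.
Qed.

Lemma point_limit (R : realType) (d : nat) (c : R) :
  (mu_e0 d c)%:E = ((sphere_area R d * c ^+ 1 / 1`!%:R)%:E *
    cluster_limit (setT : set (1.-tuple (d.-tuple R))))%E.
Proof. by rewrite cluster_limit_points mule1 expr1 divr1. Qed.

Theorem theorem2p4 (R : realType) (d : nat) (d_ge1 : (1 <= d)%N)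
    (c_e : R) (c_e_gt0 : 0 < c_e)
    (c_e_normalizes :
      (\int[lebesgue_tuple d]_x (f_e c_e x)%:E = 1)%E)
    (dO : measure_display) (Omega : measurableType dO)
    (P : probability Omega R)
    (X : nat -> {RV P >-> d.-tuple R})
    (X_density : forall i, has_density (X i) (f_e c_e))
    (X_independent : mutually_independent X)
    (r : R^nat) (r_gt0 : forall n, 0 < r n)
    (r_lim : n%:R * expR (- r n) @[n --> \oo] --> (0 : R)) :
  (((n%:R * r n ^+ d.-1 * expR (- r n))^-1)%:E *
     'E_P[fun w => (betti_outside X r 0 n w)%:R])%E @[n --> \oo]
    --> (mu_e0 d c_e)%:E
  /\
  forall k : nat, (1 <= k)%N ->
    (((n%:R ^+ k.+2 * r n ^+ d.-1 * expR (- (k.+2%:R * r n)))^-1)%:E *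
       'E_P[fun w => (betti_outside X r k n w)%:R])%E @[n --> \oo]
      --> mu_e d c_e k.
Proof.
have r0 n : 0 <= r n by exact: ltW.
split.
  have -> : (fun n => (((n%:R * r n ^+ d.-1 * expR (- r n))^-1)%:E *
      'E_P[fun w => (betti_outside X r 0 n w)%:R])%E) =
    (fun n => ((scale_factor (d := d) r 1 n)%:E *
      'E_P[fun w => (betti_outside X r 0 n w)%:R])%E).
    by apply/funext => n; rewrite /scale_factor expr1 mul1r.
  rewrite point_limit.
  apply: (expectation_squeeze d_ge1 c_e_gt0 X_density X_independent r_lim
    (B := close_tuples 2) (D := 6) (K := (2 ^ 2)%:R)) => //.
  - by move=> t _ i; rewrite (ord1 i) edistxx.
  - exact: measurable_close_tuples.
  - exact: close_tuples_tadd.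
  - exact: close_tuples_householder.
  - move=> n w; rewrite cluster_count_points cluster_count_close -natrM -natrD ler_nat.
    apply: leq_trans (leq_addr _ _).
    exact: (betti0_cech_le (sample_outsideP X (r n) n w)).
  - move=> n w; rewrite cluster_count_points cluster_count_close -natrM -natrD ler_nat.
    exact: (betti0_cech_ge (sample_outsideP X (r n) n w)).
case=> // k _; rewrite hollow_limit.
apply: (expectation_squeeze d_ge1 c_e_gt0 X_density X_independent r_lim
    (B := close_tuples k.+4) (D := 6) (K := (2 ^ k.+4)%:R)) => //.
- exact: measurable_hollow_tuples.
- exact: hollow_tuples_tadd.
- exact: hollow_tuples_householder.
- move=> t ht i; apply: le_trans (hollow_tuples_bounded ht i) _; lra.
- exact: measurable_close_tuples.
- exact: close_tuples_tadd.
- exact: close_tuples_householder.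
- move=> n w; rewrite cluster_count_hollow cluster_count_close -natrM -natrD ler_nat.
  exact: (betti_cech_le (sample_outsideP X (r n) n w)).
- move=> n w; rewrite cluster_count_hollow cluster_count_close -natrM -natrD ler_nat.
  exact: (betti_cech_ge (sample_outsideP X (r n) n w)).
Qed.
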